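(* Let $n\geq3$ and $s\geq1$. Then $$\dim\sigma_s(F_{(2,1),n})=\begin{cases}\min\left\{\dim\mathbb{S}_{(2,1)}V_n,\ s(2n-2)\right\}-2,&\text{if }(n,s)=(3,2)\text{ or }(4,3),\\ \min\left\{\dim\mathbb{S}_{(2,1)}V_n,\ s(2n-2)\right\}-1,&\text{otherwise}.\end{cases}$$ In particular, the only defective cases are $\sigma_2(F_{(2,1),3})$ and $\sigma_3(F_{(2,1),4})$.
   Context: $V_n$ is an $n$-dimensional complex vector space and $\mathbb{S}_{(2,1)}V_n$ is the irreducible polynomial $\mathrm{GL}(V_n)$-module of highest weight $(2,1)$, of dimension $n(n^2-1)/3$. $F_{(2,1),n}\subseteq\mathbb{P}(\mathbb{S}_{(2,1)}V_n)$ is the unique closed $\mathrm{GL}(V_n)$-orbit (the orbit of the class of a highest-weight vector); it is the flag variety $\mathrm{Fl}(1,2;V_n)$ of pairs $\ell\subset\Pi\subset V_n$ with $\dim\ell=1$, $\dim\Pi=2$, embedded by $\mathcal{O}(1,1)$, of dimension $2n-3$. For an irreducible nondegenerate projective variety $X\subseteq\mathbb{P}(W)$, $\sigma_s(X)$ is the Zariski closure of the union of the linear spans of $s$ points of $X$; its expected dimension is $\min\{s(\dim X+1)-1,\dim\mathbb{P}(W)\}$, and it is called defective if its dimension is strictly smaller than the expected one. *)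

(* Defs.v *)
From HB Require Import structures.
From mathcomp Require Import all_boot all_order all_algebra.
From mathcomp Require Import complex reals.
From mathcomp Require Import mpoly ring.

Set Implicit Arguments.
Unset Strict Implicit.
Unset Printing Implicit Defensive.

Import GRing.Theory.
Local Open Scope ring_scope.

(* Projective space P(W): points are the lines of W; a subset of P(W) is a     *)
(* Prop-valued predicate on points.                                           *)

Section ProjectiveGeometry.
Variables (K : fieldType) (W : vectType K).

Definition proj : Type := {U : {vspace W} | \dim U == 1%N}.

Definition psubset (A B : proj -> Prop) : Prop := forall p, A p -> B p.

Definition poly_eval (f : {mpoly K[\dim {:W}]}) (w : W) : K :=
  f.@[fun i => coord (vbasis {:W}) i w].

Definition zero_locus (I : {mpoly K[\dim {:W}]} -> Prop) (p : proj) : Prop :=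
  forall f, I f -> forall w, w \in val p -> poly_eval f w = 0.

Definition zariski_closed (Z : proj -> Prop) : Prop :=
  exists2 I : {mpoly K[\dim {:W}]} -> Prop,
    (forall f, I f -> exists d : nat, f \is d.-homog) &
    (forall p, Z p <-> zero_locus I p).

Definition zariski_closure (A : proj -> Prop) (p : proj) : Prop :=
  forall Z, zariski_closed Z -> psubset A Z -> Z p.

Definition closed_in (X Y : proj -> Prop) : Prop :=
  exists2 Z, zariski_closed Z & forall p, Y p <-> X p /\ Z p.

(* Irreducibility for the topology induced on Y by P(W). *)
Definition irreducible (Y : proj -> Prop) : Prop :=
  (exists p, Y p) /\
  forall Z1 Z2, zariski_closed Z1 -> zariski_closed Z2 ->
    psubset Y (fun p => Z1 p \/ Z2 p) -> psubset Y Z1 \/ psubset Y Z2.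

(* Y 0, ..., Y d is a strictly increasing chain; values beyond d are unused. *)
Definition irreducible_chain (X : proj -> Prop) (d : nat)
    (Y : nat -> proj -> Prop) : Prop :=
  (forall i, (i <= d)%N -> closed_in X (Y i) /\ irreducible (Y i)) /\
  (forall i, (i < d)%N -> psubset (Y i) (Y i.+1) /\ ~ psubset (Y i.+1) (Y i)).

(* Krull dimension of X for the induced Zariski topology. *)
Definition has_dim (X : proj -> Prop) (d : nat) : Prop :=
  (exists Y, irreducible_chain X d Y) /\
  (forall e Y, irreducible_chain X e Y -> (e <= d)%N).

Definition secant_variety (s : nat) (X : proj -> Prop) : proj -> Prop :=
  zariski_closure (fun p => exists x : 'I_s -> proj,
    (forall i, X (x i)) /\ (val p <= \sum_(i < s) val (x i))%VS).

(* For W <> 0, dim P(W) = dim W - 1. *)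
Definition expected_dim (s dimX : nat) : nat :=
  minn (s * (dimX + 1) - 1) (\dim {:W} - 1).

Definition defective (s : nat) (X : proj -> Prop) : Prop :=
  exists dimX d : nat, [/\ has_dim X dimX, has_dim (secant_variety s X) d &
    (d < expected_dim s dimX)%N].

End ProjectiveGeometry.

Section SchurModule.
Variables (K : fieldType) (n : nat).

(* V^{(x)3} for V = K^n: t (i, j, k) is the coefficient of e_i (x) e_j (x) e_k. *)
Local Notation tensor3 := {ffun 'I_n * 'I_n * 'I_n -> K^o}.

(* The Young symmetrizer (1 + (1 2)) (1 - (1 3)), acting by                    *)
(*   v1 (x) v2 (x) v3 |-> v1 (x) v2 (x) v3 + v2 (x) v1 (x) v3                  *)
(*                        - v3 (x) v2 (x) v1 - v3 (x) v1 (x) v2.               *)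
Definition young21 (t : tensor3) : tensor3 :=
  [ffun x => let: (i, j, k) := x in
     t (i, j, k) + t (j, i, k) - t (k, j, i) - t (j, k, i)].

Lemma young21_is_linear : linear young21.
Proof.
move=> a t u; apply/ffunP => -[[i j] k]; rewrite !ffunE /=.
by rewrite /GRing.scale /=; ring.
Qed.

HB.instance Definition _ :=
  GRing.isLinear.Build K tensor3 tensor3 *:%R young21 young21_is_linear.

(* S_(2,1) V by Weyl's construction. *)
Definition schur21 : {vspace tensor3} := limg (linfun young21).

Definition gl_tensor3 (g : 'M[K]_n) (t : tensor3) : tensor3 :=
  [ffun x => let: (a, b, c) := x in
     \sum_(i < n) \sum_(j < n) \sum_(k < n)
        g a i * g b j * g c k * t (i, j, k)].

Definition gl_schur21 (g : 'M[K]_n) (u : subvs_of schur21) : subvs_of schur21 :=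
  vsproj schur21 (gl_tensor3 g (vsval u)).

Lemma gl_tensor3_young21 (g : 'M[K]_n) (t : tensor3) :
  gl_tensor3 g (young21 t) = young21 (gl_tensor3 g t).
Proof.
apply/ffunP => -[[a b] c]; rewrite !ffunE /=.
have E2 : \sum_(i < n) \sum_(j < n) \sum_(k < n)
    g b i * g a j * g c k * t (i, j, k) =
    \sum_(i < n) \sum_(j < n) \sum_(k < n)
    g a i * g b j * g c k * t (j, i, k) :> K.
  rewrite exchange_big; do 3!apply: eq_bigr => ? _; by ring.
have E3 : \sum_(i < n) \sum_(j < n) \sum_(k < n)
    g c i * g b j * g a k * t (i, j, k) =
    \sum_(i < n) \sum_(j < n) \sum_(k < n)
    g a i * g b j * g c k * t (k, j, i) :> K.
  under eq_bigr do rewrite exchange_big.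
  rewrite exchange_big; apply: eq_bigr => ? _.
  rewrite exchange_big; do 2!apply: eq_bigr => ? _; by ring.
have E4 : \sum_(i < n) \sum_(j < n) \sum_(k < n)
    g b i * g c j * g a k * t (i, j, k) =
    \sum_(i < n) \sum_(j < n) \sum_(k < n)
    g a i * g b j * g c k * t (j, k, i) :> K.
  under eq_bigr do rewrite exchange_big.
  rewrite exchange_big; do 3!apply: eq_bigr => ? _; by ring.
rewrite E2 E3 E4 -big_split /= -!sumrB; apply: eq_bigr => i _.
rewrite -big_split /= -!sumrB; apply: eq_bigr => j _.
rewrite -big_split /= -!sumrB; apply: eq_bigr => k _.
by rewrite !ffunE /=; ring.
Qed.

(* The GL(V)-action on tensors preserves S_(2,1) V, so vsproj loses nothing.   *)
Lemma vsval_gl_schur21 (g : 'M[K]_n) (u : subvs_of schur21) :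
  vsval (gl_schur21 g u) = gl_tensor3 g (vsval u).
Proof.
rewrite /gl_schur21 vsprojK //.
have /memv_imgP[t _ ->] := subvsP u.
by rewrite lfunE /= gl_tensor3_young21 -(lfunE young21) memv_img ?memvf.
Qed.

(* The Borel subgroup of invertible upper triangular matrices acts on u by the *)
(* character b |-> b_11 ^ 2 * b_22.                                            *)
Definition highest_weight_vector21 (u : subvs_of schur21) : Prop :=
  u != 0 /\
  forall b : 'M[K]_n, b \in unitmx -> is_trig_mx b^T ->
    gl_schur21 b u = (\prod_(i < n) b i i ^+ nth 0%N [:: 2; 1]%N i) *: u.

Definition flag_variety21 (p : proj (subvs_of schur21)) : Prop :=
  exists g u, [/\ g \in unitmx, highest_weight_vector21 u &
    val p = <[gl_schur21 g u]>%VS].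

End SchurModule.

(* Main.v *)
(* A homogeneous polynomial map K^d -> W whose linear part at a point has rank  *)
(* r makes the closures of the images of a flag of r affine subspaces a chain   *)
(* of length r - 1, while d + 2 forms of one degree on d parameters satisfy a   *)
(* homogeneous relation, which bounds chains from above: so the dimension of a  *)
(* secant variety is governed by the span of generic tangent spaces (Terracini).*)
(*                                                                              *)
(* A functional on S_(2,1) V is a form F(v, w), quadratic in v and linear in w, *)
(* with F(v, v) = 0, and it kills the tangent space at (v, w) iff F is singular *)
(* there.  That s generic singular points impose the expected number of         *)
(* conditions on F is proved by induction from n to n + 3, specializing points  *)
(* to coordinate subspaces L, M, N of codimension 3 (the Brambilla-Ottaviani    *)
(* scheme): the restriction of F to each of them vanishes by induction, and     *)
(* forms vanishing on them are handled in the same way, until only finitely     *)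
(* many systems are left, which are already nonsingular modulo 2.               *)
(*                                                                              *)
(* In the two exceptional cases s = n - 1, so the vectors v_1, ..., v_s lie in  *)
(* a hyperplane H, and the sum of the points lies in Sym^2(H) (x) e + S_(2,1)(H)*)
(* for a fixed e outside H; these spaces depend on too few parameters.          *)

From Stdlib Require Import NArith.
Require Import Defs.
From mathcomp Require Import all_boot all_order all_algebra.
From mathcomp Require Import complex reals.
From mathcomp Require Import mpoly ring zify.

Set Implicit Arguments.
Unset Strict Implicit.
Unset Printing Implicit Defensive.

Import Order.TTheory GRing.Theory Num.Theory.
Local Open Scope ring_scope.

(** * Polynomial functions and the pigeonhole principle *)

(** The cone over the flag variety consists of the tensors [phi v w], cubic in (v, w), and the
    secant variety is the closure of the sums of s of them. Dimension is measured by chains of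
    irreducible closed sets, so both inequalities are statements about chains.

    Upper bounds rest on [chain_bound]: a chain of length e carries forms u_0, ..., u_e of one
    degree whose monomials of equal degree are independent ([chain_independent]), whereas d + 2
    forms pulled back to d parameters satisfy a homogeneous relation ([pigeonhole]); hence e <= d.
    Counting parameters gives [points_bound] and, with linear charts, [ambient_bound]. In the two
    exceptional cases [hyperplane_bound] counts fewer parameters.

    Lower bounds rest on [chain_exists]: a chart whose value and d derivatives at the origin are
    independent produces a chain of length d. By [free_tangents] and [tangent_chain] it then
    suffices that a certain linear system be nonsingular: a form with s general singular points and
    m prescribed zero coordinates is 0 ([determined0]). If m + s (2 n - 2) equals the dimension b of
    the Schur module, the system is square, so any smaller number of points imposes independent
    conditions; and if m = 0, any larger number spans. So for each n one square system and one
    spanning system decide every s ([determined_points]).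

    These systems are obtained by three nested inductions from n to n + 3 ([step0], [step1],
    [step2]), each specializing points to a coordinate subspace of codimension 3. The number of
    unknowns is cubic in n, so after three differences it is constant, and the innermost system
    [determined3] reduces to a single one ([shift3]). The initial systems are integral and are
    checked modulo 2. Since (3, 2) and (4, 3) are singular, the outer induction starts at n = 5, 6,
    7, and n = 3, 4 are treated by hand. *)

Section PolyFun.
Variable K : numFieldType.

Definition polyfun (I : finType) (h : (I -> K) -> K) : Prop :=
  exists P : {mpoly K[#|I|]}, forall a, h a = P.@[fun i => a (enum_val i)].

Variable I : finType.

Lemma polyfun_cst c : @polyfun I (fun=> c).
Proof. by exists c%:MP => a; rewrite mevalC. Qed.

Lemma polyfun_var i : @polyfun I (fun a => a i).
Proof. by exists 'X_(enum_rank i) => a; rewrite mevalXU enum_rankK. Qed.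

Lemma polyfunD (g h : (I -> K) -> K) :
  polyfun g -> polyfun h -> polyfun (fun a => g a + h a).
Proof. by move=> [P hP] [Q hQ]; exists (P + Q) => a; rewrite mevalD hP hQ. Qed.

Lemma polyfunM (g h : (I -> K) -> K) :
  polyfun g -> polyfun h -> polyfun (fun a => g a * h a).
Proof. by move=> [P hP] [Q hQ]; exists (P * Q) => a; rewrite mevalM hP hQ. Qed.

Lemma polyfunN (h : (I -> K) -> K) : polyfun h -> polyfun (fun a => - h a).
Proof. by move=> [P hP]; exists (- P) => a; rewrite mevalN hP. Qed.

Lemma polyfunB (g h : (I -> K) -> K) :
  polyfun g -> polyfun h -> polyfun (fun a => g a - h a).
Proof. by move=> hg hh; apply: polyfunD => //; apply: polyfunN. Qed.

Lemma polyfun_sum (J : Type) (r : seq J) (h : J -> (I -> K) -> K) :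
  (forall j, polyfun (h j)) -> polyfun (fun a => \sum_(j <- r) h j a).
Proof.
move=> hh; have /boolp.choice[P hP] := hh.
by exists (\sum_(j <- r) P j) => a; rewrite raddf_sum; apply: eq_bigr => j _.
Qed.

Lemma polyfun_meval (d : nat) (P : {mpoly K[d]}) (g : 'I_d -> (I -> K) -> K) :
  (forall i, polyfun (g i)) -> polyfun (fun a => P.@[fun i => g i a]).
Proof.
move=> /fin_all_exists[Q hQ]; exists (P \mPo [tuple Q i | i < d]) => a.
by rewrite comp_mpoly_meval; apply: meval_eq => i; rewrite tnth_mktuple hQ.
Qed.

Lemma polyfun_comp (J : finType) (h : (J -> K) -> K) (g : (I -> K) -> J -> K) :
  polyfun h -> (forall j, polyfun (fun a => g a j)) -> polyfun (fun a => h (g a)).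
Proof.
move=> [P hP] hg.
have [Q hQ] := @polyfun_meval _ P (fun i a => g a (enum_val i)) (fun i => hg _).
by exists Q => a; rewrite hP hQ.
Qed.

Lemma polyfun_line (h : (I -> K) -> K) : polyfun h ->
  forall a b, exists Q : {poly K}, forall t, h (fun i => a i + t * b i) = Q.[t].
Proof.
move=> [P hP] a b.
exists (\sum_(m <- msupp P) (P@_m)%:P *
   \prod_(i < #|I|) ((a (enum_val i))%:P + (b (enum_val i)) *: 'X) ^+ m i) => t.
rewrite hP mevalE horner_sum; apply: eq_bigr => m _.
rewrite hornerM hornerC horner_prod; congr (_ * _); apply: eq_bigr => i _.
by rewrite horner_exp !hornerE /= mulrC.
Qed.

Lemma poly_nonroot (r : {poly K}) : r != 0 -> exists t, r.[t] != 0.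
Proof.
move=> r0; apply: boolp.contrapT => nex.
pose rs : seq K := [seq i%:R | i <- iota 0 (size r)].
suff : (size rs < size r)%N by rewrite size_map size_iota ltnn.
apply: max_poly_roots => //.
  apply/allP => _ /mapP[i _ ->]; rewrite /root; apply/negPn/negP => ri.
  by apply: nex; exists i%:R.
by rewrite map_inj_uniq ?iota_uniq //; apply: mulrIn; rewrite oner_eq0.
Qed.

Lemma poly_eval0 (r : {poly K}) : (forall t, r.[t] = 0) -> r = 0.
Proof.
move=> h; apply/eqP; apply: contraT => /poly_nonroot[t].
by rewrite h eqxx.
Qed.

End PolyFun.

Section Pigeonhole.

(* The exponents of the monomial T_0^(m D - |k|) T_1^(k_0) ... T_m^(k_(m-1)),   *)
(* so that the box {0..D-1}^m indexes monomials of constant degree m D.        *)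
Definition box_exp (m D : nat) (k : {ffun 'I_m -> 'I_D}) (j : nat) : nat :=
  if j is j'.+1 then (if insub j' is Some i then val (k i) else 0)%N
  else (m * D - \sum_i k i)%N.

Lemma box_expS m D (k : {ffun 'I_m -> 'I_D}) (i : 'I_m) : box_exp k i.+1 = k i.
Proof. by rewrite /= valK. Qed.

Lemma box_sum m D (k : {ffun 'I_m -> 'I_D}) : (\sum_i k i <= m * D)%N.
Proof.
apply: (@leq_trans (\sum_(i < m) D)%N); last by rewrite sum_nat_const card_ord.
by apply: leq_sum => i _; apply: ltnW.
Qed.

Lemma sum_box_exp m D (k : {ffun 'I_m -> 'I_D}) :
  (\sum_(j < m.+1) box_exp k j = m * D)%N.
Proof.
rewrite big_ord_recl; under eq_bigr do rewrite lift0 box_expS.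
by rewrite subnK // box_sum.
Qed.

Lemma box_exp_inj m D (k k' : {ffun 'I_m -> 'I_D}) :
  (forall j, (j <= m)%N -> box_exp k j = box_exp k' j) -> k = k'.
Proof.
move=> h; apply/ffunP => i; apply/val_inj.
by have := h i.+1 (ltn_ord i); rewrite !box_expS.
Qed.

Lemma card_bmultinom d M : (#|{: 'X_{1..d < M}}| <= M ^ d)%N.
Proof.
have lt (m : 'X_{1..d < M}) i : (bmnm m i < M)%N.
  by apply: leq_ltn_trans (bmdeg m); rewrite mdegE (bigD1 i) //= leq_addr.
pose g (m : 'X_{1..d < M}) := [ffun i : 'I_d => Ordinal (lt m i)].
have g_inj : injective g.
  move=> m m' /ffunP e; apply/val_inj/mnmP => i.
  by have := congr1 val (e i); rewrite !ffunE.
by have := leq_card g g_inj; rewrite card_ffun !card_ord.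
Qed.

Variable K : numFieldType.

Lemma msizeM_leS n (p q : {mpoly K[n]}) a b :
  (msize p <= a.+1)%N -> (msize q <= b.+1)%N -> (msize (p * q) <= (a + b).+1)%N.
Proof.
have [->|p0] := eqVneq p 0; first by rewrite mul0r msize0.
have [->|q0] := eqVneq q 0; first by rewrite mulr0 msize0.
move=> hp hq; rewrite msizeM // -ltnS.
by case: (_ + _)%N (leq_add hp hq) => [|c] //=; rewrite addSn addnS.
Qed.

Lemma msizeX_leS n (p : {mpoly K[n]}) a e :
  (msize p <= a.+1)%N -> (msize (p ^+ e) <= (a * e).+1)%N.
Proof.
move=> hp; elim: e => [|e IH]; first by rewrite expr0 msize1.
by rewrite exprS mulnS; apply: msizeM_leS.
Qed.

(** The box supplies D^(d+1) products, while the coefficients of all their pullbacks, polynomials in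
    d variables of degree linear in D, number O(D^d) even when the finitely many charts t are taken
    together. One relation c therefore serves every t. *)
Lemma pigeonhole (I T : finType) (d : nat) (h : T -> nat -> (I -> K) -> K) :
  #|I| = d -> (forall t j, polyfun (h t j)) ->
  exists D (c : {ffun 'I_d.+1 -> 'I_D} -> K), (exists k, c k != 0) /\
    forall t a, \sum_k c k * \prod_(j < d.+2) h t j a ^+ box_exp k j = 0.
Proof.
move=> <- hh; set m := #|I|.+1; clear d; set d := #|I| in m *.
have /boolp.choice[P hP] : forall t, exists P : nat -> {mpoly K[d]},
    forall j a, h t j a = (P j).@[fun i => a (enum_val i)].
  by move=> t; have /boolp.choice[P hP] := hh t; exists P.
pose S := (\max_t \max_(j < m.+1) msize (P t j))%N.
(* Large enough that #|T| ((m S + 1) D)^d < D^(d+1), where m = d + 1 and S bounds the sizes of the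
   polynomials. *)
pose D := (#|T| * (m * S + 1) ^ d).+1; pose M := (m * D * S).+1.
pose Bx := {ffun 'I_m -> 'I_D}.
pose Q t (k : Bx) := \prod_(j < m.+1) P t j ^+ box_exp k j.
have hQ t k : (msize (Q t k) <= M)%N.
  rewrite /M -(sum_box_exp k) big_distrl /Q /=.
  apply: (big_ind2 (fun (p : {mpoly K[d]}) s => msize p <= s.+1)%N).
  - by rewrite msize1.
  - by move=> p a q b; apply: msizeM_leS.
  - move=> j _; rewrite mulnC; apply: msizeX_leS; apply: leqW.
    apply: leq_trans (leq_bigmax (F := fun t => \max_(j < m.+1) msize (P t j))%N t).
    exact: (leq_bigmax (F := fun j : 'I_m.+1 => msize (P t j))).
pose Mon := (T * 'X_{1..d < M})%type.
(* Rows are products, columns are coefficients in the various charts; the relation is a vector of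
   the left kernel. *)
pose A := \matrix_(x < #|{: Bx}|, y < #|{: Mon}|)
   (Q (enum_val y).1 (enum_val x))@_(bmnm (enum_val y).2).
have ltA : (\rank A < #|{: Bx}|)%N.
  apply: leq_ltn_trans (rank_leq_col _) _.
  rewrite card_prod card_ffun !card_ord expnS.
  apply: (@leq_ltn_trans (#|T| * ((m * S + 1) * D) ^ d)%N).
    rewrite leq_mul2l; apply/orP; right.
    apply: leq_trans (card_bmultinom d M) _.
    have leM : (M <= (m * S + 1) * D)%N.
      by rewrite /M mulnDl mul1n mulnAC -addn1 leq_add2l.
    by elim: (d) => // d' IH; rewrite !expnS leq_mul.
  rewrite expnMn mulnA ltn_mul2r expn_gt0 /=.
  by rewrite /D ltnS leqnn.
have /rowV0Pn[v /sub_kermxP vA v0] : kermx A != 0.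
  by rewrite -mxrank_eq0 mxrank_ker -lt0n subn_gt0.
exists D, (fun k => v 0 (enum_rank k)); split.
  have /rV0Pn[x vx] := v0; by exists (enum_val x); rewrite enum_valK.
move=> t a.
have Q0 : \sum_k v 0 (enum_rank k) *: Q t k = 0.
  apply/mpolyP => mm; rewrite mcoeff0 raddf_sum /=.
  have [lt|ge] := ltnP (mdeg mm) M; last first.
    apply: big1 => k _; rewrite mcoeffZ (_ : _@_mm = 0) ?mulr0 //.
    by apply/memN_msupp_eq0/msize_mdeg_ge; apply: leq_trans (hQ _ _) ge.
  have := congr1 (fun B : 'M_(_, _) => B 0 (enum_rank (t, BMultinom lt))) vA.
  rewrite !mxE => A0; rewrite -[RHS]A0 [RHS](reindex_onto enum_rank enum_val) /=.
    by apply: eq_big => [k|k _]; rewrite ?enum_rankK ?eqxx // mcoeffZ !mxE !enum_rankK.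
  by move=> i _; rewrite enum_valK.
have := congr1 (meval (fun i => a (enum_val i))) Q0.
rewrite meval0 raddf_sum /= => E0; rewrite -[RHS]E0; apply: eq_bigr => k _.
rewrite mevalZ /Q rmorph_prod /=; congr (_ * _); apply: eq_bigr => j _.
by rewrite rmorphXn /= hP.
Qed.
End Pigeonhole.

(** * Projective sets and chains of irreducible closed subsets *)

Section Vanishing.
Variables (K : numFieldType) (W : vectType K).
Local Notation form := {mpoly K[\dim {:W}]}.
Implicit Types (f g : form) (p : proj W) (w : W) (X Y : proj W -> Prop).

Lemma poly_evalM f g w : poly_eval (f * g) w = poly_eval f w * poly_eval g w.
Proof. exact: mevalM. Qed.

Lemma poly_evalX f k w : poly_eval (f ^+ k) w = poly_eval f w ^+ k.
Proof. exact: rmorphXn. Qed.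

Lemma poly_evalZ a f w : poly_eval (a *: f) w = a * poly_eval f w.
Proof. exact: mevalZ. Qed.

Lemma poly_eval_sum (J : Type) (r : seq J) (P : pred J) (F : J -> form) w :
  poly_eval (\sum_(j <- r | P j) F j) w = \sum_(j <- r | P j) poly_eval (F j) w.
Proof. exact: raddf_sum. Qed.

Lemma poly_eval_prod (J : Type) (r : seq J) (P : pred J) (F : J -> form) w :
  poly_eval (\prod_(j <- r | P j) F j) w = \prod_(j <- r | P j) poly_eval (F j) w.
Proof. exact: rmorph_prod. Qed.

Lemma poly_eval_homog f d a w :
  f \is d.-homog -> poly_eval f (a *: w) = a ^+ d * poly_eval f w.
Proof.
move=> /dhomogP hf; rewrite /poly_eval !mevalE mulr_sumr big_seq [RHS]big_seq.
apply: eq_bigr => m /hf /= hm; rewrite mulrCA; congr (_ * _).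
rewrite -hm mdegE -prodrXr -big_split /=; apply: eq_bigr => i _.
by rewrite linearZ /= exprMn.
Qed.

Definition linform (l : W -> K) : form :=
  \sum_(i < \dim {:W}) l (vbasis {:W})`_i *: 'X_i.

Lemma linform_homog l : linform l \is 1.-homog.
Proof. by apply: rpred_sum => i _; apply: dhomogZ; rewrite dhomogX /= mdeg1. Qed.

Lemma linformE (l : {linear W -> K^o}) w : poly_eval (linform l) w = l w.
Proof.
rewrite {2}(coord_vbasis (memvf w)) linear_sum poly_eval_sum.
apply: eq_bigr => i _; rewrite linearZ poly_evalZ /poly_eval mevalXU mulrC.
by [].
Qed.

Definition vanish f p : Prop := forall w, w \in val p -> poly_eval f w = 0.

Lemma projP p : exists2 w, w != 0 & val p = <[w]>%VS.
Proof.
have /eqP dp := valP p.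
have p0 : val p != 0%VS by rewrite -dimv_eq0 dp.
exists (vpick (val p)); first by rewrite vpick0.
apply/esym/eqP; rewrite eqEdim -memvE memv_pick dp dim_vline vpick0.
by rewrite p0.
Qed.

Lemma dim_line_eq1 w : w != 0 -> \dim <[w]> == 1%N.
Proof. by rewrite dim_vline => ->. Qed.

Definition line w (w0 : w != 0) : proj W := exist _ <[w]>%VS (dim_line_eq1 w0).

Lemma vanish_line f d w p : f \is d.-homog -> val p = <[w]>%VS ->
  vanish f p <-> poly_eval f w = 0.
Proof.
move=> hf pw; split=> [|fw w']; first by apply; rewrite pw memv_line.
by rewrite pw => /vlineP[a ->]; rewrite (poly_eval_homog _ _ hf) fw mulr0.
Qed.

Definition homogeneous f : Prop := exists d : nat, f \is d.-homog.

Lemma closure_vanish X p : zariski_closure X p <->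
  forall f, homogeneous f -> (forall q, X q -> vanish f q) -> vanish f p.
Proof.
split=> [hp f hf fX|hp Z [I hI ZI] XZ].
  apply: (hp (zero_locus (fun g => g = f))) => //; last by move=> q /fX fq g ->.
  by exists (fun g => g = f) => [g ->|].
apply/ZI => f If; apply: hp => [|q /XZ /ZI]; first exact: hI.
by apply.
Qed.

Lemma zariski_closure_closed X : zariski_closed (zariski_closure X).
Proof.
exists (fun f => homogeneous f /\ forall q, X q -> vanish f q) => [f []//|p].
rewrite closure_vanish; split=> [hp f [hf fX]|hp f hf fX]; first exact: hp.
exact: hp.
Qed.

Lemma irreducible_vanishM Y f g : irreducible Y -> homogeneous f -> homogeneous g ->
  (forall p, Y p -> vanish (f * g) p) ->
  (forall p, Y p -> vanish f p) \/ (forall p, Y p -> vanish g p).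
Proof.
move=> [_ irr] hf hg fgY.
have cl h : homogeneous h -> zariski_closed (fun p => vanish h p).
  move=> hh; exists (fun h' => h' = h) => [h' ->|p] //.
  by split=> [hp _ ->|]; [|apply].
apply: (irr _ _ (cl _ hf) (cl _ hg)) => p /fgY.
have [w _ pw] := projP p; have [[d fd] [e ge]] := (hf, hg).
have fge : f * g \is (d + e).-homog by apply: dhomogM.
move=> /(vanish_line fge pw) /eqP; rewrite poly_evalM mulf_eq0.
by case/orP => /eqP h; [left|right]; apply/(vanish_line _ pw) => //; [exact: fd|exact: ge].
Qed.

Lemma irreducible_vanishX Y f g k : irreducible Y -> homogeneous f -> homogeneous g ->
  ~ (forall p, Y p -> vanish f p) ->
  (forall p, Y p -> vanish (f ^+ k * g) p) -> forall p, Y p -> vanish g p.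
Proof.
move=> irr hf hg nf; elim: k => [|k IH]; first by rewrite expr0 mul1r.
rewrite exprS -mulrA => /(irreducible_vanishM irr hf)[]//.
have [[d fd] [e ge]] := (hf, hg).
by exists (d * k + e)%N; apply: dhomogM => //; apply: dhomogMn.
Qed.

Section ChainIndependence.
Variables (e M : nat) (Y : nat -> proj W -> Prop) (u : nat -> form).
Hypothesis Y_irr : forall i, (i <= e)%N -> irreducible (Y i).
Hypothesis Y_sub : forall i, (i < e)%N -> psubset (Y i) (Y i.+1).
Hypothesis u_homog : forall i, u i \is M.-homog.
Hypothesis u_nz : forall i, (i <= e)%N -> ~ forall p, Y i p -> vanish (u i) p.
Hypothesis u_van : forall i, (i < e)%N -> forall p, Y i p -> vanish (u i.+1) p.

Definition power_prod (i : nat) (k : nat -> nat) : form := \prod_(j < i) u j ^+ k j.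

Lemma power_prod_homog i k : power_prod i k \is (M * \sum_(j < i) k j).-homog.
Proof.
rewrite /power_prod; elim: i => [|i IH]; first by rewrite !big_ord0 muln0 dhomog1.
by rewrite !big_ord_recr /= mulnDr; apply: dhomogM => //; apply: dhomogMn.
Qed.

(* Induction on i: divide by the smallest power of u_(i+1), then restrict to Y_i, *)
(* where only the terms without u_(i+1) survive.                              *)
Lemma chain_independent (B : finType) i wt (S : {set B}) (c : B -> K) (k : B -> nat -> nat) :
  (i <= e)%N ->
  {in S, forall b, (\sum_(j < i.+1) k b j)%N = wt} ->
  {in S &, forall b b', (forall j, (j <= i)%N -> k b j = k b' j) -> b = b'} ->
  (forall p, Y i p -> vanish (\sum_(b in S) c b *: power_prod i.+1 (k b)) p) ->
  {in S, forall b, c b = 0}.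
Proof.
elim: i wt S k => [|i IH] wt S k ie hwt hinj hvan b bS.
  have S1 : S = [set b].
    apply/setP => b'; rewrite inE; apply/idP/eqP => [b'S|-> //].
    apply: hinj => // j; rewrite leqn0 => /eqP->.
    by have := hwt b bS; rewrite -(hwt b' b'S) !big_ord1 => ->.
  move: hvan; rewrite S1 big_set1 /power_prod big_ord1 => hvan.
  apply/eqP; apply: contra_notT (u_nz (leq0n e)) => cb0.
  have v1 : forall p, Y 0 p -> vanish (1 : form) p.
    apply: (irreducible_vanishX (k := k b 0%N) (Y_irr (leq0n e))
      (ex_intro _ M (u_homog 0)) (ex_intro _ 0%N (dhomog1 _ _)) (u_nz (leq0n e))).
    move=> p Yp w wp.
    have := hvan p Yp w wp; rewrite poly_evalZ mulr1 => /eqP.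
    by rewrite mulf_eq0 (negPf cb0) => /eqP.
  move=> p Yp; have [[q Yq] _] := Y_irr (leq0n e).
  have := v1 q Yq 0 (mem0v _); rewrite /poly_eval meval1 => /eqP.
  by rewrite oner_eq0.
apply/eqP; apply: contraT => cb0.
pose S0 := [set b in S | c b != 0].
have bS0 : b \in S0 by rewrite inE bS.
case: (arg_minnP (fun b => k b i.+1) bS0) => b0 b0S0 hmin.
have {}b0S0 : b0 \in S0 by [].
set m := k b0 i.+1 in hmin.
pose S' := [set b in S0 | k b i.+1 == m].
pose k' b j := if j == i.+1 then (k b j - m)%N else k b j.
pose G := \sum_(b in S0) c b *: power_prod i.+2 (k' b).
have kE b1 j : (j < i.+1)%N -> k' b1 j = k b1 j.
  by move=> ji; rewrite /k' ltn_eqF.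
have GE : u i.+1 ^+ m * G = \sum_(b in S) c b *: power_prod i.+2 (k b).
  rewrite [RHS](bigID (mem S0)) /= [X in _ + X]big1 => [|b1]; last first.
    by rewrite inE => /andP[-> /=]; rewrite negbK => /eqP->; rewrite scale0r.
  rewrite addr0 mulr_sumr; apply: eq_big => [b1|b1 b1S].
    by rewrite !inE; case: (_ \in S).
  rewrite -scalerAr; congr (_ *: _); rewrite /power_prod big_ord_recr [RHS]big_ord_recr /= mulrCA.
  congr (_ * _).
    by apply: eq_bigr => j _; rewrite kE.
  by rewrite -exprD /k' eqxx subnKC // hmin.
have hk b1 : b1 \in S0 -> (\sum_(j < i.+2) k' b1 j)%N = (wt - m)%N.
  move=> b1S; have /setIdP[/hwt <- _] := b1S.
  rewrite big_ord_recr [in RHS]big_ord_recr /= /k' eqxx addnBA ?hmin //; congr (_ + _ - _)%N.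
  by apply: eq_bigr => j _; rewrite ltn_eqF.
have Ghom : G \is (M * (wt - m)).-homog.
  apply: rpred_sum => b1 b1S; apply: dhomogZ; rewrite -(hk b1 b1S).
  exact: power_prod_homog.
have Gvan p : Y i.+1 p -> vanish G p.
  apply: (irreducible_vanishX (k := m) (Y_irr ie) (ex_intro _ M (u_homog i.+1))
    (ex_intro _ (M * (wt - m))%N Ghom) (u_nz ie)).
  by rewrite GE.
suff /(_ b0) : {in S', forall b, c b = 0}.
  rewrite inE b0S0 eqxx => /(_ isT) cb00.
  by move: b0S0; rewrite inE cb00 eqxx andbF.
apply: (IH (wt - m)%N S' k (ltnW ie)) => [b1|b1 b2|p Yp w wp].
- rewrite inE => /andP[b1S0 /eqP kb1]; have := b1S0; rewrite inE => /andP[b1S _].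
  by rewrite -(hwt b1 b1S) [in RHS]big_ord_recr /= kb1 addnK.
- rewrite inE => /andP[b1S0 /eqP kb1]; rewrite inE => /andP[b2S0 /eqP kb2] kk.
  move: b1S0 b2S0; rewrite !inE => /andP[b1S _] /andP[b2S _].
  apply: hinj => // j; rewrite leq_eqVlt => /orP[/eqP->|]; first by rewrite kb1 kb2.
  by rewrite ltnS; apply: kk.
have := Gvan p (Y_sub ie Yp) w wp; rewrite /G !poly_eval_sum.
rewrite (bigID (fun b => k b i.+1 == m)) /= [X in _ + X]big1 => [|b1 /andP[b1S kb1]].
  rewrite addr0 => E0; rewrite -[RHS]E0; apply: eq_big => [b1|b1]; first by rewrite inE.
  rewrite inE => /andP[b1S /eqP kb1]; rewrite !poly_evalZ; congr (_ * _).
  rewrite /power_prod [in RHS]big_ord_recr /= poly_evalM /k' eqxx kb1 subnn expr0.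
  rewrite [poly_eval 1 w]meval1 mulr1; congr (poly_eval _ w); apply: eq_bigr => j _.
  by rewrite ltn_eqF.
rewrite poly_evalZ /power_prod big_ord_recr /= poly_evalM poly_evalX.
rewrite (u_van ie Yp wp) /k' eqxx expr0n subn_eq0 leqNgt ltn_neqAle.
by rewrite eq_sym kb1 hmin //= !mulr0.
Qed.

End ChainIndependence.
End Vanishing.

Section Chains.
Variables (K : numFieldType) (W : vectType K).
Local Notation form := {mpoly K[\dim {:W}]}.
Implicit Types (f g : form) (p : proj W) (w : W) (X : proj W -> Prop).

Lemma irreducible_nvanishM Y f g : irreducible Y -> homogeneous f -> homogeneous g ->
  ~ (forall p, Y p -> vanish f p) -> ~ (forall p, Y p -> vanish g p) ->
  ~ forall p, Y p -> vanish (f * g) p.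
Proof. by move=> irr hf hg nf ng /(irreducible_vanishM irr hf hg)[]. Qed.

Lemma irreducible_nvanishX Y f k : irreducible Y -> homogeneous f ->
  ~ (forall p, Y p -> vanish f p) -> ~ forall p, Y p -> vanish (f ^+ k) p.
Proof.
move=> irr hf nf; rewrite -[f ^+ k]mulr1.
move=> /(irreducible_vanishX irr hf (ex_intro _ 0%N (dhomog1 _ _)) nf) v1.
have [[p Yp] _] := irr; have := v1 p Yp 0 (mem0v _).
by rewrite /poly_eval meval1 => /eqP; rewrite oner_eq0.
Qed.

(** Some equation of Y_i does not vanish on Y_(i+1). The degrees are made equal by powers of a
    coordinate that is nonzero at a point of Y_0, hence vanishes identically on no member of the
    chain; u_0 is such a power itself. *)
Lemma chain_forms X e Y : irreducible_chain X e Y ->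
  exists M (u : nat -> form), [/\ forall i, u i \is M.-homog,
    forall i, (i <= e)%N -> ~ (forall p, Y i p -> vanish (u i) p) &
    forall i, (i < e)%N -> forall p, Y i p -> vanish (u i.+1) p].
Proof.
move=> [hY sY].
have YX i q : (i <= e)%N -> Y i q -> X q.
  by move=> /hY[[Z _ ZE] _] /ZE[].
have Ysub i j : (i <= j)%N -> (j <= e)%N -> psubset (Y i) (Y j).
  elim: j => [|j IH]; first by rewrite leqn0 => /eqP-> _ q.
  rewrite leq_eqVlt ltnS => /orP[/eqP-> _ q|ij je q] // /(IH ij (ltnW je)).
  by case: (sY j je) => h _; apply: h.
have /boolp.choice[g hg] : forall i, exists fd : form * nat, fd.1 \is fd.2.-homog /\
    ((i < e)%N -> (forall p, Y i p -> vanish fd.1 p) /\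
       ~ forall p, Y i.+1 p -> vanish fd.1 p).
  move=> i.
  have [ie|nie] := boolP (i < e)%N; last first.
    by exists (0, 0%N); split=> [|ie]; [exact: rpred0|case/negP: nie].
  have [_ ns] := sY i ie; have [[Z [I hI ZI] ZE] _] := hY i (ltnW ie).
  apply: boolp.contrapT => nex; apply: ns => q Yq.
  have Xq : X q by apply: YX Yq.
  apply/ZE; split=> //; apply/ZI => f If.
  have [d fd] := hI f If.
  apply: boolp.contrapT => nf; apply: nex; exists (f, d); split=> //= _; split.
    by move=> p /ZE[_ /ZI]; apply.
  by move=> hf; apply: nf; apply: hf.
have [[p0 Yp0] _] := (hY 0%N (leq0n e)).2.
have [w0 w0N p0w] := projP p0.
have [x wx] : exists x, coord (vbasis {:W}) x w0 != 0.
  apply/existsP; rewrite -[[exists _, _]]negbK negb_exists; apply: contra w0N => /forallP h.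
  apply/eqP; rewrite (coord_vbasis (memvf w0)); apply: big1 => i _.
  by have := h i; rewrite negbK => /eqP->; rewrite scale0r.
pose l : form := 'X_x.
have hl : homogeneous l by exists 1%N; rewrite dhomogX /= mdeg1.
have lY i : (i <= e)%N -> ~ forall p, Y i p -> vanish l p.
  move=> ie lv; move/eqP: wx; apply.
  have := lv p0 (Ysub 0%N i (leq0n _) ie p0 Yp0) w0.
  by rewrite p0w memv_line /poly_eval mevalXU => /(_ isT).
pose M := (\sum_(i < e) (g i).2).+1.
have dM i : (i < e)%N -> ((g i).2 <= M)%N.
  move=> ie; apply: leqW; rewrite (bigD1 (Ordinal ie)) //=; exact: leq_addr.
have lk k : l ^+ k \is k.-homog.
  by rewrite -{2}[k]mul1n; apply: dhomogMn; rewrite dhomogX /= mdeg1.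
pose u i := if i is i'.+1 then
  if (i' < e)%N then (g i').1 * l ^+ (M - (g i').2) else l ^+ M else l ^+ M.
exists M, u; split.
- case=> [|i] /=; first exact: lk.
  case: ifP => [ie|_]; last exact: lk.
  rewrite -{2}(subnKC (dM i ie)); apply: dhomogM; [exact: (hg i).1|exact: lk].
- have hlk k : homogeneous (l ^+ k) by exists k.
  case=> [|i] ie /=.
    by apply: irreducible_nvanishX => //; [exact: (hY _ ie).2|exact: lY].
  rewrite ie; apply: irreducible_nvanishM => //; first exact: (hY _ ie).2.
  + by exists (g i).2; exact: (hg i).1.
  + exact: ((hg i).2 ie).2.
  + by apply: irreducible_nvanishX => //; [exact: (hY _ ie).2|exact: lY].
- move=> i ie p Yp w wp /=; rewrite ie poly_evalM.
  by rewrite (((hg i).2 ie).1 p Yp w wp) mul0r.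
Qed.

(* The charts Psi t only have to be jointly dense in X. *)
Lemma chain_bound X (I T : finType) (Psi : T -> (I -> K) -> W) :
  (forall t i, polyfun (fun a => coord (vbasis {:W}) i (Psi t a))) ->
  (forall f, homogeneous f -> (forall t a, poly_eval f (Psi t a) = 0) ->
     forall p, X p -> vanish f p) ->
  forall e Y, irreducible_chain X e Y -> (e <= #|I|)%N.
Proof.
move=> hPsi dense e Y chY; rewrite leqNgt; apply/negP => ltIe.
have [M [u [uM u_nz u_van]]] := chain_forms chY.
have [hY sY] := chY.
have pf t j : polyfun (fun a => poly_eval (u j) (Psi t a)).
  exact: polyfun_meval.
(* A chain of length d + 1 would carry d + 2 forms; their relation on the charts holds on X by
   density, against [chain_independent] on Y_(d+1). *)
have [D [c [[k0 ck0] hc]]] := pigeonhole (erefl #|I|) pf.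
set d := #|I| in k0 ck0 hc ltIe *.
suff c0 : {in [set: {ffun 'I_d.+1 -> 'I_D}], forall k, c k = 0}.
  by move/eqP: ck0; apply; apply: c0; rewrite inE.
apply: (@chain_independent K W e M Y u _ _ uM u_nz u_van
  _ d.+1 (d.+1 * D)%N _ c (@box_exp d.+1 D) ltIe).
- by move=> i ie; apply: (hY i ie).2.
- by move=> i ie; have [] := sY i ie.
- by move=> k _; rewrite sum_box_exp.
- by move=> k k' _ _; apply: box_exp_inj.
- have [_ [Z _ ZE]] : True /\ closed_in X (Y d.+1) by split=> //; apply: (hY _ ltIe).1.
  move=> p /ZE[Xp _]; apply: dense Xp.
    exists (M * (d.+1 * D))%N; apply: rpred_sum => k _; apply: dhomogZ.
    by rewrite -(sum_box_exp k); apply: power_prod_homog.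
  move=> t a; rewrite poly_eval_sum -[RHS](hc t a).
  apply: eq_big => [k|k _]; first by rewrite inE.
  rewrite poly_evalZ /power_prod poly_eval_prod; congr (_ * _).
  by apply: eq_bigr => j _; rewrite poly_evalX.
Qed.

End Chains.

(** * Construction of a chain from an affine chart *)

Section Kronecker.
Variable K : numFieldType.

Lemma digits_inj m D (k k' : {ffun 'I_m -> 'I_D}) :
  (\sum_i k i * D ^ i = \sum_i k' i * D ^ i)%N -> k = k'.
Proof.
move=> e; apply/ffunP => i; apply/val_inj => /=; move: i.
suff H : forall (x y : nat -> nat), (forall i, x i < D)%N -> (forall i, y i < D)%N ->
  (\sum_(i < m) x i * D ^ i = \sum_(i < m) y i * D ^ i)%N ->
  forall i, (i < m)%N -> x i = y i.
  move=> i; have D0 : (0 < D)%N by apply: leq_ltn_trans (ltn_ord (k i)).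
  pose ext (z : {ffun 'I_m -> 'I_D}) j := if insub j is Some i then val (z i) else 0%N.
  have extE z (j : 'I_m) : ext z j = z j by rewrite /ext valK.
  have extD z j : (ext z j < D)%N by rewrite /ext; case: insub => [i0|] /=.
  rewrite -(extE k) -(extE k'); apply: H => //.
  rewrite (eq_bigr (fun j : 'I_m => (k j * D ^ j)%N)) => [|j _]; last by rewrite extE.
  by rewrite e; apply: eq_bigr => j _; rewrite extE.
elim: m {k k' e} => [//|m IH] x y hx hy.
have D0 : (0 < D)%N by apply: leq_ltn_trans (hx 0%N).
have sE (z : nat -> nat) : (\sum_(i < m.+1) z i * D ^ i =
    (\sum_(i < m) z i.+1 * D ^ i) * D + z 0)%N.
  rewrite big_ord_recl expn0 muln1 addnC; congr (_ + _)%N; rewrite big_distrl.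
  by apply: eq_bigr => i _; rewrite lift0 expnS mulnCA mulnC.
rewrite !sE => e.
have e0 : x 0%N = y 0%N.
  by have := congr1 (modn^~ D) e; rewrite !modnMDl !modn_small.
move: e; rewrite e0 => /addIn /eqP; rewrite eqn_pmul2r // => /eqP.
move=> /(IH (x \o succn) (y \o succn) (fun i => hx i.+1) (fun i => hy i.+1)) h.
by case=> [//|i]; apply: h.
Qed.

(** Kronecker's substitution x_i = t^(D^i) sends distinct monomials of the box to distinct powers of
    t. *)
Lemma box_poly_eq0 m D (P : pred {ffun 'I_m -> 'I_D}) (c : {ffun 'I_m -> 'I_D} -> K) :
  (forall x : 'I_m -> K, \sum_(k | P k) c k * \prod_i x i ^+ k i = 0) ->
  forall k, P k -> c k = 0.
Proof.
move=> h k Pk.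
pose r : {poly K} := \sum_(k | P k) c k *: 'X^(\sum_i k i * D ^ i).
have r0 : r = 0.
  apply: poly_eval0 => t; rewrite horner_sum -[RHS](h (fun i => t ^+ (D ^ i))).
  apply: eq_bigr => k' _; rewrite hornerZ hornerXn; congr (_ * _).
  by rewrite -prodrXr; apply: eq_bigr => i _; rewrite -exprM mulnC.
have := congr1 (coefp (\sum_i k i * D ^ i)) r0.
rewrite /= coef0 coef_sum (bigD1 k) //= coefZ coefXn eqxx mulr1 big1 ?addr0 //.
move=> k' /andP[_ kk']; rewrite coefZ coefXn; case: eqP => [/digits_inj e|]; last by rewrite mulr0.
by rewrite e eqxx in kk'.
Qed.

(* Lowest-order term in eps, after dehomogenizing by the first factor. *)
Lemma box_form_eq0 m D (c : {ffun 'I_m -> 'I_D} -> K) (A0 : ('I_m -> K) -> {poly K})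
    (A : ('I_m -> K) -> 'I_m -> {poly K}) :
  (forall x, (A0 x).[0] = 1) -> (forall x i, (A x i).[0] = x i) ->
  (forall x e, \sum_k c k * ((A0 x).[e] ^+ box_exp k 0 *
     \prod_i (e * (A x i).[e]) ^+ k i) = 0) ->
  forall k, c k = 0.
Proof.
move=> hA0 hA h k; apply/eqP; apply: contraT => ck.
pose wt (k : {ffun 'I_m -> 'I_D}) := (\sum_i k i)%N.
case: (@arg_minnP _ k (fun k => c k != 0) wt ck) => k0 ck0 hmin.
suff : forall k, wt k == wt k0 -> c k = 0.
  by move=> /(_ k0 (eqxx _)) c0; rewrite c0 eqxx in ck0.
apply: box_poly_eq0 => x.
(* The relation divided by e^(wt k0); at e = 0 only the terms of minimal weight remain, evaluated at
   x. *)
pose R : {poly K} := \sum_(k | c k != 0)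
  (c k)%:P * 'X^(wt k - wt k0) * (A0 x ^+ box_exp k 0 * \prod_i A x i ^+ k i).
have R0 : R = 0.
  suff : 'X^(wt k0) * R = 0.
    by move/eqP; rewrite mulf_eq0 expf_eq0 polyX_eq0 andbF => /eqP.
  apply: poly_eval0 => e; rewrite hornerM hornerXn horner_sum -[RHS](h x e) mulr_sumr.
  rewrite [RHS](bigID (fun k => c k != 0)) /= [X in _ + X]big1 ?addr0; last first.
    by move=> k1; rewrite negbK => /eqP->; rewrite mul0r.
  apply: eq_bigr => k1 ck1; rewrite !hornerM hornerC hornerXn horner_exp horner_prod.
  have -> : \prod_i (e * (A x i).[e]) ^+ k1 i = e ^+ wt k1 * \prod_i (A x i).[e] ^+ k1 i.
    by rewrite -prodrXr -big_split /=; apply: eq_bigr => i _; rewrite exprMn.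
  rewrite -{2}(subnKC (hmin _ ck1)) exprD.
  have -> : \prod_i (A x i ^+ k1 i).[e] = \prod_i (A x i).[e] ^+ k1 i.
    by apply: eq_bigr => i _; rewrite horner_exp.
  by ring.
have := congr1 (horner^~ 0) R0; rewrite horner0 /R horner_sum => E0.
rewrite -[RHS]E0 (bigID (fun k => c k != 0)) /= [X in _ + X]big1 ?addr0; last first.
  by move=> k1 /andP[_]; rewrite negbK => /eqP->; rewrite mul0r.
rewrite [RHS](bigID (fun k => wt k == wt k0)) /= [X in _ = _ + X]big1 ?addr0; last first.
  move=> k1 /andP[ck1 ne]; rewrite !hornerM hornerXn expr0n subn_eq0 leqNgt ltn_neqAle.
  by rewrite eq_sym ne hmin //= mulr0 mul0r.
apply: eq_big => [k1|k1 /andP[/eqP e _]]; first by rewrite andbC.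
rewrite !hornerM hornerC hornerXn e subnn expr0 mulr1 horner_exp hA0 expr1n mul1r.
by rewrite horner_prod; congr (_ * _); apply: eq_bigr => i _; rewrite horner_exp hA.
Qed.

End Kronecker.

Section ChainExists.
Variables (K : numFieldType) (W : vectType K) (X : proj W -> Prop).
Variables (d : nat) (Theta : ('I_d -> K) -> W) (theta : 'I_d -> W).
Local Notation form := {mpoly K[\dim {:W}]}.

Hypothesis poly_Theta : forall i, polyfun (fun a => coord (vbasis {:W}) i (Theta a)).
Hypothesis free_theta : free (Theta (fun=> 0) :: [tuple theta i | i < d]).
Hypothesis expand : forall x, exists r1 r2, forall e,
  Theta (fun i => e * x i) =
  Theta (fun=> 0) + e *: (\sum_i x i *: theta i) + e ^+ 2 *: r1 + e ^+ 3 *: r2.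
Hypothesis Theta_X : forall a (a0 : Theta a != 0), X (line a0).

Definition flag_image (j : nat) (p : proj W) : Prop :=
  exists a, [/\ forall i : 'I_d, (j <= i)%N -> a i = 0, Theta a != 0 &
    val p = <[Theta a]>%VS].

Definition flag_chain (j : nat) (p : proj W) : Prop :=
  X p /\ zariski_closure (flag_image j) p.

Lemma polyfun_linear (l : {linear W -> K^o}) : polyfun (fun a => l (Theta a)).
Proof.
pose P := linform l.
have [Q hQ] : polyfun (fun a => poly_eval P (Theta a)) by apply: polyfun_meval.
by exists Q => a; rewrite -hQ linformE.
Qed.

Lemma polyfun_poly_eval f : polyfun (fun a => poly_eval f (Theta a)).
Proof. exact: polyfun_meval. Qed.

Lemma flag_image_chain j p : flag_image j p -> flag_chain j p.
Proof.
move=> hp; have [a [_ a0 pa]] := hp; split; last by move=> Z _; apply.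
by have -> : p = line a0 by apply: val_inj.
Qed.

Lemma flag_image_line j a (a0 : Theta a != 0) :
  (forall i : 'I_d, (j <= i)%N -> a i = 0) -> flag_image j (line a0).
Proof. by move=> h; exists a. Qed.

Lemma Theta0_neq0 : Theta (fun=> 0) != 0.
Proof. by move: free_theta; apply: contraTneq => ->; rewrite free_cons mem0v. Qed.

(** If f and g are each nonzero somewhere on the image of the coordinate subspace, join the two
    parameters by a line inside it. Along the line f, g and a coordinate of [Theta] are nonzero
    polynomials, so all three are nonzero at a common parameter. *)
Lemma flag_chain_irreducible j : irreducible (flag_chain j).
Proof.
split; first by exists (line Theta0_neq0); apply/flag_image_chain/flag_image_line.
move=> Z1 Z2 [I1 hI1 ZI1] [I2 hI2 ZI2] sub.
have nonvan Z I : (forall f, I f -> exists d0 : nat, f \is d0.-homog) ->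
    (forall p, Z p <-> zero_locus I p) -> ~ psubset (flag_chain j) Z ->
    exists f a, [/\ I f, homogeneous f, forall i : 'I_d, (j <= i)%N -> a i = 0,
      poly_eval f (Theta a) != 0 & Theta a != 0].
  move=> hI ZI ns; apply: boolp.contrapT => nex; apply: ns => p [_ /closure_vanish hp].
  apply/ZI => f If; apply: hp => [|q [a [ha a0 qa]]]; first exact: hI.
  have [d0 fd] := hI f If.
  apply/(vanish_line fd qa)/eqP; apply: contraT => fa; case: nex.
  by exists f, a; split=> //; exists d0.
apply: boolp.contrapT => /boolp.not_orP[n1 n2].
have [f [a [If hf ha fa a0]]] := nonvan _ _ hI1 ZI1 n1.
have [g [b [Ig hg hb gb _]]] := nonvan _ _ hI2 ZI2 n2.
have [i ai] : exists i, coord (vbasis {:W}) i (Theta a) != 0.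
  apply/existsP; rewrite -[[exists _, _]]negbK negb_exists; apply: contra a0 => /forallP h.
  apply/eqP; rewrite (coord_vbasis (memvf (Theta a))); apply: big1 => i _.
  by have := h i; rewrite negbK => /eqP->; rewrite scale0r.
pose c t i := a i + t * (b i - a i).
have [F hF] := polyfun_line (polyfun_poly_eval f) a (fun i => b i - a i).
have [G hG] := polyfun_line (polyfun_poly_eval g) a (fun i => b i - a i).
have [H hH] := polyfun_line (poly_Theta i) a (fun i => b i - a i).
have c0 : c 0 = a by apply: boolp.funext => k; rewrite /c mul0r addr0.
have c1 : c 1 = b by apply: boolp.funext => k; rewrite /c mul1r addrC subrK.
have F0 : F != 0 by apply: contraNneq fa => F0; rewrite -c0 [poly_eval _ _]hF F0 horner0.
have G0 : G != 0 by apply: contraNneq gb => G0; rewrite -c1 [poly_eval _ _]hG G0 horner0.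
have H0 : H != 0 by apply: contraNneq ai => H0; rewrite -c0 [coord _ _ _]hH H0 horner0.
have [t] : exists t, (F * G * H).[t] != 0 by apply: poly_nonroot; rewrite !mulf_neq0.
rewrite !hornerM !mulf_eq0 !negb_or => /andP[/andP[Ft Gt] Ht].
have ct0 : Theta (c t) != 0.
  by apply: contraNneq Ht => ct; rewrite -hH -/(c t) ct linear0.
have /flag_image_chain/sub : flag_image j (line ct0).
  by apply: flag_image_line => k jk; rewrite /c ha // hb // subr0 mulr0 addr0.
case=> [/ZI1/(_ f If)|/ZI2/(_ g Ig)] h; have := h (Theta (c t)) (memv_line _).
  by rewrite [poly_eval _ _]hF => Ft0; rewrite Ft0 eqxx in Ft.
by rewrite [poly_eval _ _]hG => Gt0; rewrite Gt0 eqxx in Gt.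
Qed.

(** Let l_0, ..., l_(j+1) be the coordinates dual to [Theta] at 0 and theta_0, ..., theta_j. On j
    parameters they satisfy a homogeneous relation F. If one more parameter gave nothing new, F
    would hold on j + 1 parameters, where l_0 = 1 + O(e^2) and l_(i+1) = e x_i + O(e^2); the lowest
    terms then force F = 0. *)
Lemma flag_chain_strict j : (j < d)%N -> ~ psubset (flag_chain j.+1) (flag_chain j).
Proof.
move=> jd sub.
pose B : (d.+1).-tuple W :=
  [tuple of Theta (fun=> 0) :: [tuple theta i | i < d]].
have freeB : free B by [].
pose l (k : nat) : {linear W -> K^o} := coord B (inord k).
have l0 : l 0%N (Theta (fun=> 0)) = 1.
  have := coord_free (inord 0) (inord 0) freeB; rewrite inordK // eqxx; exact.
have lS0 k : (k < d)%N -> l k.+1 (Theta (fun=> 0)) = 0.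
  move=> kd; have := coord_free (inord 0) (inord k.+1) freeB; rewrite inordK //= => ->.
  by rewrite -val_eqE /= !inordK.
have ltheta k (i : 'I_d) : (k <= d)%N -> l k (theta i) = (k == i.+1)%:R.
  move=> kd; have := coord_free (inord i.+1) (inord k) freeB.
  rewrite inordK /=; last by rewrite ltnS.
  rewrite (nth_map i) ?size_enum_ord // nth_ord_enum => ->.
  by rewrite -val_eqE /= !inordK ?ltnS // 1?eq_sym.
pose pad (m : nat) (a : 'I_m -> K) (i : 'I_d) : K :=
  if insub (val i) is Some i1 then a i1 else 0.
have pad_out m a (i : 'I_d) : (m <= i)%N -> @pad m a i = 0.
  by move=> mi; rewrite /pad insubF // ltnNge mi.
pose h (t : unit) k (a : 'I_j -> K) := l k (Theta (pad j a)).
have ph t k : polyfun (h t k).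
  apply: (polyfun_comp (polyfun_linear (l k))) => i; rewrite /pad.
  by case: insub => [i'|]; [apply: polyfun_var|apply: polyfun_cst].
have [D [c [[k0 ck0] hc]]] := pigeonhole (card_ord j) ph.
pose F : form := \sum_k c k *: \prod_(i < j.+2) linform (l i) ^+ box_exp k i.
have FE w : poly_eval F w = \sum_k c k * \prod_(i < j.+2) l i w ^+ box_exp k i.
  rewrite poly_eval_sum; apply: eq_bigr => k _; rewrite poly_evalZ poly_eval_prod.
  by congr (_ * _); apply: eq_bigr => i _; rewrite poly_evalX linformE.
have Fhom : F \is (j.+1 * D).-homog.
  apply: rpred_sum => k _; apply: dhomogZ; rewrite -(sum_box_exp k).
  apply: (big_ind2 (fun (p : form) s => p \is s.-homog)).
  - exact: dhomog1.
  - by move=> p s q s' hp hq; apply: dhomogM.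
  - move=> i _; have := dhomogMn (box_exp k i) (linform_homog (l i)).
    by rewrite mul1n.
have padK a : (forall i : 'I_d, (j <= i)%N -> a i = 0) ->
    pad j (fun i' => a (widen_ord (ltnW jd) i')) = a.
  move=> ha; apply: boolp.funext => i; rewrite /pad; case: insubP => [i' lt e|].
    by congr a; apply: val_inj.
  by rewrite -leqNgt => /ha.
have Fj p : flag_image j p -> vanish F p.
  move=> [a [ha a0 pa]]; apply/(vanish_line Fhom pa); rewrite FE.
  rewrite -[RHS](hc tt (fun i' => a (widen_ord (ltnW jd) i'))).
  apply: eq_bigr => k _; congr (_ * _); apply: eq_bigr => i _.
  by rewrite /h padK.
(* F has positive degree, which covers the parameters where [Theta] is 0 and defines no projective
   point. *)
have D0 : (0 < D)%N by apply: leq_ltn_trans (ltn_ord (k0 ord0)).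
have FS a : (forall i : 'I_d, (j.+1 <= i)%N -> a i = 0) -> poly_eval F (Theta a) = 0.
  move=> ha; have [a0|a0] := eqVneq (Theta a) 0.
    rewrite a0 -(scale0r 0) (poly_eval_homog _ _ Fhom) expr0n.
    by rewrite muln_eq0 -[D == 0]negbK -lt0n D0 mul0r.
  have /flag_image_chain/sub[_ /closure_vanish hp] := flag_image_line a0 ha.
  by apply: (hp F (ex_intro _ (j.+1 * D)%N Fhom) Fj (Theta a)); apply: memv_line.
move/eqP: ck0; apply.
have /boolp.choice[r hr] := expand.
have /boolp.choice[r' hr'] := hr.
pose xx (x : 'I_j.+1 -> K) := pad j.+1 x.
pose rr k x : {poly K} := (l k (r (xx x)))%:P + (l k (r' (xx x))) *: 'X.
apply: (@box_form_eq0 K j.+1 D c (fun x => 1 + 'X^2 * rr 0%N x)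
  (fun x i => (x i)%:P + 'X * rr i.+1 x)).
- by move=> x; rewrite hornerD hornerM hornerXn hornerC expr0n /= mul0r addr0.
- by move=> x i; rewrite hornerD hornerM hornerX hornerC mul0r addr0.
move=> x e; have E0 : poly_eval F (Theta (fun i => e * xx x i)) = 0.
  by apply: FS => i ji; rewrite /xx pad_out ?mulr0.
rewrite -[RHS]E0 FE.
apply: eq_bigr => k _; congr (_ * _); rewrite [RHS]big_ord_recl.
have lin_expand q : l q (Theta (fun i => e * xx x i)) =
    l q (Theta (fun=> 0)) + e * (\sum_i xx x i * l q (theta i)) + e ^+ 2 * (rr q x).[e].
  have -> : \sum_i xx x i * l q (theta i) = l q (\sum_i xx x i *: theta i).
    by rewrite linear_sum; apply: eq_bigr => i _; rewrite linearZ.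
  have lZ b w : l q (b *: w) = b * l q w by rewrite linearZ.
  by rewrite hr' !linearD !lZ /rr !hornerE /=; ring.
congr (_ * _).
  rewrite lin_expand l0 big1 ?mulr0 ?addr0 => [|i _]; last by rewrite ltheta // mulr0.
  by rewrite !hornerE.
apply: eq_bigr => i _; rewrite lift0 box_expS lin_expand.
have id : (i < d)%N by exact: leq_trans (ltn_ord i) jd.
rewrite lS0 // (bigD1 (Ordinal id)) //= big1 ?addr0 => [|i' ne]; last first.
  by rewrite ltheta // eqSS; move: ne; rewrite -val_eqE /= eq_sym => /negPf->; rewrite mulr0.
have -> : xx x (Ordinal id) = x i.
  rewrite /xx /pad; case: insubP => [i1 _ e1|]; last by rewrite /= ltn_ord.
  by congr x; apply: val_inj.
by rewrite ltheta // eqxx !hornerE /=; congr (_ ^+ _); ring.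
Qed.

Lemma chain_exists : exists Y, irreducible_chain X d Y.
Proof.
exists flag_chain; split=> [j jd|j jd].
  split; last exact: flag_chain_irreducible.
  by exists (zariski_closure (flag_image j)) => [|p]; first exact: zariski_closure_closed.
split; last exact: flag_chain_strict.
move=> p [Xp hp]; split=> // Z cZ sub; apply: hp => // q [a [ha a0 qa]].
by apply: sub; exists a; split=> // i ji; apply: ha; apply: ltnW.
Qed.

End ChainExists.

(** * Generic configurations of points *)

Section SelectRows.
Variables (K : fieldType) (T : finType) (I : Type) (A : I -> T -> K).
Hypothesis total : forall g : T -> K,
  (forall i, \sum_t g t * A i t = 0) -> forall t, g t = 0.

Definition row_sys k (s : 'I_k -> I) : 'M[K]_(k, #|T|) :=
  \matrix_(i, j) A (s i) (enum_val j).

(** Fewer than #|T| rows are orthogonal to some nonzero v; by totality some row i0 is not orthogonal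
    to v, so it lies outside their span. *)
Lemma extend_rows k (s : 'I_k -> I) : row_free (row_sys s) -> (k < #|T|)%N ->
  exists i0, row_free (row_sys (fun i : 'I_k.+1 => oapp s i0 (unlift ord0 i))).
Proof.
move=> fs ltk.
have /rowV0Pn[v /sub_kermxP vA v0] : kermx (row_sys s)^T != 0.
  rewrite -mxrank_eq0 mxrank_ker mxrank_tr -lt0n subn_gt0.
  by apply: leq_ltn_trans ltk; apply: rank_leq_row.
have [i0 hi0] : exists i0, \sum_t v 0 (enum_rank t) * A i0 t != 0.
  apply: boolp.contrapT => nex; move/rV0Pn: v0 => [j /eqP]; apply.
  rewrite -[j]enum_valK; apply: (total (g := fun t => v 0 (enum_rank t))) => i.
  by apply/eqP; apply: boolp.contrapT => /negP ne; apply: nex; exists i.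
exists i0; apply: inj_row_free => x xM.
have E (j : 'I_#|T|) : \sum_(i < k.+1) x 0 i * A (oapp s i0 (unlift ord0 i)) (enum_val j) = 0.
  have := congr1 (fun B : 'M_(_, _) => B 0 j) xM; rewrite !mxE => e.
  by rewrite -[RHS]e; apply: eq_bigr => i _; rewrite mxE.
have E' (j : 'I_#|T|) : x 0 ord0 * A i0 (enum_val j) +
    \sum_(i < k) x 0 (lift ord0 i) * A (s i) (enum_val j) = 0.
  rewrite -[RHS](E j) big_ord_recl unlift_none; congr (_ + _).
  by apply: eq_bigr => i _; rewrite liftK.
have vs i : \sum_(j < #|T|) v 0 j * A (s i) (enum_val j) = 0.
  have := congr1 (fun B : 'M_(_, _) => B 0 i) vA; rewrite !mxE => e.
  by rewrite -[RHS]e; apply: eq_bigr => j _; rewrite !mxE.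
have x0 : x 0 ord0 = 0.
  have : \sum_(j < #|T|) v 0 j * (x 0 ord0 * A i0 (enum_val j) +
      \sum_(i < k) x 0 (lift ord0 i) * A (s i) (enum_val j)) = 0.
    by apply: big1 => j _; rewrite E' mulr0.
  under eq_bigr do rewrite mulrDr mulr_sumr.
  rewrite big_split /= exchange_big /= [X in _ + X]big1 ?addr0 => [|i _]; last first.
    under eq_bigr do rewrite mulrCA.
    by rewrite -mulr_sumr vs mulr0.
  under eq_bigr do rewrite mulrCA.
  rewrite -mulr_sumr => /eqP; rewrite mulf_eq0 => /orP[/eqP//|].
  rewrite (reindex_onto enum_rank enum_val) /=; last by move=> j _; rewrite enum_valK.
  under eq_bigr do rewrite enum_rankK.
  rewrite (eq_bigl xpredT) ?(negPf hi0) // => t; by rewrite enum_rankK eqxx.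
have x' : \row_i x 0 (lift ord0 i) = 0 :> 'rV_k.
  apply: (row_free_inj fs); rewrite mul0mx; apply/rowP => j; rewrite !mxE.
  have := E' j; rewrite x0 mul0r add0r => e; rewrite -[RHS]e.
  by apply: eq_bigr => i _; rewrite !mxE.
apply/rowP => i; rewrite mxE; case: (unliftP ord0 i) => [j|] -> //.
by have := congr1 (fun B : 'M_(_, _) => B 0 j) x'; rewrite !mxE.
Qed.

(** Replaces a possibly infinite system by an invertible square one that still contains the given
    independent rows. *)
Lemma select_rows k (s : 'I_k -> I) : row_free (row_sys s) ->
  exists s' : 'I_#|T| -> I, row_free (row_sys s') /\ forall i, exists j, s' j = s i.
Proof.
elim: {k}(#|T| - k)%N {-2}k s (erefl (#|T| - k)%N) => [|m IH] k s e fs.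
  have lek := rank_leq_col (row_sys s); rewrite (eqP (fs : \rank _ == k)) in lek.
  have {lek}e' : k = #|T| by apply/eqP; rewrite eqn_leq lek -subn_eq0 -e.
  by rewrite e' in s fs *; exists s; split=> // i; exists i.
have ltk : (k < #|T|)%N by rewrite -subn_gt0 -e.
have [i0 fs'] := extend_rows fs ltk.
have e' : m = (#|T| - k.+1)%N by rewrite subnS -e.
have [s' [fs'' hs']] := IH k.+1 _ e' fs'.
exists s'; split=> // i; have [j ej] := hs' (lift ord0 i).
by exists j; rewrite ej liftK.
Qed.

End SelectRows.

Section Generic.
Variable K : numFieldType.

(* c l p false and c l p true are the vectors v, w of the p-th point of block l. *)
Definition config : Type := nat -> nat -> bool -> nat -> K.
Implicit Types (c d : config) (P Q : config -> Prop).

Definition config_line c d (t : K) : config :=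
  fun l p b x => c l p b x + t * d l p b x.

(* Nonempty and open along every line, so that such sets always intersect. *)
Definition generic P : Prop :=
  (exists c, P c) /\
  forall c d, P c -> exists2 r : {poly K}, r != 0 &
    forall t, r.[t] != 0 -> P (config_line c d t).

(** Join a point of P to a point of Q by a line; parameter t seen from the first is 1 - t seen from
    the second, and finitely many exceptional values are avoided. *)
Lemma generic_and P Q : generic P -> generic Q -> generic (fun c => P c /\ Q c).
Proof.
move=> [[c1 P1] gP] [[c2 Q2] gQ]; split.
  have [r r0 hr] := gP c1 (fun l p b x => c2 l p b x - c1 l p b x) P1.
  have [q q0 hq] := gQ c2 (fun l p b x => c1 l p b x - c2 l p b x) Q2.
  have [t] : exists t, (r * (q \Po (1 - 'X))).[t] != 0.
    apply: poly_nonroot; rewrite mulf_neq0 // -size_poly_eq0 size_comp_poly2.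
      by rewrite size_poly_eq0.
    by rewrite -opprB size_polyN size_XsubC.
  rewrite hornerM horner_comp !hornerE mulf_eq0 negb_or => /andP[/hr Pt /hq Qt].
  exists (config_line c1 (fun l p b x => c2 l p b x - c1 l p b x) t); split=> //.
  suff <- : config_line c2 (fun l p b x => c1 l p b x - c2 l p b x) (1 - t) =
            config_line c1 (fun l p b x => c2 l p b x - c1 l p b x) t by [].
  do 4!(apply: boolp.funext => ?); rewrite /config_line; ring.
move=> c d [/gP hP /gQ hQ].
have [[r r0 hr] [q q0 hq]] := (hP d, hQ d).
exists (r * q); first by rewrite mulf_neq0.
move=> t; rewrite hornerM mulf_eq0 negb_or => /andP[/hr ? /hq ?]; split=> //.
Qed.

(** With h a renumbering of blocks and coordinates, this lets one configuration satisfy conditions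
    stated in spaces of different dimension. *)
Lemma generic_pull (h h' : config -> config) P :
  (forall c d t, h (config_line c d t) = config_line (h c) (h d) t) ->
  cancel h' h -> generic P -> generic (fun c => P (h c)).
Proof.
move=> hl hK [[c Pc] gP]; split; first by exists (h' c); rewrite hK.
move=> c1 d hc1; have [r r0 hr] := gP (h c1) (h d) hc1.
by exists r => // t /hr; rewrite hl.
Qed.

Definition line_poly (h : config -> K) : Prop :=
  forall c d, exists r : {poly K}, forall t, h (config_line c d t) = r.[t].

Lemma line_poly_var l p b x : line_poly (fun c => c l p b x).
Proof.
move=> c d; exists ((c l p b x)%:P + (d l p b x)%:P * 'X) => t.
by rewrite !hornerE /config_line mulrC.
Qed.

Lemma line_poly_cst a : line_poly (fun=> a).
Proof. by move=> c d; exists a%:P => t; rewrite hornerC. Qed.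

Lemma line_polyD g h : line_poly g -> line_poly h -> line_poly (fun c => g c + h c).
Proof.
move=> hg hh c d; have [[r hr] [q hq]] := (hg c d, hh c d).
by exists (r + q) => t; rewrite hornerD hr hq.
Qed.

Lemma line_polyM g h : line_poly g -> line_poly h -> line_poly (fun c => g c * h c).
Proof.
move=> hg hh c d; have [[r hr] [q hq]] := (hg c d, hh c d).
by exists (r * q) => t; rewrite hornerM hr hq.
Qed.

Lemma line_polyB g h : line_poly g -> line_poly h -> line_poly (fun c => g c - h c).
Proof.
move=> hg hh c d; have [[r hr] [q hq]] := (hg c d, hh c d).
by exists (r - q) => t; rewrite hornerD hornerN hr hq.
Qed.

Lemma generic_neq0 (h : config -> K) : line_poly h -> (exists c, h c != 0) ->
  generic (fun c => h c != 0).
Proof.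
move=> hl ex; split=> // c d hc; have [r hr] := hl c d.
exists r => [|t]; last by rewrite hr.
apply: contraNneq hc => r0; have := hr 0; rewrite r0 horner0 => <-.
by apply/eqP; congr h; do 4!(apply: boolp.funext => ?); rewrite /config_line mul0r addr0.
Qed.

Section Total.

Variables (T : finType) (I : Type) (A : config -> I -> T -> K).
Hypothesis A_poly : forall i t, line_poly (fun c => A c i t).

Definition totalP c : Prop := forall g : T -> K,
  (forall i, \sum_t g t * A c i t = 0) -> forall t, g t = 0.

Definition ord_elim0 (i : 'I_0) : I := let: Ordinal _ h := i in False_rect _ (notF h).

(** A square invertible subsystem chosen at c has a determinant that is polynomial along every line
    through c. *)
Lemma generic_total : (exists c, totalP c) -> generic totalP.
Proof.
move=> ex; split=> // c d hc.
have [|s [fs _]] := select_rows hc (s := ord_elim0).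
  by rewrite /row_free -leqn0 rank_leq_row.
have /boolp.choice[q hq] : forall i, exists q : T -> {poly K}, forall t u,
    A (config_line c d u) (s i) t = (q t).[u].
  move=> i; have /boolp.choice[q hq] : forall t, exists q : {poly K}, forall u,
    A (config_line c d u) (s i) t = q.[u] by move=> t; apply: A_poly.
  by exists q.
pose M : 'M[{poly K}]_#|T| := \matrix_(i, j) q i (enum_val j).
have hM u : map_mx (horner_eval u) M = row_sys (A (config_line c d u)) s.
  by apply/matrixP => i j; rewrite !mxE hq.
have c0 : config_line c d 0 = c.
  by do 4!(apply: boolp.funext => ?); rewrite /config_line mul0r addr0.
exists (\det M).
  apply: contraTneq fs => dM; rewrite row_free_unit unitmxE -[c in row_sys (A c)]c0 -hM.
  by rewrite det_map_mx dM rmorph0 unitr0.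
move=> u; rewrite -horner_evalE -det_map_mx hM -unitfE -unitmxE => uM g hg t.
suff : \row_j g (enum_val j) = 0 :> 'rV_#|T|.
  by move/rowP/(_ (enum_rank t)); rewrite !mxE enum_rankK.
have uM' : (row_sys (A (config_line c d u)) s)^T \in unitmx by rewrite unitmx_tr.
apply: (row_free_inj (A := (row_sys (A (config_line c d u)) s)^T)).
  by rewrite row_free_unit.
rewrite mul0mx; apply/rowP => i; rewrite !mxE -[RHS](hg (s i)).
rewrite [RHS](reindex_onto (@enum_val T xpredT) enum_rank) /=; last by move=> j _; rewrite enum_rankK.
by apply: eq_big => [j|j _]; rewrite ?enum_valK ?eqxx // !mxE.
Qed.

End Total.
End Generic.

(** * Conditions imposed by double points *)

(* The semistandard indices: these coordinates determine a tensor of S_(2,1). *)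
Definition bidx (i j k : nat) : bool := (i <= j)%N && (i < k)%N.

(* Derivative of v_j (v_i w_k - w_i v_k) in the x-th coordinate of v or of w. *)
Definition dphi (K : pzRingType) (v w : nat -> K) (b : bool) (x i j k : nat) : K :=
  if b then v j * (v i * (k == x)%:R - (i == x)%:R * v k)
  else (j == x)%:R * (v i * w k - w i * v k) +
       v j * ((i == x)%:R * w k - w i * (k == x)%:R).

Definition masked (K : pzRingType) (m : nat -> bool) (v : nat -> K) (x : nat) : K :=
  if m x then v x else 0.

Section Determined.
Variable K : numFieldType.
Implicit Types (c : config K) (f : nat -> nat -> nat -> K).

Definition pairing n f (R : nat -> nat -> nat -> K) : K :=
  \sum_(i < n) \sum_(j < n) \sum_(k < n) f i j k * R i j k.

Definition sing n f (v w : nat -> K) : Prop :=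
  forall b x, (x < n)%N -> pairing n f (dphi v w b x) = 0.

(* f is a functional on the semistandard coordinates; the cnt l points of block *)
(* l are projected to the coordinate subspace mask l, and f is given to vanish  *)
(* on the indices in Z.                                                         *)
Definition determined n (mask : nat -> nat -> bool) (cnt : nat -> nat)
    (Z : nat -> nat -> nat -> bool) c : Prop :=
  forall f,
  (forall l p, (p < cnt l)%N ->
     sing n f (masked (mask l) (c l p false)) (masked (mask l) (c l p true))) ->
  (forall i j k, (i < n)%N -> (j < n)%N -> (k < n)%N ->
     ~~ bidx i j k || Z i j k -> f i j k = 0) ->
  forall i j k, (i < n)%N -> (j < n)%N -> (k < n)%N -> f i j k = 0.

Lemma eq_pairing n f f' R R' :
  (forall i j k, (i < n)%N -> (j < n)%N -> (k < n)%N ->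
     f i j k * R i j k = f' i j k * R' i j k) -> pairing n f R = pairing n f' R'.
Proof.
by move=> h; do 3!(apply: eq_bigr => ? _); apply: h.
Qed.

Lemma pairingE n f R :
  pairing n f R = \sum_(t : 'I_n * 'I_n * 'I_n) f t.1.1 t.1.2 t.2 * R t.1.1 t.1.2 t.2.
Proof.
transitivity (\sum_(ij : 'I_n * 'I_n) \sum_(k < n) f ij.1 ij.2 k * R ij.1 ij.2 k).
  exact: (pair_bigA _ (fun (i j : 'I_n) => \sum_(k < n) f i j k * R i j k)).
exact: (pair_bigA _ (fun (ij : 'I_n * 'I_n) (k : 'I_n) => f ij.1 ij.2 k * R ij.1 ij.2 k)).
Qed.

Lemma line_poly_masked m l p b x : line_poly (fun c => masked m (c l p b) x).
Proof. by rewrite /masked; case: (m x); [apply: line_poly_var|apply: line_poly_cst]. Qed.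

Lemma line_poly_dphi m l p b x i j k :
  line_poly (fun c => dphi (masked m (c l p false)) (masked m (c l p true)) b x i j k).
Proof.
rewrite /dphi; case: b; do ?[exact: line_poly_masked|exact: line_poly_cst|
  apply: line_polyM|apply: line_polyB|apply: line_polyD].
Qed.

(** The definition is totality of one family of rows: the derivatives at the points, together with
    the coordinates prescribed to be 0. *)
Lemma generic_determined n mask cnt Z :
  (exists c, determined n mask cnt Z c) -> generic (determined n mask cnt Z).
Proof.
move=> [c0 h0].
pose T := ('I_n * 'I_n * 'I_n)%type.
pose I := ((nat * nat * bool * nat) + T)%type.
pose A c (i : I) (t : T) : K := match i with
  | inl (l, p, b, x) => if (p < cnt l)%N && (x < n)%N then
      dphi (masked (mask l) (c l p false)) (masked (mask l) (c l p true)) b x t.1.1 t.1.2 t.2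
      else 0
  | inr t' => ((t == t') && (~~ bidx t'.1.1 t'.1.2 t'.2 || Z t'.1.1 t'.1.2 t'.2))%:R
  end.
have Apoly i t : line_poly (fun c => A c i t).
  case: i => [[[[l p] b] x]|t'] /=; last exact: line_poly_cst.
  by case: (_ && _); [apply: line_poly_dphi|apply: line_poly_cst].
have A_tot c : determined n mask cnt Z c <-> totalP A c.
  split=> h.
    move=> g hg.
    pose f i j k : K := if insub i is Some i' then if insub j is Some j' then
      if insub k is Some k' then g (i', j', k') else 0 else 0 else 0.
    have fE (t : T) : f t.1.1 t.1.2 t.2 = g t.
      by case: t => [[i j] k]; rewrite /f !valK.
    move=> t; rewrite -fE; apply: h => // [l p pl b x xn|i j k hi hj hk hz].
      rewrite pairingE -[RHS](hg (inl (l, p, b, x))) /= pl xn /=.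
      by apply: eq_bigr => t' _; rewrite fE.
    have := hg (inr (Ordinal hi, Ordinal hj, Ordinal hk)).
    rewrite /= hz (bigD1 (Ordinal hi, Ordinal hj, Ordinal hk)) //= eqxx mulr1.
    rewrite big1 => [|t' /negPf->]; last by rewrite mulr0.
    by rewrite addr0 -fE.
  move=> f hf hz i j k hi hj hk.
  apply: (h (fun t : T => f t.1.1 t.1.2 t.2) _ (Ordinal hi, Ordinal hj, Ordinal hk)).
  case=> [[[[l p] b] x]|t'] /=.
    case: (boolP ((p < cnt l)%N && (x < n)%N)) => [/andP[pl xn]|_]; last first.
      by apply: big1 => t _; rewrite mulr0.
    by rewrite -pairingE; apply: hf.
  rewrite (bigD1 t') //= big1 => [|t /negPf->]; last by rewrite mulr0.
  rewrite addr0 eqxx /=; case: (boolP (_ || _)) => [hzt|]; last by rewrite mulr0.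
  by rewrite hz ?mul0r.
have [|_ gt] := generic_total Apoly; first by exists c0; apply/A_tot.
split; first by exists c0.
move=> c d /A_tot hc; have [r r0 hr] := gt c d hc.
by exists r => // t /hr rt; apply/A_tot.
Qed.

(* The strictly increasing map onto nat minus the gap [m, m + g). *)
Definition skip (m g x : nat) : nat := if (x < m)%N then x else (x + g)%N.
Definition unskip (m g x : nat) : nat := if (x < m)%N then x else (x - g)%N.

Lemma skipK m g : cancel (skip m g) (unskip m g).
Proof.
move=> x; rewrite /skip /unskip; have [xm|mx] := ltnP x m; first by rewrite xm.
by rewrite ltnNge (leq_trans mx) ?leq_addr //= addnK.
Qed.

Lemma leq_skip m g x y : (skip m g x <= skip m g y)%N = (x <= y)%N.
Proof. by rewrite /skip; case: (ltnP x m); case: (ltnP y m); lia. Qed.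

Lemma sum_skip n m g (F : nat -> K) : (m <= n)%N ->
  (forall x, (m <= x < m + g)%N -> F x = 0) ->
  \sum_(x < n + g) F x = \sum_(x < n) F (skip m g x).
Proof.
move=> mn F0; rewrite -(big_mkord xpredT F) -(big_mkord xpredT (fun x => F (skip m g x))).
rewrite (big_cat_nat (n := m)) ?(leq_trans mn) ?leq_addr //=.
rewrite (big_cat_nat (m := m) (n := (m + g)%N)) ?leq_addr ?leq_add2r //=.
rewrite [X in _ + (X + _)]big_nat_cond [X in _ + (X + _)]big1 => [|x]; last first.
  by rewrite andbT => /F0.
rewrite add0r [RHS](big_cat_nat (n := m)) //=; congr (_ + _).
  by rewrite !big_nat; apply: eq_bigr => x /andP[_ xm]; rewrite /skip xm.
rewrite big_addn addnK.
by rewrite !big_nat; apply: eq_bigr => x /andP[mx _]; rewrite /skip ltnNge mx.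
Qed.

Lemma pairing_skip n m g f (R : nat -> nat -> nat -> K) : (m <= n)%N ->
  (forall i j k, (m <= i < m + g)%N || (m <= j < m + g)%N || (m <= k < m + g)%N ->
     R i j k = 0) ->
  pairing (n + g) f R = pairing n (fun i j k => f (skip m g i) (skip m g j) (skip m g k))
    (fun i j k => R (skip m g i) (skip m g j) (skip m g k)).
Proof.
move=> mn R0; rewrite /pairing.
rewrite (sum_skip (m := m) (F := fun i => \sum_(j < n + g) \sum_(k < n + g) f i j k * R i j k)) //.
  apply: eq_bigr => i _.
  rewrite (sum_skip (m := m) (F := fun j => \sum_(k < n + g) f (skip m g i) j k * R (skip m g i) j k)) //.
    apply: eq_bigr => j _.
    rewrite (sum_skip (m := m) (F := fun k => f (skip m g i) (skip m g j) k * R (skip m g i) (skip m g j) k)) //.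
    by move=> k hk; rewrite R0 ?mulr0 // hk !orbT.
  by move=> j hj; apply: big1 => k _; rewrite R0 ?mulr0 // hj !orbT.
by move=> i hi; apply: big1 => j _; apply: big1 => k _; rewrite R0 ?mulr0 // hi.
Qed.

Lemma bidx_skip m g i j k : bidx (skip m g i) (skip m g j) (skip m g k) = bidx i j k.
Proof. by rewrite /bidx !ltnNge !leq_skip. Qed.

(** A derivative in a direction off the gap is zero at every triple meeting the gap, because the
    point has no coordinates there. So the restriction of the form to the subspace is singular at
    the same point. *)
Lemma sing_skip n m g f v w v' w' : (m <= n)%N ->
  (forall x, (m <= x < m + g)%N -> v x = 0 /\ w x = 0) ->
  (forall x, (x < n)%N -> v (skip m g x) = v' x /\ w (skip m g x) = w' x) ->
  sing (n + g) f v w ->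
  sing n (fun i j k => f (skip m g i) (skip m g j) (skip m g k)) v' w'.
Proof.
move=> mn gap vw hs b x xn.
have sxn : (skip m g x < n + g)%N by rewrite /skip; case: (ltnP x m); lia.
rewrite -[RHS](hs b _ sxn) (pairing_skip _ mn).
  apply: eq_pairing => i j k hi hj hk; congr (_ * _).
  rewrite /dphi; have [[-> ->] [-> _] [-> ->]] := And3 (vw i hi) (vw j hj) (vw k hk).
  by rewrite !(inj_eq (can_inj (skipK m g))).
have ne y : (m <= y < m + g)%N -> (y == skip m g x) = false by rewrite /skip; case: (ltnP x m); lia.
move=> i j k; rewrite -orbA => /or3P[] hg; rewrite /dphi (ne _ hg);
  by have [hv hw] := gap _ hg; case: b; rewrite ?hv ?hw /=; ring.
Qed.

(** The restriction half of each specialization step: the points lying off the gap form a system in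
    dimension n, which forces f to vanish on that subspace. *)
Lemma determined_skip n m g mask cnt Z c f : (m <= n)%N ->
  determined n mask cnt Z c ->
  (forall l p, (p < cnt l)%N -> exists v w,
     [/\ sing (n + g) f v w, forall x, (m <= x < m + g)%N -> v x = 0 /\ w x = 0 &
      forall x, (x < n)%N -> v (skip m g x) = masked (mask l) (c l p false) x /\
                             w (skip m g x) = masked (mask l) (c l p true) x]) ->
  (forall i j k, (i < n + g)%N -> (j < n + g)%N -> (k < n + g)%N ->
     ~~ bidx i j k -> f i j k = 0) ->
  (forall i j k, (i < n)%N -> (j < n)%N -> (k < n)%N -> Z i j k ->
     f (skip m g i) (skip m g j) (skip m g k) = 0) ->
  forall i j k, (i < n)%N -> (j < n)%N -> (k < n)%N ->
    f (skip m g i) (skip m g j) (skip m g k) = 0.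
Proof.
move=> mn hc hpts hb hZ.
apply: (hc (fun i j k => f (skip m g i) (skip m g j) (skip m g k))).
  move=> l p /hpts[v [w [hs gap vw]]]; exact: sing_skip hs.
move=> i j k hi hj hk /orP[nb|]; last exact: hZ.
have lt x : (x < n)%N -> (skip m g x < n + g)%N by rewrite /skip; case: (ltnP x m); lia.
by apply: hb; rewrite ?bidx_skip ?lt.
Qed.

End Determined.

(** * Specialization of points to coordinate subspaces *)

Definition off_gap (m g x : nat) : bool := (x < m)%N || (m + g <= x)%N.
Definition all3 (P : nat -> bool) (i j k : nat) : bool := [&& P i, P j & P k].

Section Steps.
Variable K : numFieldType.
Implicit Types (c : config K) (f : nat -> nat -> nat -> K).

(* K^(a+6) = A + U1 + U2 with L = A + U1 and M = A + U2. *)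
Definition mask2 (a l : nat) : nat -> bool :=
  match l with 0 => fun x => (x < a + 3)%N | 1 => off_gap a 3 | _ => xpredT end.
Definition cnt2 (a l : nat) : nat :=
  match l with 0 | 1 => a + 2 | 2 => 3 | _ => 0 end.
Definition zero2 (a i j k : nat) : bool :=
  all3 (mask2 a 0) i j k || all3 (mask2 a 1) i j k.
Definition determined2 a c : Prop := determined (a + 6) (mask2 a) (cnt2 a) (zero2 a) c.

(* K^(a+9) = A + U3 + U1 + U2, and block l lies in the sum of A with two of them. *)
Definition mask3 (a l : nat) : nat -> bool :=
  match l with 0 => fun x => (x < a + 6)%N | 1 => off_gap (a + 3) 3 | _ => off_gap a 3 end.
Definition cnt3 (l : nat) : nat := if (l < 3)%N then 3 else 0.
Definition zero3 (a i j k : nat) : bool :=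
  [|| all3 (mask3 a 0) i j k, all3 (mask3 a 1) i j k | all3 (mask3 a 2) i j k].
Definition determined3 a c : Prop := determined (a + 6 + 3) (mask3 a) cnt3 (zero3 a) c.

Lemma off_gapP m g n x : (m <= n)%N -> (x < n + g)%N -> off_gap m g x ->
  exists2 y, (y < n)%N & x = skip m g y.
Proof.
move=> mn xn; rewrite /off_gap; have [xm _|mx /= mgx] := ltnP x m.
  by exists x; rewrite /skip ?xm //; lia.
by exists (x - g)%N; rewrite /skip; [lia|case: (ltnP (x - g) m); lia].
Qed.

Lemma zero_off_gap n m g f : (m <= n)%N ->
  (forall i j k, (i < n)%N -> (j < n)%N -> (k < n)%N ->
     f (skip m g i) (skip m g j) (skip m g k) = 0) ->
  forall i j k, (i < n + g)%N -> (j < n + g)%N -> (k < n + g)%N ->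
    all3 (off_gap m g) i j k -> f i j k = 0.
Proof.
move=> mn h i j k hi hj hk /and3P[].
move=> /(off_gapP mn hi)[i' i'n ->] /(off_gapP mn hj)[j' j'n ->] /(off_gapP mn hk)[k' k'n ->].
exact: h.
Qed.

Lemma skip_lt m g n x : (x < n)%N -> (skip m g x < n + g)%N.
Proof. by rewrite /skip; case: (ltnP x m); lia. Qed.

Lemma off_gap_skip m g x : off_gap m g (skip m g x).
Proof. by rewrite /off_gap /skip; case: (ltnP x m); lia. Qed.

Lemma skip_point n m g f (P Q : nat -> bool) (v w v' w' : nat -> K) :
  (forall x, (x < n)%N -> P (skip m g x) = Q x) ->
  sing (n + g) f v w ->
  v = masked P (masked (off_gap m g) v') -> w = masked P (masked (off_gap m g) w') ->
  exists v w,
   [/\ sing (n + g) f v w, forall x, (m <= x < m + g)%N -> v x = 0 /\ w x = 0 &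
      forall x, (x < n)%N -> v (skip m g x) = masked Q (fun x => v' (skip m g x)) x /\
                             w (skip m g x) = masked Q (fun x => w' (skip m g x)) x].
Proof.
move=> PQ hs ev ew; exists v, w; split=> // x hx; rewrite ev ew /masked.
  have -> : off_gap m g x = false by rewrite /off_gap; lia.
  by rewrite !if_same.
by rewrite off_gap_skip (PQ _ hx).
Qed.

(** In K^(a+9) let N be a third coordinate subspace of codimension 3. Move into N a + 2 of the a + 5
    points of L, a + 2 of those of M, and the three general points. On N this is the system for a,
    so f vanishes there; three points in each of L, M, N remain to be used, and that is
    [determined3]. *)
Lemma step2 a : (exists c, determined2 a c) -> (exists c, determined3 a c) ->
  exists c, determined2 (a + 3) c.
Proof.
move=> /generic_determined g2 /generic_determined g3.
(* The three points of N in block 2 serve both systems; the points of L and M moved into N are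
   stored in blocks 3 and 4. *)
pose r l := if l == 2 then 2 else (l + 3)%N.
pose r' l := if l == 2 then 2 else (l - 3)%N.
have rK : cancel r r'.
  move=> l; rewrite /r /r'; have [->//|_] := eqVneq l 2.
  by rewrite addnK ifN //; lia.
pose h c : config K := fun l p b x => c (r l) p b (skip a 3 x).
pose h' c : config K := fun l p b x => c (r' l) p b (unskip a 3 x).
have hK : cancel h' h.
  by move=> c; do 4!(apply: boolp.funext => ?); rewrite /h /h' rK skipK.
have [[c [d3 d2]] _] := generic_and g3 (generic_pull (fun _ _ _ => erefl) hK g2).
pose N := off_gap a 3.
pose c' : config K := fun l p b => match l with
  | 0 => if (p < a + 2)%N then masked N (c 3 p b) else c 0%N (p - (a + 2))%N b
  | 1 => if (p < a + 2)%N then masked N (c 4 p b) else c 1%N (p - (a + 2))%N b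
  | _ => masked N (c 2 p b) end.
exists c'; rewrite /determined2 (_ : a + 3 + 6 = a + 6 + 3)%N; last by lia.
move=> f hpts hz.
have zN : forall i j k, (i < a + 6)%N -> (j < a + 6)%N -> (k < a + 6)%N ->
    f (skip a 3 i) (skip a 3 j) (skip a 3 k) = 0.
  apply: (determined_skip _ d2) => [|l p|i j k hi hj hk nb|i j k hi hj hk zz]; first by lia.
  - case: l => [|[|[|l]]] //= pl.
    + have pl' : (p < cnt2 (a + 3) 0)%N by rewrite /=; lia.
      apply: (skip_point _ (hpts 0%N p pl')); rewrite /c' ?pl //.
      by move=> x hx /=; rewrite /skip; case: (ltnP x a); lia.
    + have pl' : (p < cnt2 (a + 3) 1)%N by rewrite /=; lia.
      apply: (skip_point _ (hpts 1%N p pl')); rewrite /c' ?pl //.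
      by move=> x hx /=; rewrite /skip /off_gap; case: (ltnP x a); lia.
    + by apply: (skip_point (P := xpredT) _ (hpts 2 p pl)).
  - by apply: hz; rewrite // nb.
  - apply: hz; rewrite ?skip_lt //.
    move: zz; rewrite /skip /zero2 /all3 /= /off_gap.
    by case: (ltnP i a); case: (ltnP j a); case: (ltnP k a); lia.
have z3 := zero_off_gap _ zN.
apply: d3 => [l p|i j k hi hj hk].
  rewrite /cnt3; case: l => [|[|[|l]]] //= p3.
  - have pl' : (p + (a + 2) < cnt2 (a + 3) 0)%N by rewrite /=; lia.
    have := hpts 0%N _ pl'; rewrite /c' ltnNge leq_addl /= addnK.
    by rewrite (_ : a + 3 + 3 = a + 6)%N //; lia.
  - have pl' : (p + (a + 2) < cnt2 (a + 3) 1)%N by rewrite /=; lia.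
    by have := hpts 1%N _ pl'; rewrite /c' ltnNge leq_addl /= addnK.
  - exact: (hpts 2 p p3).
case/orP=> [nb|/or3P[] hh].
- by apply: hz; rewrite // nb.
- apply: hz => //; rewrite /zero2 /= (_ : a + 3 + 3 = a + 6)%N ?hh ?orbT //; lia.
- by apply: hz => //; rewrite /zero2 /= hh !orbT.
- by apply: z3 => //; lia.
Qed.

(** A triple with an index in the common part A has at most two indices in U1, U2, U3, hence lies in
    one of the three subspaces, where f is zero already. The other triples involve nine coordinates
    only. *)
Lemma shift3 a : (exists c, determined3 0 c) -> exists c, determined3 a c.
Proof.
move=> [c hc].
pose c' : config K := fun l p b => masked (off_gap 0 a) (fun x => c l p b (unskip 0 a x)).
exists c'; rewrite /determined3 (_ : a + 6 + 3 = 9 + a)%N; last by lia.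
move=> f hpts hz.
have mE l x : mask3 a l (skip 0 a x) = mask3 0 l x.
  by case: l => [|[|l]]; rewrite /mask3 /off_gap /skip ltn0; lia.
have z0 := zero_off_gap (leq0n 9) (determined_skip (f := f) (leq0n 9) hc _ _ _).
have z : forall i j k, (i < 9 + a)%N -> (j < 9 + a)%N -> (k < 9 + a)%N ->
    all3 (off_gap 0 a) i j k -> f i j k = 0.
  apply: z0 => [l p pl|i j k hi hj hk nb|i j k hi hj hk zz].
  - have [v [w [hs gap vw]]] := skip_point (n := 9) (Q := mask3 0 l)
      (v' := fun x => c l p false (unskip 0 a x)) (w' := fun x => c l p true (unskip 0 a x))
      (fun x _ => mE l x) (hpts l p pl) erefl erefl.
    exists v, w; split=> // x hx.
    by have := vw x hx; rewrite /masked skipK.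
  - by apply: hz; rewrite // nb.
  - apply: hz; rewrite ?skip_lt //; apply/orP; right; move: zz.
    rewrite /zero3 /all3 /mask3 /off_gap /skip !ltn0; lia.
move=> i j k hi hj hk; have [h3|] := boolP (all3 (off_gap 0 a) i j k); first exact: z.
move=> n3; apply: hz => //; apply/orP; right; move: n3.
rewrite /zero3 /all3 /mask3 /off_gap; lia.
Qed.

(* K^(n+3) with L = K^n: s points lie in L, n + 2 are general, and f vanishes on L. *)
Definition mask1 (n l : nat) : nat -> bool :=
  if l is 0 then fun x => (x < n)%N else xpredT.
Definition cnt1 (n s l : nat) : nat := match l with 0 => s | 1 => n + 2 | _ => 0 end.
Definition zero1 (n : nat) (E : seq (nat * nat * nat)) (i j k : nat) : bool :=
  all3 (fun x => (x < n)%N) i j k || ((i, j, k) \in E).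
Definition determined1 n s E c : Prop :=
  determined (n + 3) (mask1 n) (cnt1 n s) (zero1 n E) c.

Definition cnt0 (s l : nat) : nat := if l is 0 then s else 0.
Definition zero0 (E : seq (nat * nat * nat)) (i j k : nat) : bool := (i, j, k) \in E.
Definition determined0 n s E c : Prop :=
  determined n (fun=> xpredT) (cnt0 s) (zero0 E) c.

Definition skip_triple (m g : nat) (t : nat * nat * nat) : nat * nat * nat :=
  (skip m g t.1.1, skip m g t.1.2, skip m g t.2).

(** In K^(n+6) let M be a second coordinate subspace of codimension 3. Move s of the points of L
    into the intersection of L and M, and n + 2 of the n + 5 general points into M. The restriction
    to M is the given system; afterwards f vanishes on L and M, with n + 2 points left in each and
    three general ones. *)
Lemma step1 n s E : (exists c, determined1 n s E c) -> (exists c, determined2 n c) ->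
  exists c, determined1 (n + 3) (s + (n + 2)) (map (skip_triple n 3) E) c.
Proof.
move=> /generic_determined g1 /generic_determined g2.
(* The n + 2 points of M in block 1 serve both systems; the s points in the intersection are stored
   in block 3. *)
pose r l := if l == 1 then 1 else (l + 3)%N.
pose r' l := if l == 1 then 1 else (l - 3)%N.
have rK : cancel r r'.
  move=> l; rewrite /r /r'; have [->//|_] := eqVneq l 1.
  by rewrite addnK ifN //; lia.
pose h c : config K := fun l p b x => c (r l) p b (skip n 3 x).
pose h' c : config K := fun l p b x => c (r' l) p b (unskip n 3 x).
have hK : cancel h' h.
  by move=> c; do 4!(apply: boolp.funext => ?); rewrite /h /h' rK skipK.
have [[c [d2 d1]] _] := generic_and g2 (generic_pull (fun _ _ _ => erefl) hK g1).
pose M := off_gap n 3.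
pose c' : config K := fun l p b => match l with
  | 0 => if (p < s)%N then masked M (c 3 p b) else c 0%N (p - s)%N b
  | _ => if (p < n + 2)%N then masked M (c 1%N p b) else c 2 (p - (n + 2))%N b end.
exists c'; move=> f hpts hz.
have zM : forall i j k, (i < n + 3)%N -> (j < n + 3)%N -> (k < n + 3)%N ->
    f (skip n 3 i) (skip n 3 j) (skip n 3 k) = 0.
  apply: (determined_skip _ d1) => [|l p|i j k hi hj hk nb|i j k hi hj hk zz]; first by lia.
  - case: l => [|[|l]] //= pl.
    + have pl' : (p < cnt1 (n + 3) (s + (n + 2)) 0)%N by rewrite /=; lia.
      apply: (skip_point _ (hpts 0%N p pl')); rewrite /c' ?pl //.
      by move=> x hx /=; rewrite /skip; case: (ltnP x n); lia.
    + have pl' : (p < cnt1 (n + 3) (s + (n + 2)) 1)%N by rewrite /=; lia.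
      by apply: (skip_point (P := xpredT) _ (hpts 1%N p pl')); rewrite /c' ?pl.
  - by apply: hz; rewrite // nb.
  - apply: hz; rewrite ?skip_lt //; apply/orP; right; rewrite /zero1.
    case/orP: zz => [|zz]; last first.
      by apply/orP; right; apply/mapP; exists (i, j, k).
    rewrite /all3 /skip; case: (ltnP i n); case: (ltnP j n); case: (ltnP k n) => //; lia.
have z3 := zero_off_gap (leq_addr 3 n) zM.
rewrite (_ : n + 6 = n + 3 + 3)%N in d2; last by lia.
apply: d2 => [l p|i j k hi hj hk].
  case: l => [|[|[|l]]] //= p3.
  - have pl' : (p + s < cnt1 (n + 3) (s + (n + 2)) 0)%N by rewrite /=; lia.
    by have := hpts 0%N _ pl'; rewrite /c' ltnNge leq_addl /= addnK.
  - have pl' : (p < cnt1 (n + 3) (s + (n + 2)) 1)%N by rewrite /=; lia.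
    by have := hpts 1%N _ pl'; rewrite /c' p3.
  - have pl' : (p + (n + 2) < cnt1 (n + 3) (s + (n + 2)) 1)%N by rewrite /=; lia.
    by have := hpts 1%N _ pl'; rewrite /c' ltnNge leq_addl /= addnK.
case/orP=> [nb|/orP[] hh].
- by apply: hz; rewrite // nb.
- by apply: hz => //; rewrite /zero1 hh orbT.
- by apply: z3.
Qed.

(** Moving s points into L = K^n makes f vanish on L by the system in K^n; the same s points and the
    n + 2 general ones then determine f by their conditions transversal to L. *)
Lemma step0 n s E0 E1 :
  {in E0, forall t, [&& t.1.1 < n, t.1.2 < n & t.2 < n]%N} ->
  (exists c, determined0 n s E0 c) -> (exists c, determined1 n s E1 c) ->
  exists c, determined0 (n + 3) (s + (n + 2)) (E0 ++ E1) c.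
Proof.
move=> hE0 /generic_determined g0 /generic_determined g1.
pose h c : config K := fun l p b x => c l p b (skip n 3 x).
pose h' c : config K := fun l p b x => c l p b (unskip n 3 x).
have hK : cancel h' h.
  by move=> c; do 4!(apply: boolp.funext => ?); rewrite /h /h' skipK.
have [[c [d1 d0]] _] := generic_and g1 (generic_pull (fun _ _ _ => erefl) hK g0).
pose L := off_gap n 3; pose L' x := (x < n)%N.
pose c' : config K := fun l p b =>
  if (p < s)%N then masked L' (c 0%N p b) else c 1%N (p - s)%N b.
exists c'; move=> f hpts hz.
have sE x : (x < n)%N -> skip n 3 x = x by rewrite /skip => ->.
have zL : forall i j k, (i < n)%N -> (j < n)%N -> (k < n)%N -> f i j k = 0.
  have : forall i j k, (i < n)%N -> (j < n)%N -> (k < n)%N ->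
    f (skip n 3 i) (skip n 3 j) (skip n 3 k) = 0; last first.
    by move=> z i j k hi hj hk; have := z i j k hi hj hk; rewrite !sE.
  apply: (determined_skip (leqnn n) d0) => [l p|i j k hi hj hk nb|i j k hi hj hk zz].
  - case: l => [|l] //= pl.
    have pl' : (p < cnt0 (s + (n + 2)) 0)%N by rewrite /=; lia.
    exists (masked xpredT (c' 0%N p false)), (masked xpredT (c' 0%N p true)).
    split=> [|x hx|x hx]; first exact: hpts pl'; rewrite /c' pl /masked /h /L' /=.
      by have -> : (x < n)%N = false by lia.
    by rewrite sE // hx.
  - by apply: hz; rewrite // nb.
  - by rewrite !sE //; apply: hz; rewrite ?ltn_addr // /zero0 mem_cat (zz : _ \in E0) orbT.
apply: d1 => [l p|i j k hi hj hk].
  case: l => [|[|l]] //= pl.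
  - have pl' : (p < cnt0 (s + (n + 2)) 0)%N by rewrite /=; lia.
    by have := hpts 0%N _ pl'; rewrite /c' pl.
  - have pl' : (p + s < cnt0 (s + (n + 2)) 0)%N by rewrite /=; lia.
    by have := hpts 0%N _ pl'; rewrite /c' ltnNge leq_addl /= addnK.
case/orP=> [nb|/orP[/and3P[hi' hj' hk']|hh]].
- by apply: hz; rewrite // nb.
- exact: zL.
- by apply: hz; rewrite // /zero0 mem_cat hh !orbT.
Qed.

End Steps.

(** * The initial cases, by elimination modulo 2 *)

Lemma rmorph_dphi (R S : pzRingType) (h : {rmorphism R -> S}) v w b x i j k :
  h (dphi v w b x i j k) = dphi (h \o v) (h \o w) b x i j k.
Proof. by rewrite /dphi; case: b; rewrite !(rmorphD, rmorphN, rmorphM, rmorph_nat). Qed.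

Section Mod2.

(* An integer matrix whose determinant is odd is invertible over K. *)
Lemma mod2_total (K : numFieldType) (I : Type) m (A : I -> 'I_m -> int) :
  (forall g : 'I_m -> 'F_2, (forall i, \sum_t g t * (A i t)%:~R = 0) -> forall t, g t = 0) ->
  forall g : 'I_m -> K, (forall i, \sum_t g t * (A i t)%:~R = 0) -> forall t, g t = 0.
Proof.
move=> h2 g hg.
have [|s [fs _]] := select_rows h2 (s := @ord_elim0 I).
  by rewrite /row_free -leqn0 rank_leq_row.
pose M : 'M[int]_#|'I_m| := \matrix_(i, j) A (s i) (enum_val j).
have M0 : \det M != 0.
  apply: contraTneq fs => d0; rewrite row_free_unit unitmxE.
  have -> : row_sys (fun i t => (A i t)%:~R) s = map_mx (intr : int -> 'F_2) M.
    by apply/matrixP => i j; rewrite !mxE.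
  by rewrite det_map_mx d0 rmorph0 unitr0.
have uM : map_mx (intr : int -> K) M \in unitmx by rewrite unitmxE det_map_mx unitfE intr_eq0.
have E0 : map_mx (intr : int -> K) M *m \col_j g (enum_val j) = 0.
  apply/colP => i; rewrite !mxE -[RHS](hg (s i)).
  rewrite [RHS](reindex_onto (@enum_val 'I_m xpredT) enum_rank) /=; last first.
    by move=> j _; rewrite enum_rankK.
  by apply: eq_big => [j|j _]; rewrite ?enum_valK ?eqxx // !mxE mulrC.
have g0 : \col_j g (enum_val j) = 0 :> 'cV_#|'I_m|.
  by rewrite -(mulKmx uM (\col_j g (enum_val j))) E0 mulmx0.
by move=> t; have /colP/(_ (enum_rank t)) := g0; rewrite !mxE enum_rankK.
Qed.

Fixpoint xorv (u v : seq bool) : seq bool :=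
  match u, v with
  | x :: u', y :: v' => xorb x y :: xorv u' v'
  | [::], _ => v
  | _, [::] => u
  end.

Fixpoint pick_pivot (before rest : seq (seq bool)) : option (seq bool * seq (seq bool)) :=
  match rest with
  | [::] => None
  | r :: rest' =>
    if r is true :: t then Some (t, catrev before rest') else pick_pivot (r :: before) rest'
  end.

(** Forward elimination, one column and one pivot row at a time; a column without pivot means a
    nonzero kernel. *)
Fixpoint injective_mod2 (m : nat) (rows : seq (seq bool)) : bool :=
  if m is m'.+1 then
    if pick_pivot [::] rows is Some (t, rows') then
      injective_mod2 m' [seq if r is true :: r' then xorv r' t else behead r | r <- rows']
    else false
  else true.

Definition dot2 m (r : seq bool) (g : nat -> 'F_2) : 'F_2 :=
  \sum_(j < m) (nth false r j)%:R * g j.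

Lemma F2_xor (a b : bool) : (xorb a b)%:R = a%:R + b%:R :> 'F_2.
Proof. by case: a; case: b; apply/eqP. Qed.

Lemma F2_opp (a : 'F_2) : - a = a.
Proof. by rewrite oppr_pchar2 // pchar_Fp. Qed.

Lemma nth_xorv u v j : nth false (xorv u v) j = xorb (nth false u j) (nth false v j).
Proof. by elim: u v j => [|x u IH] [|y v] [|j] //=; rewrite ?nth_nil ?Bool.xorb_false_r. Qed.

Lemma dot2_xorv m u v g : dot2 m (xorv u v) g = dot2 m u g + dot2 m v g.
Proof.
rewrite /dot2 -big_split /=; apply: eq_bigr => j _.
by rewrite nth_xorv F2_xor mulrDl.
Qed.

Lemma dot2S m r g :
  dot2 m.+1 r g = (head false r)%:R * g 0%N + dot2 m (behead r) (g \o succn).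
Proof.
rewrite /dot2 big_ord_recl nth0; congr (_ + _); apply: eq_bigr => j _.
by rewrite nth_behead lift0.
Qed.

Lemma pick_pivotP before rest t rows : pick_pivot before rest = Some (t, rows) ->
  perm_eq (before ++ rest) ((true :: t) :: rows).
Proof.
elim: rest before => [//|r rest IH] before /=.
have mid : perm_eq (before ++ r :: rest) ((r :: before) ++ rest).
  by rewrite -[r :: rest]cat1s perm_catCA.
case: r mid => [|[] r] mid; try by move=> /IH; apply: perm_trans.
case=> <- <-; apply: (perm_trans mid).
by rewrite /= perm_cons catrevE perm_cat2r perm_sym perm_rev.
Qed.

(** The reduced rows are again equations, without the first unknown, so induction kills the later
    unknowns and the pivot row then kills the first. *)
Lemma injective_mod2P m rows (g : nat -> 'F_2) : injective_mod2 m rows ->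
  {in rows, forall r, dot2 m r g = 0} -> forall j, (j < m)%N -> g j = 0.
Proof.
elim: m rows g => [//|m IH] rows g /=.
case e : (pick_pivot [::] rows) => [[t rows']|//] inj hr.
have {e} /perm_mem eqr := pick_pivotP e.
have ht := hr (true :: t); rewrite eqr mem_head dot2S /= mul1r in ht.
have {}ht := ht isT.
have gS : forall j, (j < m)%N -> g j.+1 = 0.
  apply: (IH _ (g \o succn) inj) => _ /mapP[r rr ->].
  have := hr r; rewrite eqr inE rr orbT dot2S => /(_ isT).
  case: r {rr} => [|[] r] /=; rewrite ?mul0r ?add0r // mul1r => hrr.
  rewrite dot2_xorv -[dot2 m r _]addr0 -{1}(subrr (g 0%N)) addrA -[RHS](addr0 0) -{1}hrr -{1}ht.
  by rewrite F2_opp; ring.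
case=> [_|j]; last exact: gS.
move: ht; rewrite /dot2 big1 ?addr0 // => j _.
by rewrite /= gS ?mulr0.
Qed.

End Mod2.
Definition triples (n : nat) : seq (nat * nat * nat) :=
  [seq (ij, k) | ij <- [seq (i, j) | i <- iota 0 n, j <- iota 0 n], k <- iota 0 n].

Lemma mem_triples n t : (t \in triples n) = [&& t.1.1 < n, t.1.2 < n & t.2 < n]%N.
Proof.
case: t => [[i j] k]; apply/allpairsP/idP => [[[[i' j'] k']]|/and3P[hi hj hk]] /=.
  case=> /allpairsP[[a b] /= [ha hb [-> ->]]] hk [-> -> ->].
  by move: ha hb hk; rewrite !mem_iota !add0n /= => -> -> ->.
exists ((i, j), k); rewrite mem_iota /= add0n hk; split=> //.
by apply/allpairsP; exists (i, j); rewrite !mem_iota /= !add0n hi hj.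
Qed.

Lemma pairing_triples (K : numFieldType) n (f R : nat -> nat -> nat -> K) :
  pairing n f R = \sum_(t <- triples n) f t.1.1 t.1.2 t.2 * R t.1.1 t.1.2 t.2.
Proof.
rewrite /triples !big_allpairs /pairing.
have iE (F : nat -> K) : \sum_(i < n) F i = \sum_(i <- iota 0 n) F i.
  by rewrite -(big_mkord xpredT) /index_iota subn0.
rewrite (iE (fun i => \sum_(j < n) \sum_(k < n) f i j k * R i j k)); apply: eq_bigr => i _.
rewrite (iE (fun j => \sum_(k < n) f i j k * R i j k)); apply: eq_bigr => j _.
exact: (iE (fun k => f i j k * R i j k)).
Qed.

Definition bdphi (v w : nat -> bool) (b : bool) (x i j k : nat) : bool :=
  if b then v j && xorb (v i && (k == x)) ((i == x) && v k)
  else xorb ((j == x) && xorb (v i && w k) (w i && v k))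
            (v j && xorb ((i == x) && w k) (w i && (k == x))).

Lemma F2_bdphi v w b x i j k : (bdphi v w b x i j k)%:R =
  dphi (fun y => (v y)%:R) (fun y => (w y)%:R) b x i j k :> 'F_2.
Proof.
have F2_and (a c : bool) : (a && c)%:R = a%:R * c%:R :> 'F_2.
  by case: a; rewrite ?mul1r ?mul0r.
by rewrite /bdphi /dphi; case: b; rewrite !(F2_and, F2_xor) !F2_opp.
Qed.

Section Check.
Variables (n : nat) (mask : nat -> nat -> bool) (cnt : nat -> nat).
Variables (Z0 : nat -> nat -> nat -> bool) (pts : seq (seq (N * N))).

(* The points are given by the binary expansions of their coordinate vectors. *)
Definition point_bit (l q : nat) (b : bool) (x : nat) : bool :=
  let vw := nth (0, 0)%num (nth [::] pts l) q in
  N.testbit_nat (if b then vw.2 else vw.1) x.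

Definition unknowns : seq (nat * nat * nat) :=
  [seq t <- triples n | bidx t.1.1 t.1.2 t.2 && ~~ Z0 t.1.1 t.1.2 t.2].

Definition masked_bits (l q : nat) (b : bool) : seq bool :=
  [seq mask l x && point_bit l q b x | x <- iota 0 n].

Definition sing_row (U : seq (nat * nat * nat)) (v w : seq bool) (b : bool) (x : nat) : seq bool :=
  [seq bdphi (nth false v) (nth false w) b x t.1.1 t.1.2 t.2 | t <- U].

(** Three blocks suffice for all the systems to be checked; leaving out equations could only make
    the check fail. *)
Definition sing_rows (U : seq (nat * nat * nat)) : seq (seq bool) :=
  flatten [seq flatten [seq flatten [seq
    [seq sing_row U (masked_bits l q false) (masked_bits l q true) b x | x <- iota 0 n]
    | b <- [:: false; true]] | q <- iota 0 (cnt l)] | l <- iota 0 3].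

Definition check_determined : bool :=
  let U := unknowns in injective_mod2 (size U) (sing_rows U).

(** Points with coordinates 0 and 1 are defined over the integers, and so is [dphi]. The system over
    K is thus the image of an integral one whose reduction modulo 2 is the one eliminated. *)
Lemma check_determinedP (K : numFieldType) : check_determined ->
  exists c : config K, determined n mask cnt Z0 c.
Proof.
rewrite /check_determined; set U := unknowns => chk.
exists (fun l q b x => (point_bit l q b x)%:R) => f hf hz.
pose vec (R : pzRingType) l q b : nat -> R := masked (mask l) (fun x => (point_bit l q b x)%:R).
pose I := (nat * nat * bool * nat)%type.
pose t_ (j : 'I_(size U)) := nth (0, 0, 0)%N U j.
pose A (i : I) (j : 'I_(size U)) : int := let: (l, q, b, x) := i in
  if (l < 3)%N && (q < cnt l)%N && (x < n)%N then
  dphi (vec int l q false) (vec int l q true) b x (t_ j).1.1 (t_ j).1.2 (t_ j).2 else 0.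
have vecE (R : pzRingType) l q b : (intr : int -> R) \o vec int l q b = vec R l q b.
  by apply: boolp.funext => x; rewrite /vec /masked /=; case: (mask l x); case: point_bit.
have AE (R : pzRingType) l q b x j : (l < 3)%N -> (q < cnt l)%N -> (x < n)%N ->
    (A (l, q, b, x) j)%:~R = dphi (vec R l q false) (vec R l q true) b x
      (t_ j).1.1 (t_ j).1.2 (t_ j).2.
  move=> hl hq hx; rewrite /A hl hq hx -(vecE R l q false) -(vecE R l q true).
  exact: (rmorph_dphi (intr : {rmorphism int -> R})).
have tU j : t_ j \in U by apply: mem_nth.
have g0 : forall j : 'I_(size U), f (t_ j).1.1 (t_ j).1.2 (t_ j).2 = 0.
  apply: (@mod2_total K I _ A) => [g hg j|[[[l q] b] x]].
    pose g' k := if insub k is Some k' then g k' else 0.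
    have g'E (k : 'I_(size U)) : g' k = g k by rewrite /g' valK.
    rewrite -g'E; apply: (injective_mod2P chk) => //.
    move=> r /flattenP[_ /mapP[l hl ->] /flattenP[_ /mapP[q hq ->]]].
    move=> /flattenP[_ /mapP[b _ ->] /mapP[x hx ->]].
    move: hl hq hx; rewrite !mem_iota !add0n /= => hl hq hx.
    rewrite -[RHS](hg (l, q, b, x)) /dot2; apply: eq_bigr => k _.
    rewrite g'E mulrC AE // /sing_row (nth_map (0, 0, 0)%N) // F2_bdphi; congr (_ * _).
    have := tU k; rewrite mem_filter mem_triples => /andP[_ /and3P[hi hj hk]].
    have bE c y : (y < n)%N ->
        (nth false (masked_bits l q c) y)%:R = vec 'F_2 l q c y.
      move=> hy; rewrite (nth_map 0%N) ?size_iota // nth_iota // add0n.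
      by rewrite /vec /masked; case: (mask l y).
    by rewrite /dphi !bE.
  have [/andP[/andP[hl hq] hx]|/negPf no] := boolP ((l < 3)%N && (q < cnt l)%N && (x < n)%N);
    last by apply: big1 => k _; rewrite /A no mulr0.
  rewrite -[RHS](hf l q hq b x hx) pairing_triples.
  rewrite [RHS](bigID (fun t => bidx t.1.1 t.1.2 t.2 && ~~ Z0 t.1.1 t.1.2 t.2)) /=.
  rewrite [X in _ = _ + X]big_seq_cond [X in _ = _ + X]big1 => [|t]; last first.
    rewrite mem_triples negb_and negbK => /andP[/and3P[hi hj hk] nt].
    by rewrite hz ?mul0r.
  rewrite addr0 -[RHS]big_filter -/unknowns -/U [RHS](big_nth (0, 0, 0)%N) big_mkord.
  by apply: eq_bigr => k _; rewrite AE.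
move=> i j k hi hj hk.
have [/andP[hb hZ]|nb] := boolP (bidx i j k && ~~ Z0 i j k); last first.
  by apply: hz; rewrite // -[Z0 i j k]negbK -negb_and.
have iU : (i, j, k) \in U by rewrite mem_filter /= hb hZ mem_triples /= hi hj hk.
have lt : (index (i, j, k) U < size U)%N by rewrite index_mem.
by have := g0 (Ordinal lt); rewrite /t_ /= nth_index.
Qed.
End Check.

Section Base.
Variable K : numFieldType.

Ltac by_elimination p := by apply: (@check_determinedP _ _ _ _ p); vm_compute.

(** The listed triples are coordinates set to 0 in order to complete the system: here 8 unknowns, 4
    conditions from the point, 4 coordinates. In the exceptional systems (3, 2) and (4, 3) one
    coordinate more is needed than the expected count gives, namely 1 and 3. *)
Lemma base0_3_1 : exists c : config K,
  determined0 3 1 [:: (0, 0, 1); (0, 0, 2); (0, 1, 1); (0, 1, 2)]%N c.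
Proof.
by_elimination
  [:: [:: (4, 6)]]%num.
Qed.

Lemma base0_3_2 : exists c : config K,
  determined0 3 2 [:: (0, 1, 2)]%N c.
Proof.
by_elimination
  [:: [:: (4, 2); (3, 6)]]%num.
Qed.

Lemma base0_3_3 : exists c : config K,
  determined0 3 3 [::] c.
Proof.
by_elimination
  [:: [:: (4, 3); (3, 0); (5, 4)]]%num.
Qed.

Lemma base0_4_2 : exists c : config K,
  determined0 4 2 [:: (0, 2, 2); (0, 3, 2); (1, 2, 2); (1, 2, 3); (1, 3, 2); (1, 3, 3); (2, 2, 3); (2, 3, 3)]%N c.
Proof.
by_elimination
  [:: [:: (14, 7); (5, 6)]]%num.
Qed.

Lemma base0_4_3 : exists c : config K,
  determined0 4 3 [:: (0, 3, 3); (1, 3, 3); (2, 3, 3)]%N c.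
Proof.
by_elimination
  [:: [:: (15, 1); (9, 4); (12, 2)]]%num.
Qed.

Lemma base0_4_4 : exists c : config K,
  determined0 4 4 [::] c.
Proof.
by_elimination
  [:: [:: (6, 8); (4, 9); (10, 11); (3, 10)]]%num.
Qed.

Lemma base0_5 : exists c : config K,
  determined0 5 5 [::] c.
Proof.
by_elimination
  [:: [:: (2, 11); (16, 28); (5, 24); (30, 4); (31, 8)]]%num.
Qed.

Lemma base0_6 : exists c : config K,
  determined0 6 7 [::] c.
Proof.
by_elimination
  [:: [:: (12, 21); (53, 28); (34, 39); (47, 11); (55, 49); (60, 42); (51, 10)]]%num.
Qed.

Lemma base0_7_9 : exists c : config K,
  determined0 7 9 [:: (3, 4, 4); (3, 6, 5); (4, 6, 5); (5, 5, 6)]%N c.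
Proof.
by_elimination
  [:: [:: (108, 57); (103, 80); (106, 59); (33, 2); (19, 113); (115, 118); (102, 94); (17, 100); (64, 67)]]%num.
Qed.

Lemma base0_7_10 : exists c : config K,
  determined0 7 10 [::] c.
Proof.
by_elimination
  [:: [:: (125, 120); (114, 122); (77, 53); (54, 106); (14, 125); (112, 19); (24, 59); (35, 58); (57, 16); (8, 12)]]%num.
Qed.

Lemma base1_2 : exists c : config K,
  determined1 2 1 [::] c.
Proof.
by_elimination
  [:: [:: (2, 3)];
    [:: (28, 8); (13, 30); (18, 23); (24, 17)]]%num.
Qed.

Lemma base1_3 : exists c : config K,
  determined1 3 2 [::] c.
Proof.
by_elimination
  [:: [:: (3, 6); (2, 5)];
    [:: (58, 15); (11, 52); (33, 9); (54, 19); (43, 25)]]%num.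
Qed.

Lemma base1_4_3 : exists c : config K,
  determined1 4 3 [:: (4, 6, 6); (5, 5, 6)]%N c.
Proof.
by_elimination
  [:: [:: (1, 14); (5, 8); (6, 8)];
    [:: (117, 58); (70, 50); (66, 80); (19, 65); (124, 39); (101, 115)]]%num.
Qed.

Lemma base1_4_4 : exists c : config K,
  determined1 4 4 [::] c.
Proof.
by_elimination
  [:: [:: (8, 9); (9, 4); (10, 12); (15, 14)];
    [:: (101, 123); (21, 53); (93, 103); (64, 108); (60, 98); (102, 113)]]%num.
Qed.

Lemma base2 a : (a < 3)%N -> exists c : config K, determined2 a c.
Proof.
case: a => [|[|[|//]]] _.
- by_elimination
  [:: [:: (4, 7); (5, 4)];
    [:: (24, 16); (56, 32)];
    [:: (59, 49); (47, 38); (14, 42)]]%num.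
- by_elimination
  [:: [:: (3, 13); (8, 3); (2, 10)];
    [:: (96, 64); (16, 32); (17, 97)];
    [:: (87, 65); (45, 58); (127, 56)]]%num.
- by_elimination
  [:: [:: (26, 16); (14, 25); (24, 28); (5, 21)];
    [:: (32, 224); (195, 66); (33, 96); (34, 98)];
    [:: (229, 111); (179, 136); (81, 156)]]%num.
Qed.

Lemma base3 : exists c : config K, determined3 0 c.
Proof.
by_elimination
  [:: [:: (38, 30); (37, 36); (62, 4)];
    [:: (385, 257); (194, 69); (133, 450)];
    [:: (168, 200); (432, 248); (472, 328)]]%num.
Qed.

End Base.

Local Close Scope ring_scope.

(** * The three inductions and the number of points in each *)

Section Families.
Variable K : numFieldType.

Definition bounded n (E : seq (nat * nat * nat)) : Prop :=
  {in E, forall t, [&& t.1.1 < n, t.1.2 < n & t.2 < n]}.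

(** The system is square: there are 18 a + 54 unknowns; each of the 2 (a + 2) points of L or M
    imposes 6 new conditions and each of the three general points imposes 2 a + 10. *)
Lemma family2 a : exists c : config K, determined2 a c.
Proof.
elim/ltn_ind: a => a IH; have [/base2//|a3] := ltnP a 3.
rewrite -(subnK a3); apply: step2; first by apply: IH; lia.
exact/shift3/base3.
Qed.

Definition exists1 n s m : Prop :=
  exists E, [/\ size E = m, bounded (n + 3) E & exists c : config K, determined1 n s E c].

Definition exists0 n s m : Prop :=
  exists E, [/\ size E = m, bounded n E & exists c : config K, determined0 n s E c].

Lemma exists1_step n s m : exists1 n s m -> exists1 (n + 3) (s + (n + 2)) m.
Proof.
move=> [E [sE bE hE]]; exists (map (skip_triple n 3) E); split.
- by rewrite size_map.
- by move=> _ /mapP[t /bE /and3P[t1 t2 t3] ->]; rewrite /= !skip_lt.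
- by apply: step1 => //; apply: family2.
Qed.

Lemma exists0_step n s m m' : exists0 n s m -> exists1 n s m' ->
  exists0 (n + 3) (s + (n + 2)) (m + m').
Proof.
move=> [E [sE bE hE]] [E' [sE' bE' hE']]; exists (E ++ E'); split.
- by rewrite size_cat sE sE'.
- move=> t; rewrite mem_cat => /orP[/bE/and3P[t1 t2 t3]|/bE'//].
  by rewrite !ltn_addr.
- exact: step0.
Qed.

(** Forms on K^(n+3) vanishing on K^n have 3 n^2 + 9 n + 8 coordinates. The general points impose 2
    (n + 2)^2 conditions and each point of L imposes 6, so a square system needs 6 s = n (n + 1).
    For n = 1 modulo 3 this is not solvable: s is rounded down, with two coordinates set to 0, or
    rounded up. *)
Lemma family1 n : 1 < n ->
  if n %% 3 == 1 then exists s, [/\ 6 * s + 2 = n * (n + 1), exists1 n s 2 & exists1 n (s + 1) 0]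
  else exists s, 6 * s = n * (n + 1) /\ exists1 n s 0.
Proof.
elim/ltn_ind: n => n IH n1.
have [n5|n5] := ltnP n 5.
  have [->|[->|->]] : n = 2 \/ (n = 3 \/ n = 4) by lia.
  - by exists 1; split=> //; exists [::]; split=> //; apply: base1_2.
  - by exists 2; split=> //; exists [::]; split=> //; apply: base1_3.
  - exists 3; split=> //.
      by exists [:: (4, 6, 6); (5, 5, 6)]; split=> //; [move=> t; rewrite !inE => /orP[]/eqP->|apply: base1_4_3].
    by exists [::]; split=> //; apply: base1_4_4.
have lt : n - 3 < n by lia.
have gt : 1 < n - 3 by lia.
have en : n = n - 3 + 3 by lia.
have := IH _ lt gt; move: (n - 3) en gt => m -> m1 {lt IH n1 n5 n}.
rewrite modnDr; case: ifP => _.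
  move=> [s [es h1 h2]]; exists (s + (m + 2)); split; first by lia.
    exact: exists1_step.
  have -> : s + (m + 2) + 1 = s + 1 + (m + 2) by lia.
  exact: exists1_step.
by move=> [s [es h]]; exists (s + (m + 2)); split; [lia|apply: exists1_step].
Qed.

(** A square system needs s (2 n - 2) = n (n^2 - 1) / 3, which is again 6 s = n (n + 1), so the same
    s fits the transversal system. For n = 1 modulo 3 the remainder is 2 (n - 1) / 3 coordinates.
    The induction cannot start at n = 3 or 4, where these values of s are the exceptional ones. *)
Lemma family0 n : 4 < n ->
  if n %% 3 == 1 then exists s, [/\ 6 * s + 2 = n * (n + 1),
     exists0 n s (2 * (n - 1) %/ 3) & exists0 n (s + 1) 0]
  else exists s, 6 * s = n * (n + 1) /\ exists0 n s 0.
Proof.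
elim/ltn_ind: n => n IH n1.
have [n5|n5] := ltnP n 8.
  have [->|[->|->]] : n = 5 \/ (n = 6 \/ n = 7) by lia.
  - by exists 5; split=> //; exists [::]; split=> //; apply: base0_5.
  - by exists 7; split=> //; exists [::]; split=> //; apply: base0_6.
  - exists 9; split=> //; last by exists [::]; split=> //; apply: base0_7_10.
    exists [:: (3, 4, 4); (3, 6, 5); (4, 6, 5); (5, 5, 6)]; split=> //; last exact: base0_7_9.
    by move=> t; rewrite !inE => /or4P[]/eqP->.
have lt : n - 3 < n by lia.
have gt : 4 < n - 3 by lia.
have en : n = n - 3 + 3 by lia.
have := IH _ lt gt; have := @family1 (n - 3) ltac:(lia).
move: (n - 3) en gt => m -> m1 {lt IH n1 n5 n}.
rewrite modnDr; case: ifP => [/eqP m3|_].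
  move=> [s' [es' h1' h2']] [s [es h1 h2]]; have ss : s' = s by lia.
  rewrite ss in h1' h2'; exists (s + (m + 2)); split; first by lia.
    have -> : 2 * (m + 3 - 1) %/ 3 = 2 * (m - 1) %/ 3 + 2 by lia.
    exact: exists0_step.
  have -> : s + (m + 2) + 1 = s + 1 + (m + 2) by lia.
  exact: (exists0_step h2 h2').
move=> [s' [es' h']] [s [es h]]; have ss : s' = s by lia.
rewrite ss in h'; exists (s + (m + 2)); split; first by lia.
exact: (exists0_step h h').
Qed.

(* The last equation says m + s (2 n - 2) = dim S_(2,1) K^n. *)
Lemma determined_points n : 4 < n -> exists s s' m,
  [/\ exists0 n s m, exists0 n s' 0, s' <= s + 1 &
      3 * (m + s * (2 * n - 2)) = n * (n - 1) * (n + 1)].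
Proof.
move=> n4; have := family0 n4; case: ifP => [/eqP m3 [s [es h h']]|_ [s [es h]]].
  exists s, (s + 1), (2 * (n - 1) %/ 3); split=> //.
  have e : 3 * (2 * (n - 1) %/ 3) = 2 * (n - 1).
    by rewrite mulnC divnK //; have := divn_eq n 3; rewrite m3; lia.
  rewrite mulnDr e.
  have -> : 3 * (s * (2 * n - 2)) = (6 * s) * (n - 1) by nia.
  have -> : 6 * s = n * (n + 1) - 2 by lia.
  nia.
exists s, s, 0; split=> //; first by lia.
rewrite add0n.
have -> : 3 * (s * (2 * n - 2)) = (6 * s) * (n - 1) by nia.
rewrite es; nia.
Qed.

End Families.

Local Open Scope ring_scope.

(** * The Schur module and the flag variety *)

Section Tensors.
Variables (K : numFieldType) (n : nat).
Local Notation tensor3 := {ffun 'I_n * 'I_n * 'I_n -> K^o}.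
Local Notation W := (subvs_of (schur21 K n)).
Implicit Types (t : tensor3) (a b c v w : nat -> K).

(** On tensors with these two symmetries the Young symmetrizer is multiplication by 3. *)
Lemma schur21P t : reflect
  ((forall i j k, t (i, j, k) = - t (k, j, i)) /\
   (forall i j k, t (i, j, k) + t (j, k, i) + t (k, i, j) = 0))
  (t \in schur21 K n).
Proof.
apply: (iffP idP) => [/memv_imgP[u _ ->]|[anti cyc]].
  by rewrite lfunE /=; split=> i j k; rewrite !ffunE /=; ring.
have -> : t = linfun (@young21 K n) (3%:R^-1 *: t).
  apply/ffunP => -[[i j] k]; rewrite lfunE /= !ffunE /= !/(_ *: _) /=.
  have e1 : t (j, i, k) = - t (k, i, j) by apply: anti.
  have e2 : t (k, j, i) = - t (i, j, k) by apply: anti.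
  have e3 : t (j, k, i) = - t (i, j, k) - t (k, i, j).
    by apply/eqP; rewrite -subr_eq0 -(cyc i j k); apply/eqP; ring.
  by rewrite e1 e2 e3; field.
exact: memv_img (memvf _).
Qed.

(** Straightening: antisymmetry reduces to i < k, and if moreover j < i the cyclic relation
    expresses the entry through two semistandard ones. *)
Lemma schur21_eq0 t : t \in schur21 K n ->
  (forall i j k : 'I_n, bidx i j k -> t (i, j, k) = 0) -> t = 0.
Proof.
move=> /schur21P[anti cyc] h; apply/ffunP => -[[i j] k]; rewrite ffunE.
have lt (a b c : 'I_n) : (a < c)%N -> t (a, b, c) = 0.
  move=> ac; have [ab|ba] := leqP a b; first by apply: h; rewrite /bidx ab ac.
  have e := cyc a b c; rewrite (anti c a b) (h b c a) /bidx in e; last by lia.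
  by rewrite (h b a c) /bidx in e; [rewrite addr0 subr0 in e|lia].
have [ik|ki|ik] := ltngtP i k; first exact: lt.
  by rewrite anti lt ?oppr0.
have := anti i j k; rewrite -(val_inj ik) => e.
by apply/eqP; rewrite -eqNr -e.
Qed.

(** Trilinear, so it polarizes [phi], whose value at (v, w) represents the flag spanned by v inside
    the plane spanned by v and w. *)
Definition tri a b c : tensor3 :=
  [ffun t : 'I_n * 'I_n * 'I_n => b t.1.2 * (a t.1.1 * c t.2 - c t.1.1 * a t.2)].
Definition phi v w : tensor3 := tri v v w.
Definition dphi_tensor v w (b : bool) (x : nat) : tensor3 :=
  [ffun t : 'I_n * 'I_n * 'I_n => dphi v w b x t.1.1 t.1.2 t.2].

Lemma phi_schur v w : phi v w \in schur21 K n.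
Proof. by apply/schur21P; split=> i j k; rewrite !ffunE /=; ring. Qed.

Lemma tri_sym_schur a b c : tri a b c + tri b a c \in schur21 K n.
Proof. by apply/schur21P; split=> i j k; rewrite !ffunE /=; ring. Qed.

Lemma dphi_schur v w (b : bool) x : dphi_tensor v w b x \in schur21 K n.
Proof. by apply/schur21P; split=> i j k; rewrite !ffunE /= /dphi; case: b; ring. Qed.

Definition phiW v w : W := vsproj _ (phi v w).

Lemma vsval_phiW v w : vsval (phiW v w) = phi v w.
Proof. exact/vsprojK/phi_schur. Qed.

Lemma polyfun_vsproj (I : finType) (F : (I -> K) -> tensor3) :
  (forall q, polyfun (fun h => F h q)) ->
  forall i, polyfun (fun h => coord (vbasis {:W}) i (vsproj _ (F h) : W)).
Proof.
move=> hF i.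
pose d (s : 'I_n * 'I_n * 'I_n) : tensor3 := [ffun q => (q == s)%:R].
have [P hP] : polyfun (fun h => \sum_s F h s * coord (vbasis {:W}) i (vsproj _ (d s) : W)).
  by apply: polyfun_sum => s; apply: polyfunM; [apply: hF|apply: polyfun_cst].
exists P => h; rewrite -hP.
have {1}-> : F h = \sum_s F h s *: d s.
  apply/ffunP => t; rewrite sum_ffunE (bigD1 t) //= big1 => [|s st].
    by rewrite !ffunE eqxx addr0 /GRing.scale /= mulr1.
  by rewrite !ffunE eq_sym (negPf st) /GRing.scale /= mulr0.
by rewrite !linear_sum; apply: eq_bigr => s _; rewrite !linearZ.
Qed.

Lemma phiZ (q r : K) v w :
  phi (fun x => q * v x) (fun x => r * w x) = (q ^+ 2 * r) *: phi v w.
Proof. by apply/ffunP => t; rewrite !ffunE /GRing.scale /=; ring. Qed.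

Definition evec (x y : nat) : K := (y == x)%:R.

Definition mxvec_of (g : 'M[K]_n) (v : nat -> K) (x : nat) : K :=
  if insub x is Some i then \sum_j g i j * v j else 0.

Lemma mxvec_ofE g v (i : 'I_n) : mxvec_of g v i = \sum_j g i j * v j.
Proof. by rewrite /mxvec_of valK. Qed.

Lemma eq_phi v w v' w' : (forall i : 'I_n, v i = v' i) -> (forall i : 'I_n, w i = w' i) ->
  phi v w = phi v' w'.
Proof. by move=> hv hw; apply/ffunP => t; rewrite !ffunE !hv !hw. Qed.

Lemma gl_phi g v w : gl_tensor3 g (phi v w) = phi (mxvec_of g v) (mxvec_of g w).
Proof.
apply/ffunP => -[[i j] k]; rewrite !ffunE /= !mxvec_ofE.
under eq_bigr => a _.
  under eq_bigr => b _.
    rewrite (eq_bigr (fun c : 'I_n => (g j b * v b) * ((g i a * v a) * (g k c * w c)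
      - (g i a * w a) * (g k c * v c)))); last first.
      by move=> c _; rewrite ffunE /=; ring.
    rewrite -mulr_sumr sumrB -!mulr_sumr.
    over.
  rewrite -mulr_suml.
  over.
by rewrite -mulr_sumr sumrB -!mulr_suml.
Qed.

End Tensors.

Section Flag.
Variables (K : numFieldType) (n : nat).
Hypothesis n2 : (1 < n)%N.
Local Notation tensor3 := {ffun 'I_n * 'I_n * 'I_n -> K^o}.
Local Notation W := (subvs_of (schur21 K n)).
Local Notation phiW := (@phiW K n).
Local Notation phi := (@phi K n).

Let i0 : 'I_n := Ordinal (ltnW n2).
Let i1 : 'I_n := Ordinal n2.
Local Notation e0 := (@evec K 0).
Local Notation e1 := (@evec K 1).

Lemma gl_tensor3Z (g : 'M[K]_n) c (t : tensor3) : gl_tensor3 g (c *: t) = c *: gl_tensor3 g t.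
Proof.
apply/ffunP => -[[i j] k]; rewrite !ffunE scaler_sumr; apply: eq_bigr => a _.
rewrite scaler_sumr; apply: eq_bigr => b _; rewrite scaler_sumr; apply: eq_bigr => d _.
by rewrite ffunE /GRing.scale /=; ring.
Qed.

Lemma mxvec_of_evec (g : 'M[K]_n) (x i : 'I_n) : mxvec_of g (@evec K x) i = g i x.
Proof.
rewrite mxvec_ofE (bigD1 x) //= big1 => [|j jx]; first by rewrite /evec eqxx mulr1 addr0.
by rewrite /evec val_eqE (negPf jx) mulr0.
Qed.

Lemma phi_e01 : phi e0 e1 != 0.
Proof.
apply/eqP => /ffunP/(_ (i0, i0, i1)); rewrite !ffunE /evec /= => e.
by have /eqP := oner_neq0 K; apply; rewrite -[RHS]e; ring.
Qed.

Lemma phiW_eq0 v w : (phiW v w == 0) = (phi v w == 0).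
Proof. by rewrite -(inj_eq (@subvs_inj _ _ _)) vsval_phiW. Qed.

Lemma phi_e01_weight (b : 'M[K]_n) : is_trig_mx b^T ->
  gl_tensor3 b (phi e0 e1) =
  (\prod_(i < n) b i i ^+ nth 0%N [:: 2; 1]%N i) *: phi e0 e1.
Proof.
move=> /is_trig_mxP tb; have b0 (i j : 'I_n) : (j < i)%N -> b i j = 0.
  by move=> ji; have := tb j i ji; rewrite mxE.
have -> : \prod_(i < n) b i i ^+ nth 0%N [:: 2; 1]%N i = b i0 i0 ^+ 2 * b i1 i1.
  rewrite (bigD1 i0) // (bigD1 i1) //= big1 ?mulr1 // => i.
  rewrite -!val_eqE /=; case: (nat_of_ord i) => [|[|m]] //= _.
  by rewrite ?nth_nil ?expr0.
rewrite gl_phi (@eq_phi _ _ _ _ (fun x => b i0 i0 * e0 x)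
   (fun x => b i0 i1 * e0 x + b i1 i1 * e1 x)).
- by apply/ffunP => t; rewrite !ffunE /GRing.scale /=; ring.
- move=> i; rewrite (mxvec_of_evec b i0) /evec.
  have [->|ne] := eqVneq i i0; first by rewrite eqxx mulr1.
  rewrite b0; first by rewrite -val_eqE /= in ne; rewrite (negPf ne) mulr0.
  by rewrite lt0n; move: ne; rewrite -val_eqE.
- move=> i; rewrite (mxvec_of_evec b i1) /evec.
  have [->|ne] := eqVneq i i0; first by rewrite eqxx mulr1 mulr0 addr0.
  have [->|ne'] := eqVneq i i1; first by rewrite mulr0 eqxx mulr1 add0r.
  move: ne ne'; rewrite -!val_eqE /= => ne ne'; rewrite (negPf ne) (negPf ne') !mulr0 addr0.
  by apply: b0 => /=; lia.
Qed.

(** The diagonal matrix with entry 2 at m and 1 elsewhere compares powers of 2: in a nonzero entry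
    (i, j, k) the index m occurs as often as in (0, 0, 1). Three entries are left, and the
    symmetries tie them to the one at (0, 0, 1). *)
Lemma highest_weightP (u : W) : highest_weight_vector21 u <->
  exists2 c : K, c != 0 & u = c *: phiW e0 e1.
Proof.
split=> [[u0 hu]|[c c0 ->]]; last first.
  split; first by rewrite scaler_eq0 negb_or c0 phiW_eq0 phi_e01.
  move=> b _ tb; apply: subvs_inj; rewrite vsval_gl_schur21 linearZ /= gl_tensor3Z vsval_phiW phi_e01_weight //.
  by rewrite !linearZ /= ?vsval_phiW !scalerA mulrC.
pose t := vsval u.
have tS : t \in schur21 K n by apply: subvsP.
have [anti cyc] := schur21P _ tS.
pose d (m x : 'I_n) : K := if x == m then 2%:R else 1.
have wt m i j k : d m i * d m j * d m k * t (i, j, k) = d m i0 ^+ 2 * d m i1 * t (i, j, k).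
  pose b := diag_mx (\row_x d m x).
  have bE x y : b x y = d m x *+ (x == y) by rewrite !mxE.
  have ub : b \in unitmx.
    rewrite unitmxE det_diag unitfE; apply/prodf_neq0 => x _; rewrite mxE /d.
    by case: ifP => _; rewrite ?oner_eq0 ?pnatr_eq0.
  have tb : is_trig_mx b^T.
    by apply/is_trig_mxP => x y xy; rewrite mxE bE -val_eqE /= gtn_eqF.
  have := congr1 (fun z : W => vsval z (i, j, k)) (hu b ub tb).
  rewrite vsval_gl_schur21 linearZ /= !ffunE /= -/t => e.
  have pE : \prod_(i < n) b i i ^+ nth 0%N [:: 2; 1]%N i = d m i0 ^+ 2 * d m i1.
    rewrite (bigD1 i0) // (bigD1 i1) //= big1 => [|x]; first by rewrite mulr1 !bE !eqxx.
    rewrite -!val_eqE /=; case: (nat_of_ord x) => [|[|q]] //= _.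
    by rewrite ?nth_nil ?expr0.
  rewrite -pE; move: e; rewrite [X in _ = X]/GRing.scale /= => <-.
  rewrite (bigD1 i) //= [X in _ = _ + X]big1 => [|x xi]; last first.
    apply: big1 => y _; apply: big1 => z _.
    by rewrite bE eq_sym (negPf xi) mulr0n !mul0r.
  rewrite addr0 (bigD1 j) //= [X in _ = _ + X]big1 => [|x xi]; last first.
    by apply: big1 => y _; rewrite (bE j) eq_sym (negPf xi) mulr0n mulr0 !mul0r.
  rewrite addr0 (bigD1 k) //= [X in _ = _ + X]big1 => [|x xi]; last first.
    by rewrite (bE k) eq_sym (negPf xi) mulr0n mulr0 mul0r.
  by rewrite addr0 !bE !eqxx.
have supp i j k : t (i, j, k) != 0 -> forall m : 'I_n,
    ((i == m) + (j == m) + (k == m) = (i0 == m) + (i0 == m) + (i1 == m))%N.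
  move=> tn m; have := wt m i j k => /(mulIf tn); rewrite /d.
  have dE (q : bool) : (if q then 2%:R else 1) = 2%:R ^+ q :> K by case: q.
  rewrite !dE expr2 -!exprD; apply: ieexprIn; first by rewrite ltr0n.
  by rewrite (eqr_nat K 2 1).
have i01 : (i0 == i1) = false by [].
have zero i j k : ~~ [|| [&& i == i0, j == i0 & k == i1], [&& i == i0, j == i1 & k == i0] |
    [&& i == i1, j == i0 & k == i0]] -> t (i, j, k) = 0.
  move=> no; apply/eqP; apply: contraT => /supp h.
  have ex x : (x == i0) && (x == i1) = false.
    by apply/negbTE/negP => /andP[/eqP-> ]; rewrite i01.
  move: (h i0) (h i1) (ex i) (ex j) (ex k) no; rewrite !eqxx [i1 == i0]eq_sym i01.
  by do 6!case: (_ == _) => //=.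
exists (t (i0, i0, i1)).
  apply: contraNneq u0 => t0; rewrite -(inj_eq (@subvs_inj _ _ _)) -/t.
  apply/eqP/ffunP => -[[i j] k]; rewrite ffunE.
  have [/or3P[]/and3P[/eqP-> /eqP-> /eqP->]|/zero//] := boolP [|| [&& i == i0, j == i0 & k == i1],
    [&& i == i0, j == i1 & k == i0] | [&& i == i1, j == i0 & k == i0]].
  - exact: t0.
  - by apply/eqP; rewrite -eqNr -anti.
  - by rewrite anti t0 oppr0.
apply: subvs_inj; rewrite -/t linearZ /= vsval_phiW.
apply/ffunP => -[[i j] k]; rewrite !ffunE /evec /=.
have [/or3P[]/and3P[/eqP-> /eqP-> /eqP->]|no] := boolP [|| [&& i == i0, j == i0 & k == i1],
    [&& i == i0, j == i1 & k == i0] | [&& i == i1, j == i0 & k == i0]].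
- by rewrite /GRing.scale /=; ring.
- have -> : t (i0, i1, i0) = 0 by apply/eqP; rewrite -eqNr -anti.
  by rewrite /GRing.scale /=; ring.
- by rewrite anti /GRing.scale /=; ring.
rewrite zero //; move: no; rewrite -!val_eqE /=.
case: (nat_of_ord i) => [|[|i']]; case: (nat_of_ord j) => [|[|j']];
  case: (nat_of_ord k) => [|[|k']] //= _; rewrite /GRing.scale /=; ring.
Qed.

Lemma vlineZ (c : K) (u : W) : c != 0 -> (<[c *: u]> = <[u]>)%VS.
Proof.
move=> c0; apply/eqP; rewrite eqEsubv -!memvE memvZ ?memv_line //=.
by rewrite -{1}[u]scale1r -(mulVf c0) -scalerA memvZ ?memv_line.
Qed.

(** If [phi v w] is nonzero then v and w are independent, so they are the first two columns of an
    invertible matrix. *)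
Lemma extend_pair v w : phi v w != 0 -> exists g : 'M[K]_n,
  [/\ g \in unitmx, forall i : 'I_n, v i = mxvec_of g e0 i &
      forall i : 'I_n, w i = mxvec_of g e1 i].
Proof.
move=> vw.
pose U : 'M[K]_(2, n) := \matrix_(i, j) (val i == val j)%:R.
pose f : 'M[K]_n := \matrix_(i, j) (if i == i0 then v j else if i == i1 then w j else 0).
have UE (g : 'M[K]_n) (r : 'I_2) (x : 'I_n) j : val r = val x -> (U *m g) r j = g x j.
  move=> rx; rewrite mxE (bigD1 x) //= big1 => [|y yx]; first by rewrite mxE rx eqxx mul1r addr0.
  by rewrite mxE rx eq_sym val_eqE (negPf yx) mul0r.
have freeUf : row_free (U *m f).
  apply: inj_row_free => x xf.
  have e (j : 'I_n) : x 0 ord0 * v j + x 0 ord_max * w j = 0.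
    have := congr1 (fun B : 'M_(_, _) => B 0 j) xf; rewrite [LHS]mxE big_ord_recl big_ord1.
    rewrite (@UE f _ i0) // (_ : lift ord0 ord0 = ord_max); last exact: val_inj.
    by rewrite (@UE f _ i1) // !mxE eqxx /= => ->.
  have x1 : x 0 ord_max = 0.
    apply/eqP; apply: contraNT vw => x1; apply/eqP.
    have we (j : 'I_n) : w j = - (x 0 ord0 / x 0 ord_max) * v j.
      have := e j; rewrite addrC => /eqP; rewrite addr_eq0 => /eqP e'.
      by rewrite mulNr mulrAC -mulNr -e' mulrC mulKf.
    by apply/ffunP => t; rewrite !ffunE !we; ring.
  have x0 : x 0 ord0 = 0.
    apply/eqP; apply: contraNT vw => x0; apply/eqP/ffunP => t; rewrite !ffunE.
    have v0 (j : 'I_n) : v j = 0.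
      have := e j; rewrite x1 mul0r addr0 => /eqP.
      by rewrite mulf_eq0 (negPf x0) => /eqP.
    by rewrite !v0; ring.
  apply/rowP => j; rewrite mxE; case: j => [[|[|j]] lj] //.
    by rewrite -[RHS]x0; congr (x _ _); apply: val_inj.
  by rewrite -[RHS]x1; congr (x _ _); apply: val_inj.
have [|g ug Ug] := @complete_unitmx _ _ _ U f.
  apply/eqP; rewrite eqn_leq mxrankM_maxl (eqP (freeUf : \rank _ == 2)).
  exact: rank_leq_row.
exists g^T; split; first by rewrite unitmx_tr.
- move=> i; rewrite (mxvec_of_evec g^T i0) mxE -(@UE g ord0 i0) // -Ug (@UE f _ i0) //.
  by rewrite mxE eqxx.
- move=> i; rewrite (mxvec_of_evec g^T i1) mxE -(@UE g ord_max i1) // -Ug (@UE f _ i1) //.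
  by rewrite mxE eqxx.
Qed.

Lemma flag_varietyP (p : proj W) : flag_variety21 p <->
  exists v w, phi v w != 0 /\ val p = <[phiW v w]>%VS.
Proof.
split=> [[g [u [ug /highest_weightP[c c0 ->] pE]]]|[v [w [vw pE]]]].
  have glE : gl_schur21 g (c *: phiW e0 e1) = c *: phiW (mxvec_of g e0) (mxvec_of g e1).
    apply: subvs_inj; rewrite vsval_gl_schur21 !linearZ /= gl_tensor3Z.
    by rewrite !vsval_phiW gl_phi.
  exists (mxvec_of g e0), (mxvec_of g e1); split.
    have := valP p; rewrite pE glE dim_vline scaler_eq0 negb_or eqb1 => /andP[_].
    by rewrite phiW_eq0.
  by rewrite pE glE vlineZ.
have [g [ug gv gw]] := extend_pair vw.
exists g, (phiW e0 e1); split=> //.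
  by apply/highest_weightP; exists 1; rewrite ?oner_eq0 ?scale1r.
rewrite pE; congr <[_]>%VS; apply: subvs_inj; rewrite vsval_gl_schur21 !vsval_phiW gl_phi.
by apply: eq_phi => i.
Qed.

End Flag.

(** * Upper bounds for chains in secant varieties *)

Section Secant.
Variables (K : numFieldType) (n : nat).
Hypothesis n2 : (1 < n)%N.
Local Notation W := (subvs_of (schur21 K n)).
Local Notation phiW := (@phiW K n).
Implicit Type (c : config K).

Definition secant_point (s : nat) c : W := \sum_(p < s) phiW (c 0%N p false) (c 0%N p true).

Definition secant_points (s : nat) (p : proj W) : Prop :=
  exists c, secant_point s c != 0 /\ val p = <[secant_point s c]>%VS.

Lemma phiWZ a v w : a *: phiW v w = phiW v (fun x => a * w x).
Proof.
apply: subvs_inj; rewrite linearZ /= !vsval_phiW; apply/ffunP => t.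
by rewrite !ffunE /GRing.scale /=; ring.
Qed.

(** Coefficients of a combination are absorbed in w, in which [phi] is linear. Conversely a zero
    summand is assigned an arbitrary point of the flag variety. *)
Lemma secant_pointsP s p :
  (exists x : 'I_s -> proj W, (forall i, flag_variety21 (x i)) /\
     (val p <= \sum_(i < s) val (x i))%VS) <-> secant_points s p.
Proof.
split=> [[x [xF px]]|[c [c0 pE]]].
  have [u u0 pu] := projP p.
  have : u \in (\sum_(i < s) val (x i))%VS by apply: (subvP px); rewrite pu memv_line.
  move=> /memv_sumP[y hy uE].
  have /fin_all_exists[vw hvw] : forall i, exists vw : (nat -> K) * (nat -> K),
      y i = phiW vw.1 vw.2.
    move=> i; have [v [w [_ xi]]] := (flag_varietyP n2 _).1 (xF i).
    have := hy i isT; rewrite xi => /vlineP[a ->].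
    by exists (v, fun x => a * w x); rewrite phiWZ.
  pose c : config K := fun _ q b => if insub q is Some i then
    (if b then (vw i).2 else (vw i).1) else fun=> 0.
  have cE : secant_point s c = u.
    by rewrite uE; apply: eq_bigr => i _; rewrite hvw /c valK.
  by exists c; rewrite cE.
have [g0 [gF _]] : exists q : proj W, flag_variety21 q /\ True.
  have e0 : phiW (@evec K 0) (@evec K 1) != 0 by rewrite phiW_eq0 phi_e01.
  exists (line e0); split=> //; apply/(flag_varietyP n2).
  by exists (@evec K 0), (@evec K 1); rewrite -phiW_eq0.
have /fin_all_exists[x hx] : forall i : 'I_s, exists q : proj W, flag_variety21 q /\
    phiW (c 0%N i false) (c 0%N i true) \in val q.
  move=> i; have [z|nz] := eqVneq (phiW (c 0%N i false) (c 0%N i true)) 0.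
    by exists g0; rewrite z mem0v.
  exists (line nz); rewrite memv_line; split=> //; apply/(flag_varietyP n2).
  by exists (c 0%N i false), (c 0%N i true); rewrite -phiW_eq0.
exists x; split=> [i|]; first by case: (hx i).
rewrite pE -memvE /secant_point; apply: memv_sumr => i _.
by case: (hx i).
Qed.

Lemma secant_varietyP s p :
  secant_variety s (@flag_variety21 K n) p <-> zariski_closure (secant_points s) p.
Proof.
split=> /closure_vanish h; apply/closure_vanish => f hf hX; apply: h => // q.
  by move=> /secant_pointsP; apply: hX.
by move=> hq; apply: hX; apply/secant_pointsP.
Qed.

Lemma flag_variety_points p : flag_variety21 p <-> secant_points 1 p.
Proof.
rewrite (flag_varietyP n2); split=> [[v [w [vw pE]]]|[c [c0 pE]]].
  by exists (fun _ _ b => if b then w else v); rewrite /secant_point big_ord1 phiW_eq0.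
by move: c0 pE; rewrite /secant_point big_ord1 phiW_eq0 => c0 pE; exists (c 0%N 0%N false), (c 0%N 0%N true).
Qed.

End Secant.

Section ChartBound.
Variables (K : numFieldType) (W : vectType K) (X : proj W -> Prop).
Variables (k : nat) (H T : finType) (G : T -> 'I_k.+1 -> (H -> K) -> W).
Hypothesis G_poly : forall t b i, polyfun (fun h => coord (vbasis {:W}) i (G t b h)).
Hypothesis dense : forall f, homogeneous f ->
  (forall t y h, poly_eval f (\sum_b y b *: G t b h) = 0) -> forall p, X p -> vanish f p.

(* Normalizing one nonzero coefficient to 1 saves a parameter. *)
Lemma chart_bound e Y : irreducible_chain X e Y -> (e <= k + #|H|)%N.
Proof.
pose I := ('I_k + H)%type.
pose coef (b0 : 'I_k.+1) (a : I -> K) (b : 'I_k.+1) : K :=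
  if unlift b0 b is Some b' then a (inl b') else 1.
pose Psi (tb : T * 'I_k.+1) (a : I -> K) : W :=
  \sum_b coef tb.2 a b *: G tb.1 b (fun x => a (inr x)).
have -> : (k + #|H|)%N = #|{: I}| by rewrite card_sum card_ord.
apply: (chain_bound (Psi := Psi)) => [[t b0] i|f hf h0].
  have [P hP] : polyfun (fun a : I -> K => \sum_b coef b0 a b *
      coord (vbasis {:W}) i (G t b (fun x => a (inr x)))).
    apply: polyfun_sum => b; apply: polyfunM.
      by rewrite /coef; case: unlift => [b'|]; [apply: polyfun_var|apply: polyfun_cst].
    apply: (polyfun_comp (G_poly t b i)) => x; exact: polyfun_var.
  exists P => a; rewrite -hP linear_sum; apply: eq_bigr => b _.
  by rewrite linearZ.
apply: dense => // t y h.
have [d fd] := hf.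
have scale_eval b0 a l : poly_eval f (l *: Psi (t, b0) a) = 0.
  by rewrite (poly_eval_homog _ _ fd) h0 mulr0.
have [y0|] := boolP [forall b, y b == 0].
  rewrite big1 => [|b _]; last by rewrite (eqP (forallP y0 b)) scale0r.
  by rewrite -(scale0r (Psi (t, ord0) (fun=> 0))) scale_eval.
rewrite negb_forall => /existsP[b0 yb0].
pose a (i : I) : K := match i with inl b' => y (lift b0 b') / y b0 | inr x => h x end.
rewrite -[RHS](scale_eval b0 a (y b0)); congr (poly_eval f _).
rewrite scaler_sumr; apply: eq_bigr => b _; rewrite scalerA; congr (_ *: _).
rewrite /coef /=; case: unliftP => [b'|] ->; last by rewrite mulr1.
by rewrite mulrC divfK.
Qed.

End ChartBound.

(** The chart is the family of all combinations of a basis, with no further parameters. *)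
Lemma ambient_bound (K : numFieldType) (W : vectType K) (X : proj W -> Prop) e Y :
  irreducible_chain X e Y -> (e <= \dim {:W} - 1)%N.
Proof.
move=> chY; have [[q Yq] _] := (chY.1 0%N isT).2.
have [w w0 _] := projP q.
have dW : (0 < \dim {:W})%N.
  rewrite lt0n dimv_eq0; apply: contraNneq w0 => W0.
  by rewrite -memv0 -W0 memvf.
case dE : (\dim {:W}) dW => [//|k] _; rewrite subn1 /=.
pose G (t : unit) (b : 'I_k.+1) (h : void -> K) : W := (vbasis {:W})`_b.
have := @chart_bound _ _ X k void unit G _ _ e Y chY; rewrite card_void addn0; apply.
  by move=> t b i; exact: (@polyfun_cst K void (coord (vbasis {:W}) i (vbasis {:W})`_b)).
move=> f hf h0 p _ u _.
rewrite -[RHS](h0 tt (fun b => coord (vbasis {:W}) (cast_ord (esym dE) b) u) (fun v => match v with end)).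
congr (poly_eval f _); rewrite {1}(coord_vbasis (memvf u)).
by rewrite (reindex (cast_ord (esym dE))) //=; exists (cast_ord dE) => i _; rewrite ?cast_ordK ?cast_ordKV.
Qed.

Section UpperBounds.
Variables (K : numFieldType) (n : nat).
Hypothesis n2 : (1 < n)%N.
Local Notation W := (subvs_of (schur21 K n)).
Local Notation phiW := (@phiW K n).
Local Notation tri := (@tri K n).
Variables (X : proj W -> Prop) (s : nat).
Hypothesis dense : forall f, homogeneous f ->
  (forall q, @secant_points K n s q -> vanish f q) -> forall p, X p -> vanish f p.

Lemma eq_polyfun (I : finType) (g h : (I -> K) -> K) :
  (forall a, g a = h a) -> polyfun g -> polyfun h.
Proof. by move=> e [P hP]; exists P => a; rewrite -e. Qed.

Lemma polyfun_tri (I : finType) (a b c : (I -> K) -> nat -> K) q :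
  (forall i : 'I_n, polyfun (fun h => a h i)) ->
  (forall i : 'I_n, polyfun (fun h => b h i)) ->
  (forall i : 'I_n, polyfun (fun h => c h i)) ->
  polyfun (fun h => tri (a h) (b h) (c h) q).
Proof.
move=> ha hb hc; apply: (eq_polyfun (fun h => esym (ffunE _ _))).
by apply: polyfunM => //; apply: polyfunB; apply: polyfunM.
Qed.

Lemma secant_dense f : homogeneous f ->
  (forall c, poly_eval f (@secant_point K n s c) = 0) -> forall p, X p -> vanish f p.
Proof.
move=> hf h0; apply: dense => // q [c [_ qE]]; have [d fd] := hf.
exact/(vanish_line fd qE).
Qed.

(** A flag is normalized by v_x = 1, w_x = 0, and w = 1 at the index [lift x y]; this leaves (n - 1)
    + (n - 2) parameters. *)
Definition chart_v (x : 'I_n) (a : 'I_n.-1 -> K) (z : nat) : K :=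
  if insub z is Some i then oapp a 1 (unlift x i) else 0.

Definition chart_w (x : 'I_n) (y : 'I_n.-1) (b : 'I_n.-1.-1 -> K) (z : nat) : K :=
  if insub z is Some i then
    oapp (fun i' => oapp b 1 (unlift y i')) 0 (unlift x i) else 0.

Lemma phi_chart v w : exists x y q a b, phiW v w = q *: phiW (chart_v x a) (chart_w x y b).
Proof.
have n1 : (0 < n.-1)%N by lia.
have zero : phiW v w = 0 -> exists x y q a b, phiW v w = q *: phiW (chart_v x a) (chart_w x y b).
  by exists (Ordinal (ltnW n2)), (Ordinal n1), 0, (fun=> 0), (fun=> 0); rewrite scale0r.
have phi0 : phi n v w = 0 -> phiW v w = 0 by move=> e; apply/eqP; rewrite phiW_eq0 e.
have [/forallP v0|] := boolP [forall i : 'I_n, v i == 0].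
  apply/zero/phi0/ffunP => t; rewrite !ffunE !(eqP (v0 _)); ring.
rewrite negb_forall => /existsP[x vx].
pose w' z := w z - w x / v x * v z.
have w'x : w' x = 0 by rewrite /w' divfK // subrr.
have [/forallP w0|] := boolP [forall i : 'I_n, w' i == 0].
  apply/zero/phi0/ffunP => t; rewrite !ffunE.
  have we (i : 'I_n) : w i = w x / v x * v i by apply/eqP; rewrite -subr_eq0; apply: w0.
  by rewrite (we t.2) (we t.1.1); ring.
rewrite negb_forall => /existsP[y0 wy].
have [y ey|e] := unliftP x y0; last by rewrite e w'x eqxx in wy.
exists x, y, (v x ^+ 2 * w' y0), (fun i => v (lift x i) / v x),
  (fun i => w' (lift x (lift y i)) / w' y0).
apply: subvs_inj; rewrite linearZ /= !vsval_phiW -phiZ.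
transitivity (phi n v w').
  by apply/ffunP => t; rewrite !ffunE /w'; ring.
apply: eq_phi => i; rewrite /chart_v /chart_w valK.
  by case: unliftP => [j|] -> /=; [rewrite mulrC divfK|rewrite mulr1].
case: unliftP => [j|] -> /=; last by rewrite mulr0.
case: unliftP => [j'|] -> /=; first by rewrite mulrC divfK.
by rewrite mulr1 ey.
Qed.

(** Each of the s points has 2 n - 3 parameters, and the s coefficients of the sum count for s -
    1. *)
Lemma points_bound e Y : (0 < s)%N -> irreducible_chain X e Y ->
  (e <= s * (2 * n - 2) - 1)%N.
Proof.
move=> s0 chY; case sE : s s0 => [//|k] _.
pose H := ('I_k.+1 * ('I_n.-1 + 'I_n.-1.-1))%type.
pose T := {ffun 'I_k.+1 -> 'I_n * 'I_n.-1}.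
pose G (t : T) (b : 'I_k.+1) (h : H -> K) : W :=
  phiW (chart_v (t b).1 (fun i => h (b, inl i))) (chart_w (t b).1 (t b).2 (fun i => h (b, inr i))).
have := @chart_bound _ _ X k H T G _ _ e Y chY.
rewrite card_prod card_sum !card_ord => bound.
apply: leq_trans (bound _ _) _; last by nia.
  move=> t b i; apply: polyfun_vsproj => q; apply: polyfun_tri => j; rewrite /chart_v /chart_w valK.
  - by case: unlift => [j'|] /=; [apply: polyfun_var|apply: polyfun_cst].
  - by case: unlift => [j'|] /=; [apply: polyfun_var|apply: polyfun_cst].
  - case: unlift => [j'|] /=; last exact: polyfun_cst.
    by case: unlift => [j''|] /=; [apply: polyfun_var|apply: polyfun_cst].
move=> f hf h0; apply: secant_dense => // c.
have /fin_all_exists[z hz] : forall p : 'I_k.+1, exists z : ('I_n * 'I_n.-1) * K *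
    (('I_n.-1 -> K) * ('I_n.-1.-1 -> K)),
    phiW (c 0%N p false) (c 0%N p true) =
    z.1.2 *: phiW (chart_v z.1.1.1 z.2.1) (chart_w z.1.1.1 z.1.1.2 z.2.2).
  move=> p; have [x [y [q [a [b E]]]]] := phi_chart (c 0%N p false) (c 0%N p true).
  by exists (x, y, q, (a, b)).
rewrite -[RHS](h0 [ffun p => (z p).1.1] (fun p => (z p).1.2)
  (fun pi => match pi with (p, inl i) => (z p).2.1 i | (p, inr i) => (z p).2.2 i end)).
rewrite /secant_point sE; congr (poly_eval f _); apply: eq_bigr => p _.
by rewrite hz /G !ffunE.
Qed.

(* n - 1 vectors lie in a hyperplane H; in the basis f_x of H completed by e_y, *)
(* a sum of n - 1 points then lies in Sym^2(H) (x) e_y + S_(2,1)(H).            *)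
Definition hyp_basis (y : 'I_n) (h : 'I_n.-1 -> K) (x : 'I_n.-1) (z : nat) : K :=
  evec K (lift y x) z - h x * evec K y z.

Lemma evecE (x y : 'I_n) : evec K x y = (y == x)%:R.
Proof. by rewrite /evec -val_eqE. Qed.

(** The row u is an equation satisfied by all n - 1 vectors; it is solved for a coordinate y with
    u_y nonzero, and h records the remaining ratios. *)
Lemma hyperplane (v : 'I_n.-1 -> nat -> K) : exists y h, forall p (i : 'I_n),
  v p i = \sum_x v p (lift y x) * hyp_basis y h x i.
Proof.
pose A : 'M[K]_(n.-1, n) := \matrix_(p, i) v p i.
have /rowV0Pn[u /sub_kermxP uA u0] : kermx A^T != 0.
  rewrite -mxrank_eq0 mxrank_ker mxrank_tr -lt0n subn_gt0.
  by apply: leq_ltn_trans (rank_leq_row A) _; lia.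
have [y uy] : exists y, u 0 y != 0 by apply/rV0Pn.
have rel p : \sum_i u 0 i * v p i = 0.
  have := congr1 (fun B : 'M_(_, _) => B 0 p) uA; rewrite !mxE => e.
  by rewrite -[RHS]e; apply: eq_bigr => i _; rewrite !mxE.
exists y, (fun x => u 0 (lift y x) / u 0 y) => p i.
rewrite /hyp_basis; case: (unliftP y i) => [j|] ->.
  rewrite (bigD1 j) // big1 => [|x]; last first.
    rewrite andTb => xj.
    rewrite !evecE (inj_eq lift_inj) eq_sym (negPf xj) [lift y j == y]eq_sym.
    by rewrite (negPf (neq_lift y j)) mulr0 subr0 mulr0.
  rewrite !evecE eqxx [lift y j == y]eq_sym (negPf (neq_lift y j)).
  by rewrite /= mulr0 subr0 mulr1 addr0.
have e : u 0 y * v p y + \sum_x u 0 (lift y x) * v p (lift y x) = 0.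
  by rewrite -[RHS](rel p) [RHS](bigD1_ord y).
apply: (mulfI uy); move/eqP: e; rewrite addr_eq0 => /eqP ->.
rewrite mulr_sumr -sumrN; apply: eq_bigr => x _.
rewrite !evecE eqxx (negPf (neq_lift y x)) sub0r mulr1.
by rewrite mulrN mulrN mulrCA [u 0 y * _]mulrC divfK // mulrC.
Qed.

End UpperBounds.

(** * Upper bounds in the two exceptional cases *)

Section HyperplaneBound.
Variables (K : numFieldType) (n : nat).
Hypothesis n2 : (1 < n)%N.
Local Notation tensor3 := {ffun 'I_n * 'I_n * 'I_n -> K^o}.
Local Notation W := (subvs_of (schur21 K n)).
Variables (X : proj W -> Prop).
Hypothesis dense : forall f, homogeneous f ->
  (forall q, @secant_points K n n.-1 q -> vanish f q) -> forall p, X p -> vanish f p.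

Variables (k : nat) (gen : ('I_n.-1 -> nat -> K) -> (nat -> K) -> 'I_k.+1 -> tensor3).
Hypothesis gen_schur : forall f e b, gen f e b \in schur21 K n.
Hypothesis gen_poly : forall (I : finType) (f : (I -> K) -> 'I_n.-1 -> nat -> K) e b q,
  (forall x (i : 'I_n), polyfun (fun h => f h x i)) -> polyfun (fun h => gen (f h) e b q).
Hypothesis gen_span : forall (f : 'I_n.-1 -> nat -> K) (e : nat -> K) (a b : 'I_n.-1 -> K) (l : K)
    (v w : nat -> K),
  (forall i : 'I_n, v i = \sum_x a x * f x i) ->
  (forall i : 'I_n, w i = \sum_x b x * f x i + l * e i) ->
  exists y : 'I_k.+1 -> K, phi n v w = \sum_b y b *: gen f e b.

(** A sum of n - 1 points is a combination of k + 1 tensors depending only on a hyperplane, which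
    has n - 1 parameters. *)
Lemma hyperplane_bound e Y : irreducible_chain X e Y -> (e <= k + n.-1)%N.
Proof.
move=> chY.
pose G (y : 'I_n) (b : 'I_k.+1) (h : 'I_n.-1 -> K) : W :=
  vsproj _ (gen (hyp_basis y h) (evec K y) b).
have := @chart_bound _ _ X k 'I_n.-1 'I_n G _ _ e Y chY; rewrite card_ord; apply.
  move=> y b i; apply: polyfun_vsproj => q; apply: gen_poly => x j.
  apply: polyfunB; first exact: polyfun_cst.
  by apply: polyfunM; [apply: polyfun_var|apply: polyfun_cst].
move=> f hf h0; apply: (secant_dense dense) => // c.
have [y [h hv]] := hyperplane n2 (fun p => c 0%N p false).
have hw p (i : 'I_n) : c 0%N p true i = \sum_x c 0%N p true (lift y x) * hyp_basis y h x i +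
    (c 0%N p true y + \sum_x h x * c 0%N p true (lift y x)) * evec K y i.
  rewrite /hyp_basis.
  have -> : \sum_x c 0%N p true (lift y x) * (evec K (lift y x) i - h x * evec K y i) =
    \sum_x c 0%N p true (lift y x) * evec K (lift y x) i -
    (\sum_x h x * c 0%N p true (lift y x)) * evec K y i.
    by rewrite mulr_suml -sumrB; apply: eq_bigr => x _; ring.
  rewrite mulrDl addrACA addNr addr0.
  have [j ->|->] := unliftP y i; last first.
    rewrite big1 => [|x _]; first by rewrite evecE eqxx mulr1 add0r.
    by rewrite evecE (negPf (neq_lift y x)) mulr0.
  rewrite (bigD1 j) // big1 => [|x]; last first.
    by rewrite andTb evecE (inj_eq lift_inj) eq_sym => /negPf->; rewrite mulr0.
  by rewrite !evecE eqxx [lift y j == y]eq_sym (negPf (neq_lift y j)) /= mulr0 mulr1 !addr0.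
have /fin_all_exists[z hz] : forall p : 'I_n.-1, exists z : 'I_k.+1 -> K,
    phi n (c 0%N p false) (c 0%N p true) = \sum_b z b *: gen (hyp_basis y h) (evec K y) b.
  by move=> p; exact: gen_span (hv p) (hw p).
rewrite -[RHS](h0 y (fun b => \sum_p z p b) h); congr (poly_eval f _).
rewrite /secant_point; under [RHS]eq_bigr do rewrite scaler_suml.
rewrite exchange_big; apply: eq_bigr => p _; apply: subvs_inj.
rewrite vsval_phiW hz linear_sum; apply: eq_bigr => b _.
by rewrite linearZ /= vsprojK.
Qed.

End HyperplaneBound.

Section Exceptional.
Variable K : numFieldType.

(** The mixed term of [phi] at v = a + b and w = c. *)
Definition sym3 n (a b c : nat -> K) := tri n a b c + tri n b a c.

Lemma polyfun_sym3 n (I : finType) (a b c : (I -> K) -> nat -> K) q :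
  (forall i : 'I_n, polyfun (fun h => a h i)) ->
  (forall i : 'I_n, polyfun (fun h => b h i)) ->
  (forall i : 'I_n, polyfun (fun h => c h i)) ->
  polyfun (fun h => sym3 n (a h) (b h) (c h) q).
Proof.
move=> ha hb hc; apply: (eq_polyfun (fun h => esym (ffunE _ _))).
by apply: polyfunD; apply: polyfun_tri.
Qed.

Definition gen3 (f : 'I_2 -> nat -> K) (e : nat -> K) (b : 'I_5) :=
  let f0 := f ord0 in let f1 := f ord_max in
  nth 0 [:: phi 3 f0 e; sym3 3 f0 f1 e; phi 3 f1 e; phi 3 f0 f1; phi 3 f1 f0] b.

(** For a plane H in K^3, Sym^2(H) (x) e has dimension 3 and S_(2,1)(H) has dimension 2; the bound
    is 4 + 2. The coefficients come from expanding [phi v w] in the basis of H completed by e. *)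
Lemma exceptional_bound3 (X : proj (subvs_of (schur21 K 3)) -> Prop) :
  (forall f, homogeneous f -> (forall q, @secant_points K 3 2 q -> vanish f q) ->
     forall p, X p -> vanish f p) ->
  forall e Y, irreducible_chain X e Y -> (e <= 6)%N.
Proof.
move=> dense e Y; apply: (@hyperplane_bound K 3 isT X dense 4 gen3).
- move=> f e0 [[|[|[|[|[|b]]]]] lb] //; rewrite /gen3 /=;
    by [apply: phi_schur|apply: tri_sym_schur].
- move=> I f e0 [[|[|[|[|[|b]]]]] lb] q hf //; rewrite /gen3 /=;
    by [apply: polyfun_tri => i; by [apply: hf|apply: polyfun_cst]|
        apply: polyfun_sym3 => i; by [apply: hf|apply: polyfun_cst]].
move=> f e0 a b l v w hv hw.
pose a0 := a ord0; pose a1 := a ord_max; pose b0 := b ord0; pose b1 := b ord_max.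
exists (fun i => nth 0 [:: l * a0 ^+ 2; l * a0 * a1; l * a1 ^+ 2;
   a0 ^+ 2 * b1 - a0 * a1 * b0; a1 ^+ 2 * b0 - a0 * a1 * b1] i).
rewrite !big_ord_recl big_ord0 /gen3 /=.
have e1 : lift ord0 ord0 = ord_max :> 'I_2 by apply: val_inj.
apply/ffunP => t; rewrite !ffunE /GRing.scale /= !hv !hw !big_ord_recl !big_ord0 e1.
by rewrite -/a0 -/a1 -/b0 -/b1; ring.
Qed.

Definition gen4 (f : 'I_3 -> nat -> K) (e : nat -> K) (b : 'I_14) :=
  let f0 := f (inord 0) in let f1 := f (inord 1) in let f2 := f (inord 2) in
  nth 0 [:: phi 4 f0 e; phi 4 f1 e; phi 4 f2 e; sym3 4 f0 f1 e; sym3 4 f0 f2 e; sym3 4 f1 f2 e;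
    phi 4 f0 f1; phi 4 f1 f0; phi 4 f0 f2; phi 4 f2 f0; phi 4 f1 f2; phi 4 f2 f1;
    sym3 4 f0 f1 f2; sym3 4 f0 f2 f1] b.

(** Here Sym^2(H) (x) e has dimension 6 and S_(2,1)(H) has dimension 8; the bound is 13 + 3. *)
Lemma exceptional_bound4 (X : proj (subvs_of (schur21 K 4)) -> Prop) :
  (forall f, homogeneous f -> (forall q, @secant_points K 4 3 q -> vanish f q) ->
     forall p, X p -> vanish f p) ->
  forall e Y, irreducible_chain X e Y -> (e <= 16)%N.
Proof.
move=> dense e Y; apply: (@hyperplane_bound K 4 isT X dense 13 gen4).
- move=> f e0 [b lb]; rewrite /gen4 /=; do 14?[case: b lb => [|b] lb //=];
    by [apply: phi_schur|apply: tri_sym_schur].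
- move=> I f e0 [b lb] q hf; rewrite /gen4 /=; do 14?[case: b lb => [|b] lb //=];
    by [apply: polyfun_tri => i; by [apply: hf|apply: polyfun_cst]|
        apply: polyfun_sym3 => i; by [apply: hf|apply: polyfun_cst]].
move=> f e0 a b l v w hv hw.
pose a0 := a (inord 0); pose a1 := a (inord 1); pose a2 := a (inord 2).
pose b0 := b (inord 0); pose b1 := b (inord 1); pose b2 := b (inord 2).
exists (fun i => nth 0 [:: l * a0 ^+ 2; l * a1 ^+ 2; l * a2 ^+ 2;
   l * a0 * a1; l * a0 * a2; l * a1 * a2;
   a0 ^+ 2 * b1 - a0 * a1 * b0; a1 ^+ 2 * b0 - a0 * a1 * b1;
   a0 ^+ 2 * b2 - a0 * a2 * b0; a2 ^+ 2 * b0 - a0 * a2 * b2;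
   a1 ^+ 2 * b2 - a1 * a2 * b1; a2 ^+ 2 * b1 - a1 * a2 * b2;
   a0 * a1 * b2 - a1 * a2 * b0; a0 * a2 * b1 - a1 * a2 * b0] i).
rewrite !big_ord_recl big_ord0 /gen4 /=.
have sumE (F : 'I_3 -> K) : \sum_x F x = F (inord 0) + F (inord 1) + F (inord 2).
  rewrite !big_ord_recl big_ord0 addr0 -addrA.
  by congr (F _ + (F _ + F _)); apply: val_inj; rewrite /= inordK.
apply/ffunP => t; rewrite !ffunE /GRing.scale /= !hv !hw !sumE.
by rewrite -/a0 -/a1 -/a2 -/b0 -/b1 -/b2; ring.
Qed.

End Exceptional.

(** * Lower bounds from tangent spaces *)

Section Total.
Variables (K : numFieldType) (n : nat).
Local Notation T := ('I_n * 'I_n * 'I_n)%type.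
Implicit Type (c : config K).

Definition tangent c (p : nat) (b : bool) (x : nat) (q : T) : K :=
  dphi (c 0%N p false) (c 0%N p true) b x q.1.1 q.1.2 q.2.

(** Unlike in [determined0], the extra conditions E are arbitrary functionals, so that tangent
    vectors of discarded points can be moved into E. *)
Definition total_at (s : nat) (E : seq (T -> K)) c : Prop := forall g : T -> K,
  (forall q : T, ~~ bidx q.1.1 q.1.2 q.2 -> g q = 0) ->
  (forall p b (x : 'I_n), (p < s)%N -> \sum_q g q * tangent c p b x q = 0) ->
  (forall i, (i < size E)%N -> \sum_q g q * nth (fun=> 0) E i q = 0) ->
  forall q, g q = 0.

Lemma total_at_determined s E c : bounded n E -> determined0 n s E c ->
  exists2 E', size E' = size E & total_at s E' c.
Proof.
move=> bE hc.
exists [seq (fun q : T => ((val q.1.1, val q.1.2, val q.2) == e)%:R) | e <- E].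
  by rewrite size_map.
move=> g gB gt gE.
pose f i j k : K := if insub i is Some i' then if insub j is Some j' then
  if insub k is Some k' then g (i', j', k') else 0 else 0 else 0.
have fE (t : T) : f t.1.1 t.1.2 t.2 = g t by case: t => [[i j] k]; rewrite /f !valK.
move=> q; rewrite -fE; apply: hc => //.
  move=> [|l] p //= ps b x xn; rewrite pairingE -[RHS](gt p b (Ordinal xn) ps).
  by apply: eq_bigr => t _; rewrite fE.
move=> i j k hi hj hk; rewrite (fE (Ordinal hi, Ordinal hj, Ordinal hk) : f i j k = _).
case/orP=> [nb|iE]; first exact: gB.
have lt : (index (i, j, k) E < size E)%N by rewrite index_mem.
have := gE (index (i, j, k) E); rewrite size_map => /(_ lt).
rewrite (bigD1 (Ordinal hi, Ordinal hj, Ordinal hk)) //= (nth_map (0, 0, 0)%N) //.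
rewrite nth_index // eqxx mulr1 big1 ?addr0 // => q' ne.
case: eqP => [e|]; last by rewrite mulr0.
case/eqP: ne; case: q' e => [[i' j'] k'] /= [ei ej ek].
by congr (_, _, _); apply: val_inj.
Qed.

(** The 2 n derivatives at a point satisfy two relations: differentiating w along v gives 0, and
    differentiating v along v gives twice the point, which is also the derivative of w along w
    doubled. So at an index y with v_y nonzero both derivatives are redundant. *)
Lemma total_at_drop s E c : total_at s.+1 E c ->
  exists2 E', size E' = (size E + (2 * n - 2))%N & total_at s E' c.
Proof.
move=> tot; set v := c 0%N s false; set w := c 0%N s true.
have [/forallP v0|] := boolP [forall i : 'I_n, v i == 0].
  (* For v = 0 every derivative vanishes, and zero functionals pad the list. *)
  exists (E ++ nseq (2 * n - 2) (fun=> 0)); first by rewrite size_cat size_nseq.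
  move=> g gB gt gE; apply: tot => // [p b x|i iE]; last first.
    rewrite -[RHS](gE i) ?size_cat ?ltn_addr //.
    by apply: eq_bigr => q _; rewrite nth_cat iE.
  rewrite ltnS leq_eqVlt => /orP[/eqP->|/gt//]; apply: big1 => q _.
  by rewrite /tangent -/v -/w /dphi !(eqP (v0 _)); case: b; ring.
rewrite negb_forall => /existsP[y vy].
pose L0 b : seq (T -> K) := [seq tangent c s b (lift y x) | x <- enum 'I_n.-1].
have sL0 b : size (L0 b) = n.-1 by rewrite size_map size_enum_ord.
pose L := L0 false ++ L0 true.
exists (E ++ L); first by rewrite !size_cat !sL0; lia.
move=> g gB gt gE; apply: tot => // [p b x|i iE]; last first.
  rewrite -[RHS](gE i) ?size_cat ?ltn_addr //.
    by apply: eq_bigr => q _; rewrite nth_cat iE.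
rewrite ltnS leq_eqVlt => /orP[/eqP-> {p}|/gt//].
pose D b x := \sum_q g q * tangent c s b x q.
have DL b' (x' : 'I_n.-1) : D b' (lift y x') = 0.
  have mem : exists2 i, (i < size L)%N & nth (fun=> 0) L i = tangent c s b' (lift y x').
    have e0 : nth (fun=> 0) (L0 b') x' = tangent c s b' (lift y x').
      by rewrite (nth_map x') ?size_enum_ord // nth_ord_enum.
    case: b' e0 => e0; last first.
      by exists x'; rewrite ?size_cat ?nth_cat !sL0 ?ltn_addr ?ltn_ord.
    exists (n.-1 + x')%N; first by rewrite size_cat !sL0 ltn_add2l.
    by rewrite nth_cat sL0 ltnNge leq_addr /= addKn.
  have [i iL e] := mem; rewrite -[RHS](gE (size E + i)%N); last by rewrite size_cat ltn_add2l.
  by apply: eq_bigr => q _; rewrite nth_cat ltnNge leq_addr /= addKn e.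
have delta (u : nat -> K) (k : 'I_n) : \sum_(x < n) u x * (k == x :> nat)%:R = u k.
  rewrite (bigD1 k) //= eqxx mulr1 big1 ?addr0 // => z zk.
  by rewrite val_eqE eq_sym (negPf zk) mulr0.
have delta' (u : nat -> K) (k : 'I_n) : \sum_(x < n) (k == x :> nat)%:R * u x = u k.
  by rewrite -[RHS]delta; apply: eq_bigr => z _; rewrite mulrC.
have sumD (u : nat -> K) b' : \sum_(x < n) u x * D b' x =
    \sum_q g q * \sum_(x < n) u x * tangent c s b' x q.
  under eq_bigr do rewrite mulr_sumr.
  rewrite exchange_big; apply: eq_bigr => q _; rewrite mulr_sumr.
  by apply: eq_bigr => z _; rewrite mulrCA.
have tT (u : nat -> K) (q : T) : \sum_(x < n) u x * tangent c s true x q =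
    v q.1.2 * (v q.1.1 * u q.2 - u q.1.1 * v q.2).
  transitivity (v q.1.2 * (v q.1.1 * (\sum_(x < n) u x * (q.2 == x :> nat)%:R) -
      (\sum_(x < n) u x * (q.1.1 == x :> nat)%:R) * v q.2)); last by rewrite !delta.
  rewrite mulr_suml mulr_sumr -sumrB mulr_sumr; apply: eq_bigr => z _.
  by rewrite /tangent /dphi -/v -/w; ring.
have tF (q : T) : \sum_(x < n) v x * tangent c s false x q =
    2%:R * (v q.1.2 * (v q.1.1 * w q.2 - w q.1.1 * v q.2)).
  transitivity ((\sum_(x < n) v x * (q.1.2 == x :> nat)%:R) * (v q.1.1 * w q.2 - w q.1.1 * v q.2)
    + v q.1.2 * ((\sum_(x < n) v x * (q.1.1 == x :> nat)%:R) * w q.2 -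
      w q.1.1 * (\sum_(x < n) v x * (q.2 == x :> nat)%:R))); last by rewrite !delta; ring.
  rewrite !mulr_suml !mulr_sumr -sumrB mulr_sumr -big_split; apply: eq_bigr => z _.
  by rewrite /tangent /dphi -/v -/w /=; ring.
have only_y (u : nat -> K) b' : \sum_(x < n) u x * D b' x = u y * D b' y.
  rewrite (bigD1 y) //= big1 ?addr0 // => z; have [x' ->|->] := unliftP y z.
    by rewrite DL mulr0.
  by rewrite eqxx.
have DTy : D true y = 0.
  apply: (mulfI vy); rewrite mulr0 -(only_y v) sumD; apply: big1 => q _.
  by rewrite tT; ring.
have DFy : D false y = 0.
  apply: (mulfI vy); rewrite mulr0 -(only_y v) sumD.
  transitivity (2%:R * (\sum_(x < n) w x * D true x)).
    rewrite sumD mulr_sumr; apply: eq_bigr => q _; rewrite tF tT; ring.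
  by rewrite only_y DTy !mulr0.
have [x' ->|->] := unliftP y x; first exact: DL.
by case: b.
Qed.

Lemma total_at_le s s' E c : (s <= s')%N -> total_at s E c -> total_at s' E c.
Proof.
move=> ss tot g gB gt gE; apply: tot => // p b x ps; apply: gt.
exact: leq_trans ps ss.
Qed.

Lemma total_at_sub s sf E c : total_at sf E c ->
  exists2 E', size E' = (size E + (sf - s) * (2 * n - 2))%N & total_at s E' c.
Proof.
move=> tot; have [ss|ss] := leqP sf s.
  by exists E; [rewrite (eqP ss) mul0n addn0|apply: total_at_le tot].
move/ltnW: ss tot => /subnK <-; rewrite addnK; elim: (sf - s)%N E => [|k IH] E tot.
  by exists E => //; rewrite mul0n addn0.
have [E1 sE1 tot1] := total_at_drop tot; have [E2 sE2 tot2] := IH E1 tot1.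
by exists E2 => //; rewrite sE2 sE1 (mulSn k) addnA.
Qed.

End Total.

Section TangentChain.
Variables (K : numFieldType) (n : nat).
Hypothesis n2 : (1 < n)%N.
Local Notation T := ('I_n * 'I_n * 'I_n)%type.
Local Notation W := (subvs_of (schur21 K n)).
Implicit Type (c : config K).

Definition schur_index : {set T} := [set q : T | bidx q.1.1 q.1.2 q.2].

Lemma generic_secant_neq0 s : (0 < s)%N -> exists2 P : config K -> Prop, generic P &
  forall c, P c -> @secant_point K n s c != 0.
Proof.
move=> s0; pose q : T := (Ordinal (ltnW n2), Ordinal (ltnW n2), Ordinal n2).
pose h c : K := \sum_(p < s) (c 0%N p false 0%N * (c 0%N p false 0%N * c 0%N p true 1%N -
   c 0%N p true 0%N * c 0%N p false 1%N)).
have hE c : vsval (@secant_point K n s c) q = h c.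
  rewrite linear_sum sum_ffunE; apply: eq_bigr => p _.
  by rewrite /= vsval_phiW ffunE.
have hl : line_poly h.
  move=> c d; have /fin_all_exists[r hr] : forall p : 'I_s, exists r : {poly K}, forall t,
      config_line c d t 0%N p false 0%N * (config_line c d t 0%N p false 0%N *
        config_line c d t 0%N p true 1%N - config_line c d t 0%N p true 0%N *
        config_line c d t 0%N p false 1%N) = r.[t].
    move=> p.
    have := @line_polyM K (fun c => c 0%N p false 0%N) (fun c => c 0%N p false 0%N * c 0%N p true 1%N -
      c 0%N p true 0%N * c 0%N p false 1%N); apply.
      exact: line_poly_var.
    by apply: line_polyB; apply: line_polyM; apply: line_poly_var.
  by exists (\sum_p r p) => t; rewrite horner_sum; apply: eq_bigr => p _.
exists (fun c => h c != 0); last first.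
  by move=> c; apply: contra => /eqP c0; rewrite -hE c0 linear0 ffunE.
apply: generic_neq0 => //.
exists (fun _ p b x => if p == 0%N then evec K b x else 0).
rewrite /h (bigD1 (Ordinal s0)) //= big1 => [|p p0].
  by rewrite addr0 /evec /= mulr0 subr0 !mulr1 oner_eq0.
rewrite (_ : (val p == 0%N) = false) ?mul0r //.
by apply: negbTE; move: p0; rewrite -val_eqE.
Qed.

Lemma generic_config s sf E : (0 < s)%N -> bounded n E ->
  (exists c : config K, determined0 n sf E c) ->
  exists c (E' : seq (T -> K)), [/\ size E' = (size E + (sf - s) * (2 * n - 2))%N, total_at s E' c &
    @secant_point K n s c != 0].
Proof.
move=> s0 bE ex.
have [P gP P0] := generic_secant_neq0 s0.
have [[c [hc /P0 c0]] _] := generic_and (generic_determined ex) gP.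
have [E1 sE1 tot1] := total_at_determined bE hc.
have [E2 sE2 tot2] := total_at_sub s tot1.
by exists c, E2; rewrite sE2 sE1.
Qed.

Definition tangentW c (p : nat) (b : bool) (x : nat) : W :=
  vsproj _ (dphi_tensor n (c 0%N p false) (c 0%N p true) b x).

Lemma vsval_tangentW c p b x q : vsval (tangentW c p b x) q = tangent c p b x q.
Proof. by rewrite vsprojK ?dphi_schur // ffunE. Qed.

(** Complete the secant point to #|T| independent rows. At most [size E] of them come from E and at
    most #|T| - #|schur_index n| from coordinates that are not semistandard, so at least d are
    tangent vectors. *)
Lemma free_tangents s (E : seq (T -> K)) c d : total_at s E c ->
  @secant_point K n s c != 0 -> (d + size E < #|schur_index|)%N ->
  exists l : 'I_d -> 'I_s * bool * 'I_n,
    free (@secant_point K n s c :: [tuple tangentW c (l i).1.1 (l i).1.2 (l i).2 | i < d]).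
Proof.
move=> tot c0 dE.
pose J := ('I_s * bool * 'I_n)%type.
pose I' := (unit + ('I_(size E) + {q : T | ~~ bidx q.1.1 q.1.2 q.2}))%type.
pose I := (J + I')%type.
pose A (i : I) (q : T) : K := match i with
  | inl z => tangent c z.1.1 z.1.2 z.2 q
  | inr (inl _) => vsval (@secant_point K n s c) q
  | inr (inr (inl e)) => nth (fun=> 0) E e q
  | inr (inr (inr q')) => (q == val q')%:R end.
have A_tot g : (forall i, \sum_q g q * A i q = 0) -> forall q, g q = 0.
  move=> hg; apply: tot.
  - move=> q nq; have := hg (inr (inr (inr (exist _ q nq)))).
    rewrite /= (bigD1 q) //= eqxx mulr1 big1 ?addr0 // => q' /negPf->.
    by rewrite mulr0.
  - by move=> p b x ps; have := hg (inl (Ordinal ps, b, x)).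
  - by move=> i iE; have := hg (inr (inr (inl (Ordinal iE)))).
pose s1 (i : 'I_1) : I := inr (inl tt).
have fs1 : row_free (row_sys A s1).
  apply: inj_row_free => x xM; have [q qn] : exists q, vsval (@secant_point K n s c) q != 0.
    apply: boolp.contrapT => nex; case/eqP: c0; apply: subvs_inj; apply/ffunP => q.
    rewrite linear0 ffunE; apply/eqP; apply: boolp.contrapT => /negP ne; apply: nex.
    by exists q.
  have := congr1 (fun B : 'M_(_, _) => B 0 (enum_rank q)) xM.
  rewrite !mxE big_ord1 mxE /= enum_rankK => /eqP; rewrite mulf_eq0 (negPf qn) orbF => /eqP x0.
  by apply/rowP => j; rewrite (ord1 j) x0 mxE.
have [s' [fs' hs']] := select_rows A_tot fs1.
have [r0 r0E] := hs' ord0.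
have s'_inj : injective s'.
  move=> i j ij; apply/eqP; apply: contraT => ne.
  have : delta_mx 0 i - delta_mx 0 j = 0 :> 'rV[K]_#|{: T}|.
    apply: (row_free_inj fs'); rewrite mul0mx mulmxBl -!rowE; apply/rowP => k.
    by rewrite !mxE ij subrr.
  move/rowP/(_ i); rewrite !mxE !eqxx /= (negPf ne) subr0 => /eqP.
  by rewrite oner_eq0.
pose JJ : {set J} := [set z | inl z \in codom s'].
have cardJ : (d <= #|JJ|)%N.
  have le : (#|{: T}| <= #|JJ| + #|{: I'}|)%N.
    rewrite -{1}[#|{: T}|]card_ord -(card_codom s'_inj).
    have sub : {subset codom s' <= [set inl z | z in JJ] :|: [set inr z | z in [set: I']]}.
      move=> [z|z] hz; rewrite inE; apply/orP; [left|right]; apply: imset_f => //.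
      by rewrite inE.
    apply: leq_trans (subset_leq_card (introT subsetP sub)) _.
    apply: leq_trans (leq_card_setU _ _) _.
    rewrite card_imset; last by move=> a b [].
    by rewrite card_imset ?cardsT // => a b [].
  have cB : (#|schur_index| + #|{: {q : T | ~~ bidx q.1.1 q.1.2 q.2}}| = #|{: T}|)%N.
    rewrite card_sig -(cardsC schur_index); congr (_ + _)%N.
    by apply: eq_card => q; rewrite !inE.
  have cI : #|{: I'}| = (1 + (size E + #|{: {q : T | ~~ bidx q.1.1 q.1.2 q.2}}|))%N.
    by rewrite !card_sum card_unit card_ord.
  rewrite cI in le; move: le dE; rewrite -cB.
  move: #|JJ| #|{: {q : T | ~~ bidx q.1.1 q.1.2 q.2}}| #|schur_index| (size E) => a b c1 e; lia.
pose l (i : 'I_d) : J := enum_val (widen_ord cardJ i).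
have l_inj : injective l.
  by move=> i j /enum_val_inj /(congr1 val) /= /val_inj.
have lJ i : inl (l i) \in codom s' by have := enum_valP (widen_ord cardJ i); rewrite inE.
have /fin_all_exists[r hr] : forall i : 'I_d, exists r, s' r = inl (l i).
  by move=> i; have /codomP[r ->] := lJ i; exists r.
exists l; apply/(@freeP _ _ d.+1 [tuple of _ :: _]) => k.
rewrite big_ord_recl => k0.
pose x : 'rV[K]_#|{: T}| := k ord0 *: delta_mx 0 r0 + \sum_(i < d) k (lift ord0 i) *: delta_mx 0 (r i).
have x0 : x = 0.
  apply: (row_free_inj fs'); rewrite mul0mx mulmxDl mulmx_suml -scalemxAl -rowE.
  under eq_bigr do rewrite -scalemxAl -rowE.
  apply/rowP => y; rewrite !mxE r0E summxE /=.
  have := congr1 (fun z : W => vsval z (enum_val y)) k0.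
  rewrite linearD linearZ linear0 !ffunE /= => e; rewrite -[RHS]e; congr (_ + _).
  rewrite linear_sum sum_ffunE; apply: eq_bigr => i _; rewrite !mxE hr linearZ ffunE /=.
  by rewrite add0n (nth_map i) ?size_enum_ord // nth_ord_enum vsval_tangentW.
have r_inj i j : r i = r j -> i = j.
  by move=> e; apply: l_inj; have := hr i; rewrite e hr => -[].
have r_ne i : (r0 == r i) = false.
  by apply/eqP => e; have := hr i; rewrite -e r0E.
move=> i; case: (unliftP ord0 i) => [j|] ->.
  have /rowP/(_ (r j)) := x0; rewrite !mxE summxE (bigD1 j) //= !mxE !eqxx /= mulr1.
  rewrite eq_sym r_ne mulr0 add0r big1 ?addr0 // => j' ne; rewrite !mxE /=.
  by case: eqP => [/r_inj e|]; [rewrite e eqxx in ne|rewrite mulr0].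
have /rowP/(_ r0) := x0; rewrite !mxE summxE !eqxx /= mulr1 big1 ?addr0 // => j _.
by rewrite !mxE r_ne mulr0.
Qed.

End TangentChain.

Section TangentChain.
Variables (K : numFieldType) (n : nat).
Local Notation T := ('I_n * 'I_n * 'I_n)%type.
Local Notation W := (subvs_of (schur21 K n)).
Local Notation tensor3 := {ffun 'I_n * 'I_n * 'I_n -> K^o}.
Implicit Type (c : config K).

Lemma triZ_sum (I : finType) (x : I -> K) (a : I -> nat -> K) (b d : nat -> K) :
  (tri n (fun z => \sum_i x i * a i z) b d = \sum_i x i *: tri n (a i) b d) *
  (tri n b (fun z => \sum_i x i * a i z) d = \sum_i x i *: tri n b (a i) d) *
  (tri n b d (fun z => \sum_i x i * a i z) = \sum_i x i *: tri n b d (a i)).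
Proof.
split; [split|]; apply/ffunP => q; rewrite sum_ffunE !ffunE.
- by rewrite mulr_suml mulr_sumr -sumrB mulr_sumr; apply: eq_bigr => i _;
    rewrite !ffunE /GRing.scale /=; ring.
- by rewrite mulr_suml; apply: eq_bigr => i _; rewrite !ffunE /GRing.scale /=; ring.
- by rewrite mulr_sumr mulr_suml -sumrB mulr_sumr; apply: eq_bigr => i _;
    rewrite !ffunE /GRing.scale /=; ring.
Qed.

(** Move the points of c along the d chosen coordinate directions. As [phi] is cubic, the sum
    expands into its value at c, the combination of tangent vectors, and terms of order 2 and 3. *)
Lemma tangent_chain s c d (l : 'I_d -> 'I_s * bool * 'I_n) (X : proj W -> Prop) :
  (forall p, @secant_points K n s p -> X p) ->
  free (@secant_point K n s c :: [tuple tangentW n c (l i).1.1 (l i).1.2 (l i).2 | i < d]) ->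
  exists Y, irreducible_chain X d Y.
Proof.
move=> hX hfree.
pose hit (i : 'I_d) (p : nat) (b : bool) : K := ((p == (l i).1.1) && (b == (l i).1.2))%:R.
pose dir (x : 'I_d -> K) (p : nat) (b : bool) (z : nat) : K :=
  \sum_i x i * (hit i p b * evec K (l i).2 z).
pose move_c (x : 'I_d -> K) : config K := fun _ p b z => c 0%N p b z + dir x p b z.
pose Theta x := @secant_point K n s (move_c x).
have Theta0 : Theta (fun=> 0) = secant_point n s c.
  apply: eq_bigr => p _; apply: subvs_inj; rewrite !vsval_phiW; apply: eq_phi => i;
  by rewrite /move_c /dir big1 ?addr0 // => j _; rewrite mul0r.
apply: (@chain_exists K W X d Theta (fun i => tangentW n c (l i).1.1 (l i).1.2 (l i).2)).
- move=> i.
  have mp p b z : polyfun (fun a : 'I_d -> K => move_c a p p b z).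
    apply: polyfunD; first exact: polyfun_cst.
    by apply: polyfun_sum => j; apply: polyfunM; [apply: polyfun_var|apply: polyfun_cst].
  have [P hP] : polyfun (fun a => \sum_(p < s) coord (vbasis {:W}) i
      (phiW n (move_c a 0%N p false) (move_c a 0%N p true))).
    apply: polyfun_sum => p; apply: polyfun_vsproj => q.
    by apply: polyfun_tri => j; apply: mp.
  by exists P => a; rewrite -hP linear_sum.
- by rewrite Theta0.
- move=> x; pose v (p : 'I_s) := c 0%N p false; pose w (p : 'I_s) := c 0%N p true.
  pose v' (p : 'I_s) := dir x p false; pose w' (p : 'I_s) := dir x p true.
  pose r1 p : tensor3 := tri n (v' p) (v' p) (w p) + tri n (v' p) (v p) (w' p) + tri n (v p) (v' p) (w' p).
  exists (vsproj _ (\sum_p r1 p)), (vsproj _ (\sum_p tri n (v' p) (v' p) (w' p))) => e.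
  rewrite Theta0.
  have lin p : \sum_i x i *: (if p == (l i).1.1 then dphi_tensor n (v p) (w p) (l i).1.2 (l i).2 else 0)
      = tri n (v' p) (v p) (w p) + tri n (v p) (v' p) (w p) + tri n (v p) (v p) (w' p) :> tensor3.
    rewrite /v' /w' /dir !triZ_sum -!big_split; apply: eq_bigr => i _ /=.
    rewrite -!scalerDr; congr (_ *: _); apply/ffunP => q; rewrite /hit -(val_eqE p) /=.
    have [ep|np] := eqVneq (val p) (val (l i).1.1); last first.
      by rewrite !ffunE /=; ring.
    rewrite /= !ffunE /dphi /evec; case: (l i).1.2 => /=; ring.
  have -> : \sum_i x i *: tangentW n c (l i).1.1 (l i).1.2 (l i).2 =
      vsproj _ (\sum_p (tri n (v' p) (v p) (w p) + tri n (v p) (v' p) (w p) + tri n (v p) (v p) (w' p))).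
    under [in RHS]eq_bigr do rewrite -lin.
    rewrite exchange_big linear_sum; apply: eq_bigr => i _.
    rewrite -scaler_sumr linearZ; congr (_ *: _).
    rewrite (bigD1 (l i).1.1) //= eqxx big1 ?addr0 // => p /negPf ne.
    by rewrite ne.
  have sp cc : secant_point n s cc = vsproj _ (\sum_(p < s) phi n (cc 0%N p false) (cc 0%N p true)).
    by rewrite /secant_point linear_sum.
  rewrite /Theta !sp -!linearZ -!linearD; congr vsproj.
  rewrite !scaler_sumr -!big_split; apply: eq_bigr => p _ /=.
  have de b z : dir (fun i => e * x i) p b z = e * dir x p b z.
    by rewrite /dir mulr_sumr; apply: eq_bigr => i _; rewrite -mulrA.
  apply/ffunP => q; rewrite !ffunE /move_c !de /v' /w' /v /w /GRing.scale /=; ring.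
- move=> a a0; apply: hX; exists (move_c a); split=> //.
Qed.

End TangentChain.

(** * Dimensions of the secant varieties *)

Lemma sum_consecutive n : (3 * \sum_(i < n) i * i.+1 = n * (n - 1) * (n + 1))%N.
Proof.
elim: n => [|n IH]; first by rewrite big_ord0.
rewrite big_ord_recr /= mulnDr IH; case: n {IH} => [//|n]; rewrite !subn1 /=; nia.
Qed.

Lemma card_geq_ord n m : #|[set j : 'I_n | (m <= j)%N]| = (n - m)%N.
Proof.
rewrite -sum1_card (eq_bigl (fun j : 'I_n => (m <= j)%N)) => [|j]; last by rewrite inE.
rewrite -(big_mkord (fun j => m <= j)%N (fun=> 1%N)) big_mkcond /=.
elim: n => [|n IH]; first by rewrite big_geq.
by rewrite big_nat_recr //= IH; case: leqP; lia.
Qed.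

Lemma card_schur_index n : (3 * #|schur_index n| = n * (n - 1) * (n + 1))%N.
Proof.
rewrite -sum_consecutive; congr (3 * _)%N.
pose F (i : 'I_n) := [set q : 'I_n * 'I_n | (i <= q.1)%N && (i < q.2)%N].
have cF i : #|F i| = ((n - i) * (n - i).-1)%N.
  have -> : F i = setX [set j : 'I_n | (i <= j)%N] [set k : 'I_n | (i < k)%N].
    by apply/setP => q; rewrite !inE.
  by rewrite cardsX !card_geq_ord subnS.
have -> : #|schur_index n| = (\sum_(i < n) #|F i|)%N.
  rewrite -sum1_card (eq_bigr (fun i => \sum_(q in F i) 1)%N) => [|i _]; last by rewrite sum1_card.
  pose h (z : 'I_n * ('I_n * 'I_n)) : 'I_n * 'I_n * 'I_n := (z.1, z.2.1, z.2.2).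
  rewrite pair_big_dep /= (reindex h) /=; last first.
    by exists (fun q => (q.1.1, (q.1.2, q.2))) => [[i [j k]]|[[i j] k]].
  by apply: eq_bigl => -[i [j k]]; rewrite !inE.
under eq_bigr do rewrite cF.
rewrite (reindex_inj rev_ord_inj); apply: eq_bigr => i _ /=.
by rewrite subKn // mulnC.
Qed.

Section Dimension.
Variables (K : numFieldType) (n : nat).
Hypothesis n2 : (1 < n)%N.
Local Notation W := (subvs_of (schur21 K n)).
Local Notation b := #|schur_index n|.

Lemma dim_schur_le : (\dim {:W} <= b)%N.
Proof.
pose M : 'M[K]_(\dim {:W}, b) := \matrix_(i, j) vsval (vbasis {:W})`_i (enum_val j).
suff /eqP <- : row_free M by apply: rank_leq_col.
apply: inj_row_free => x xM.
have x0 : \sum_i x 0 i *: (vbasis {:W})`_i = 0.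
  apply: subvs_inj; rewrite linear0; apply: schur21_eq0 => [|i j k hb]; first exact: subvsP.
  have hq : (i, j, k) \in schur_index n by rewrite inE.
  have := congr1 (fun B : 'M_(_, _) => B 0 (enum_rank_in hq (i, j, k))) xM.
  rewrite !mxE => e; rewrite -[RHS]e linear_sum sum_ffunE; apply: eq_bigr => z _.
  by rewrite linearZ ffunE mxE enum_rankK_in.
have /freeP h : free (vbasis {:W}) by apply: basis_free (vbasisP _).
by apply/rowP => i; rewrite mxE; apply: (h (fun i => x 0 i)).
Qed.

Section Variety.
Variables (s : nat) (X : proj W -> Prop).
Hypothesis s0 : (0 < s)%N.
Hypothesis X_secant : forall p, @secant_points K n s p -> X p.
Hypothesis X_dense : forall f, homogeneous f ->
  (forall q, @secant_points K n s q -> vanish f q) -> forall p, X p -> vanish f p.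

Lemma lower_chain sf m d : exists0 K n sf m -> (d + (m + (sf - s) * (2 * n - 2)) < b)%N ->
  exists Y, irreducible_chain X d Y.
Proof.
move=> [E [sE bE ex]] db.
have [c [E' [sE' tot c0]]] := generic_config n2 s0 bE ex.
have [|l fl] := @free_tangents K n n2 s E' c d tot c0; first by rewrite sE' sE.
exact: tangent_chain fl.
Qed.

Lemma b_gt0 : (0 < b)%N.
Proof. by have := card_schur_index n; nia. Qed.

(** In a square system every subset of the points imposes independent conditions, so the chain
    reaches the parameter count. *)
Lemma independent_dim sf m : (s <= sf)%N -> exists0 K n sf m ->
  (m + sf * (2 * n - 2) = b)%N ->
  has_dim X (s * (2 * n - 2) - 1) /\ (s * (2 * n - 2) <= b)%N.
Proof.
move=> ss ex eb.
have le : (sf * (2 * n - 2) = s * (2 * n - 2) + (sf - s) * (2 * n - 2))%N.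
  by rewrite -mulnDl subnKC.
have pos : (0 < s * (2 * n - 2))%N by rewrite muln_gt0 s0 andTb; lia.
move: (s * _)%N ((sf - s) * _)%N (sf * _)%N le pos eb (@lower_chain sf m)
  (fun e Y => @points_bound _ _ n2 _ _ X_dense e Y s0) => A B C le pos eb lower bound.
split; last by lia.
split; first by apply: (lower _ ex); lia.
by move=> e Y; apply: bound.
Qed.

(** Already s' points have tangent spaces spanning the whole module, so the chain reaches the
    ambient dimension. *)
Lemma spanning_dim s' : (s' <= s)%N -> exists0 K n s' 0 ->
  has_dim X (b - 1) /\ (b <= s * (2 * n - 2))%N.
Proof.
move=> ss ex; have b0 := b_gt0.
have ch : exists Y, irreducible_chain X (b - 1) Y.
  by apply: lower_chain ex _; rewrite (eqP (ss : s' - s == 0)%N); lia.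
split; last first.
  have [Y chY] := ch; have := points_bound n2 X_dense s0 chY.
  have pos : (0 < s * (2 * n - 2))%N by rewrite muln_gt0 s0 andTb; lia.
  lia.
split=> // e Y chY; apply: leq_trans (ambient_bound chY) _.
by apply: leq_sub2r; apply: dim_schur_le.
Qed.

End Variety.
End Dimension.

Section Values.
Variable K : numFieldType.

Lemma exists0_span n : (2 < n)%N -> exists s, exists0 K n s 0.
Proof.
move=> n3; have [n5|] := ltnP 4 n.
  by have [s [s' [m [_ h _ _]]]] := determined_points K n5; exists s'.
move=> n4; have [->|->] : n = 3 \/ n = 4 by lia.
  by exists 3, [::]; split=> //; apply: base0_3_3.
by exists 4, [::]; split=> //; apply: base0_4_4.
Qed.

(** The semistandard coordinates bound the dimension from above. From below, a spanning
    configuration yields a chain of length one less than their number, which the ambient space must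
    accommodate. *)
Lemma dim_schur n : (2 < n)%N -> \dim (schur21 K n) = #|schur_index n|.
Proof.
move=> n3; have n2 : (1 < n)%N by lia.
have -> : \dim (schur21 K n) = \dim {:subvs_of (schur21 K n)} by rewrite dimvf.
apply/eqP; rewrite eqn_leq dim_schur_le /=.
have [s ex] := exists0_span n3.
have b1 : (1 < #|schur_index n|)%N by have := card_schur_index n; nia.
(* The number of points is raised to s + 1 only to make it positive. *)
have H : (#|schur_index n| - 1 + (0 + (s - s.+1) * (2 * n - 2)) < #|schur_index n|)%N.
  by rewrite (eqP (leqnSn s : s - s.+1 == 0)%N) mul0n; lia.
have [Y chY] := @lower_chain K n n2 s.+1 (@secant_points K n s.+1) isT (fun _ h => h) s 0 _ ex H.
have := ambient_bound chY; move: (\dim _) => D.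
by move: #|schur_index n| b1 => B b1; lia.
Qed.

Definition secant_dim (n s : nat) : nat :=
  (if ((n, s) == (3, 2)) || ((n, s) == (4, 3))
   then minn (\dim (schur21 K n)) (s * (2 * n - 2)) - 2
   else minn (\dim (schur21 K n)) (s * (2 * n - 2)) - 1)%N.

(** X may be any set between the sums of s points and their closure, which covers the flag variety
    and the secant variety at once. For n > 4 either s is at most the number of points in the square
    system, or it reaches the spanning number, which is at most one larger. *)
Lemma has_secant_dim n s (X : proj (subvs_of (schur21 K n)) -> Prop) :
  (2 < n)%N -> (0 < s)%N ->
  (forall p, @secant_points K n s p -> X p) ->
  (forall f, homogeneous f ->
     (forall q, @secant_points K n s q -> vanish f q) -> forall p, X p -> vanish f p) ->
  has_dim X (secant_dim n s).
Proof.
move=> n3 s0 hX dense; rewrite /secant_dim dim_schur //.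
have n2 : (1 < n)%N by lia.
have cb := card_schur_index n.
have indep sf m : (s <= sf)%N -> exists0 K n sf m ->
    (m + sf * (2 * n - 2) = #|schur_index n|)%N -> has_dim X (minn #|schur_index n| (s * (2 * n - 2)) - 1)%N.
  by move=> ss ex e; have [h le] := independent_dim n2 s0 hX dense ss ex e; rewrite (minn_idPr le).
have span s' : (s' <= s)%N -> exists0 K n s' 0 ->
    has_dim X (minn #|schur_index n| (s * (2 * n - 2)) - 1)%N.
  by move=> ss ex; have [h le] := spanning_dim n2 s0 hX dense ss ex; rewrite (minn_idPl le).
have [n5|n4] := ltnP 4 n.
  have -> : ((n, s) == (3, 2)%N) || ((n, s) == (4, 3)%N) = false.
    by rewrite !xpair_eqE; lia.
  have [sf [s' [m [ex ex' ss eb]]]] := determined_points K n5.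
  have eb' : (m + sf * (2 * n - 2) = #|schur_index n|)%N.
    by apply/eqP; rewrite -(eqn_pmul2l (m := 3)) // eb cb mulnC mulnA.
  have [le|gt] := leqP s sf; first exact: indep ex eb'.
  by apply: span ex'; lia.
have [en|en] : n = 3 \/ n = 4 by lia.
  subst n; have b8 : #|schur_index 3| = 8.
    by move: cb; move: #|schur_index 3| => B; lia.
  case: s s0 hX dense indep span => [//|[|[|s]]] _ hX dense indep span.
  - apply: (indep 1 4) => //.
    exists [:: (0, 0, 1); (0, 0, 2); (0, 1, 1); (0, 1, 2)]%N; split=> //; last exact: base0_3_1.
    by move=> t; rewrite !inE => /or4P[]/eqP->.
  - rewrite /= b8; split; last exact: (exceptional_bound3 dense).
    (* The two points leave a line of forms instead of 0, cut out by one coordinate: 6 + 1 < 8. *)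
    apply: (lower_chain (s := 2) n2 isT hX (sf := 2) (m := 1)); last by rewrite b8.
    exists [:: (0, 1, 2)]%N; split=> //; last exact: base0_3_2.
    by move=> t; rewrite !inE => /eqP->.
  - apply: (span 3) => //; exists [::]; split=> //; exact: base0_3_3.
subst n; have b20 : #|schur_index 4| = 20.
  by move: cb; move: #|schur_index 4| => B; lia.
have ex2 : exists0 K 4 2 8.
  exists [:: (0, 2, 2); (0, 3, 2); (1, 2, 2); (1, 2, 3); (1, 3, 2); (1, 3, 3);
              (2, 2, 3); (2, 3, 3)]%N; split=> //; last exact: base0_4_2.
  by apply/allP.
case: s s0 hX dense indep span => [//|[|[|[|s]]]] _ hX dense indep span.
- exact: (indep 2 8).
- exact: (indep 2 8).
- rewrite /= b20; split; last exact: (exceptional_bound4 dense).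
  (* The three points leave a space of forms of dimension 3 instead of 2: 16 + 3 < 20. *)
  apply: (lower_chain (s := 3) n2 isT hX (sf := 3) (m := 3)); last by rewrite b20.
  exists [:: (0, 3, 3); (1, 3, 3); (2, 3, 3)]%N; split=> //; last exact: base0_4_3.
  by apply/allP.
- apply: (span 4) => //; exists [::]; split=> //; exact: base0_4_4.
Qed.

Lemma has_dim_uniq (W : vectType K) (X : proj W -> Prop) d d' :
  has_dim X d -> has_dim X d' -> d = d'.
Proof.
move=> [[Y chY] h] [[Y' chY'] h']; apply/eqP; rewrite eqn_leq.
by rewrite (h' _ _ chY) (h _ _ chY').
Qed.

(** The dimension of the flag variety is the case s = 1. Since dimensions are unique, being
    defective becomes a comparison of two explicit numbers. *)
Lemma secant_dimension_theorem n s : (3 <= n)%N -> (1 <= s)%N ->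
  has_dim (secant_variety s (@flag_variety21 K n)) (secant_dim n s) /\
  (defective s (@flag_variety21 K n) <-> (n, s) = (3, 2)%N \/ (n, s) = (4, 3)%N).
Proof.
move=> n3 s0; have n2 : (1 < n)%N by lia.
have dS : has_dim (secant_variety s (@flag_variety21 K n)) (secant_dim n s).
  apply: has_secant_dim => // [p hp|f hf hX p].
    by apply/(secant_varietyP n2) => Z _; apply.
  by move=> /(secant_varietyP n2) /closure_vanish; apply.
have dF : has_dim (@flag_variety21 K n) (2 * n - 3).
  have -> : (2 * n - 3 = secant_dim n 1)%N.
    have le : (1 * (2 * n - 2) <= #|schur_index n|)%N.
      by move: (card_schur_index n); move: #|schur_index n| => B; nia.
    have -> : secant_dim n 1 = (minn #|schur_index n| (1 * (2 * n - 2)) - 1)%N.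
      by rewrite /secant_dim dim_schur // !xpair_eqE !andbF.
    by rewrite (minn_idPr le); lia.
  apply: has_secant_dim => // [p|f hf hX p]; first by move/(flag_variety_points n2).
  by move/(flag_variety_points n2); apply: hX.
split=> //.
have expE : expected_dim (subvs_of (schur21 K n)) s (2 * n - 3) =
    (minn #|schur_index n| (s * (2 * n - 2)) - 1)%N.
  have dW : \dim {:subvs_of (schur21 K n)} = #|schur_index n| by rewrite -(dim_schur n3) dimvf.
  have e : (2 * n - 3 + 1 = 2 * n - 2)%N by lia.
  by rewrite /expected_dim e dW minnC -subn_minl.
have cb := card_schur_index n.
split=> [[dF' [d [hF hd lt]]]|exc].
  have e1 := has_dim_uniq hF dF; have e2 := has_dim_uniq hd dS; subst dF' d.
  move: lt; rewrite expE /secant_dim dim_schur //; case: ifP => [/orP[]/eqP->|]; [by left|by right|].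
  by rewrite ltnn.
exists (2 * n - 3)%N, (secant_dim n s); split=> //.
rewrite expE /secant_dim dim_schur //.
case: exc cb => -[en es]; subst n s => cb.
  have -> : #|schur_index 3| = 8 by move: cb; move: #|schur_index 3| => B; lia.
  by [].
have -> : #|schur_index 4| = 20 by move: cb; move: #|schur_index 4| => B; lia.
by [].
Qed.

End Values.

Local Close Scope ring_scope.

Theorem theorem6p12 (R : realType) (n s : nat)
    (hn : (3 <= n)%N) (hs : (1 <= s)%N) :
  has_dim (secant_variety s (@flag_variety21 R[i] n))
    (if ((n, s) == (3, 2)) || ((n, s) == (4, 3))
     then minn (\dim (schur21 R[i] n)) (s * (2 * n - 2)) - 2
     else minn (\dim (schur21 R[i] n)) (s * (2 * n - 2)) - 1)%N
  /\ (defective s (@flag_variety21 R[i] n) <->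
      (n, s) = (3, 2)%N \/ (n, s) = (4, 3)%N).
Proof. exact: (@secant_dimension_theorem R[i] n s hn hs). Qed.
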